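(* Let $U\subseteq\mathbb{R}^m$ be finite, let $p:\widetilde{\mathcal{U}}_{pc}\to\mathbb{R}^r$ be a response map on an admissible set of inputs $\widetilde{\mathcal{U}}_{pc}$, having an extension to negative times, and let $\Sigma=(X\subseteq\mathbb{R}^n,f,h,x_0)$ be a local Nash realization of $p$. Let $\epsilon>0$. Then the following steps can be carried out, and the system $\Sigma_V$ produced in Step 4 is a semi-algebraically reachable local Nash realization of $p_u$, where $u\in\widetilde{\mathcal{U}}_{pc}\cap\widetilde{\mathcal{U}}_{pc}(\Sigma)$ and $T_u<\epsilon$. Step 1. Let $I$ be the ideal of functions in $\mathcal{N}(X)$ vanishing on $\mathcal{R}(x_0)$. Choose $\varphi_1,\dots,\varphi_d\in\mathcal{N}(X)$ whose classes form a transcendence basis of $\mathcal{N}(X)/I$ over $\mathbb{R}$, and put $\Phi=(\varphi_1,\dots,\varphi_d)$. Step 2. Let $\pi_1,\dots,\pi_n$ be the coordinate functions on $X$. Find non-zero polynomials $Q_i\in\mathbb{R}[T,T_1,\dots,T_d]$, $i=1,\dots,n$, of smallest possible degree with $Q_i(\pi_i,\Phi)=0$ on $\mathcal{R}(x_0)$, and an input $u\in\widetilde{\mathcal{U}}_{pc}(\Sigma)\cap\widetilde{\mathcal{U}}_{pc}$ with $T_u<\epsilon$ such that $\frac{dQ_i}{dT}\big(\pi_i(x_\Sigma(T_u;x_0,u)),\Phi(x_\Sigma(T_u;x_0,u))\big)\neq0$ for $i=1,\dots,n$. Step 3. By applying the implicit function theorem (to the $Q_i$ near $x_\Sigma(T_u;x_0,u)$),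 find an open connected semi-algebraic set $V\subseteq\mathbb{R}^d$, an open semi-algebraic set $W\subseteq X\subseteq\mathbb{R}^n$ and a Nash map $G:V\to W$ such that (1) $\Phi(x_\Sigma(T_u;x_0,u))\in V$ and $x_\Sigma(T_u;x_0,u)\in W$; (2) $G(\Phi(x_\Sigma(T_{uv};x_0,uv)))=x_\Sigma(T_{uv};x_0,uv)$ for every $v$ such that $x_\Sigma(T_u+t;x_0,uv)\in W$ for all $t\in[0,T_v]$. Step 4. Set $\Sigma_V=(V,f^V,h^V,x_0^V)$, where $f^V_\alpha(z)=D\Phi(G(z))f_\alpha(G(z))$ and $h^V(z)=h(G(z))$ for $z\in V$, $\alpha\in U$, and $x_0^V=\Phi(x_\Sigma(T_u;x_0,u))$.
   Context: **Inputs.** $\mathcal{U}_{pc}$ is the set of piecewise-constant inputs $u=(\alpha_1,t_1)\cdots(\alpha_k,t_k)$ with values $\alpha_i\in U$ and durations $t_i\in[0,\infty)$, regarded as piecewise-constant functions on $[0,T_u]$, $T_u=\sum_i t_i$ (so $(\alpha,0)$ may be deleted and $(\alpha,s)(\alpha,t)=(\alpha,s+t)$); $uv$ is concatenation. A nonempty subset $\widetilde{\mathcal{U}}_{pc}\subseteq\mathcal{U}_{pc}$ is an admissible set of inputs if: (i) for all $u\in\widetilde{\mathcal{U}}_{pc}$, $t\in[0,T_u]$, the restriction $u_{[0,t]}\in\widetilde{\mathcal{U}}_{pc}$; (ii) for all $u\in\widetilde{\mathcal{U}}_{pc}$, $\alpha\in U$ there is $t>0$ with $u(\alpha,t)\in\widetilde{\mathcal{U}}_{pc}$;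 (iii) for all $u=(\alpha_1,t_1)\cdots(\alpha_k,t_k)\in\widetilde{\mathcal{U}}_{pc}$ there is $\delta>0$ such that $(\alpha_1,\bar t_1)\cdots(\alpha_k,\bar t_k)\in\widetilde{\mathcal{U}}_{pc}$ for all $\bar t_i\in[0,t_i+\delta]$. **Response maps.** A map $p:\widetilde{\mathcal{U}}_{pc}\to\mathbb{R}^r$ is a response map if for all $k>0$, $\alpha_1,\dots,\alpha_k\in U$, the map $(t_1,\dots,t_k)\mapsto p((\alpha_1,t_1)\cdots(\alpha_k,t_k))$ is (componentwise) analytic on the set of those $(t_1,\dots,t_k)\in[0,\infty)^k$ with $(\alpha_1,t_1)\cdots(\alpha_k,t_k)\in\widetilde{\mathcal{U}}_{pc}$. For $u\in\widetilde{\mathcal{U}}_{pc}$, let $\widetilde{\mathcal{U}}_{pc}^u=\{v\in\widetilde{\mathcal{U}}_{pc}\mid uv\in\widetilde{\mathcal{U}}_{pc}\}$ and $p_u:\widetilde{\mathcal{U}}_{pc}^u\to\mathbb{R}^r$, $p_u(v)=p(uv)$; this is again a response map. **Extension to negative times.** $\mathcal{U}_{pc}^-$ is the set of generalized inputs $(\alpha_1,t_1)\cdots(\alpha_k,t_k)$ with $\alpha_i\in U$, $t_i\in\mathbb{R}$. Let $I(0,a)=[0,a]$ if $a\ge0$ and $[a,0]$ if $a<0$. A nonempty $\overline{\mathcal{U}}_{pc}\subseteq\mathcal{U}_{pc}^-$ is an admissible set of generalized inputs if: (i) for $u=(\alpha_1,t_1)\cdots(\alpha_k,t_k)\in\overline{\mathcal{U}}_{pc}$,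 each $i$ and $t\in I(0,t_i)$, $(\alpha_1,t_1)\cdots(\alpha_{i-1},t_{i-1})(\alpha_i,t)\in\overline{\mathcal{U}}_{pc}$; (ii) for $u\in\overline{\mathcal{U}}_{pc}$, $\alpha\in U$ there is $\delta>0$ with $u(\alpha,t)\in\overline{\mathcal{U}}_{pc}$ for all $t\in(-\delta,\delta)$; (iii) for $u=(\alpha_1,t_1)\cdots(\alpha_k,t_k)\in\overline{\mathcal{U}}_{pc}$ there is $\delta>0$ with $(\alpha_1,\bar t_1)\cdots(\alpha_k,\bar t_k)\in\overline{\mathcal{U}}_{pc}$ for all $\bar t_i\in I(0,\mathrm{sgn}(t_i)(|t_i|+\delta))$. A map $\bar p:\overline{\mathcal{U}}_{pc}\to\mathbb{R}^r$ is a generalized response map if each component is analytic in $(t_1,\dots,t_k)$ for each fixed $\alpha_1,\dots,\alpha_k$ (on the set of tuples in $\mathbb{R}^k$ giving elements of $\overline{\mathcal{U}}_{pc}$) and satisfies $\bar p(u(\alpha,0)v)=\bar p(uv)$ and $\bar p(u(\alpha,t_1)(\alpha,t_2)v)=\bar p(u(\alpha,t_1+t_2)v)$ whenever these generalized inputs lie in $\overline{\mathcal{U}}_{pc}$. A response map $p:\widetilde{\mathcal{U}}_{pc}\to\mathbb{R}^r$ has an extension to negative times if there are an admissible set of generalized inputs $\overline{\mathcal{U}}_{pc}\supseteq\widetilde{\mathcal{U}}_{pc}$ and a generalized response map $\bar p:\overline{\mathcal{U}}_{pc}\to\mathbb{R}^r$ with $\bar p|_{\widetilde{\mathcal{U}}_{pc}}=p$.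 **Nash systems.** A Nash function on an open semi-algebraic $X\subseteq\mathbb{R}^n$ is an analytic semi-algebraic function $X\to\mathbb{R}$; $\mathcal{N}(X)$ is the ring of these; an $\mathbb{R}^k$-valued map is Nash if its components are. A Nash system $\Sigma=(X,f,h,x_0)$ with input space $U$ and output space $\mathbb{R}^r$ consists of an open connected semi-algebraic $X\subseteq\mathbb{R}^n$, $f:X\times U\to\mathbb{R}^n$ with $f_\alpha=f(\cdot,\alpha)$ Nash for every $\alpha\in U$, a Nash map $h:X\to\mathbb{R}^r$, and an initial state $x_0\in X$; the dynamics is $\dot x(t)=f(x(t),u(t))$, $x(0)=x_0$. $\widetilde{\mathcal{U}}_{pc}(\Sigma)$ is the largest admissible set of inputs $u\in\mathcal{U}_{pc}$ for which there is a unique trajectory $x_\Sigma(\cdot;x_0,u):[0,T_u]\to X$ of $\Sigma$. $\Sigma$ is a local (Nash) realization of a response map $p:\widetilde{\mathcal{U}}_{pc}\to\mathbb{R}^r$ if $p(u)=h(x_\Sigma(T_u;x_0,u))$ for all $u\in\widetilde{\mathcal{U}}_{pc}\cap\widetilde{\mathcal{U}}_{pc}(\Sigma)$. **Reachability.** $\mathcal{R}(x_0)=\{x_\Sigma(T_u;x_0,u)\mid u\in\widetilde{\mathcal{U}}_{pc}(\Sigma)\}$. $\Sigma$ is semi-algebraically reachable if every $g\in\mathcal{N}(X)$ vanishing on $\mathcal{R}(x_0)$ is zero. $D\Phi$ denotes the Jacobian matrix of $\Phi$. *)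

(* Defs.v *)
From HB Require Import structures.
From mathcomp Require Import all_boot all_order all_algebra.
From mathcomp Require Import all_classical all_reals all_analysis.
From mathcomp Require Import (canonicals, coercions) mpoly.

Set Implicit Arguments.
Unset Strict Implicit.
Unset Printing Implicit Defensive.

Import Order.TTheory GRing.Theory Num.Theory.
Import numFieldNormedType.Exports.

Local Open Scope classical_set_scope.
Local Open Scope ring_scope.

Definition peval (R : realType) (n : nat) (P : mpoly.mpoly n R) (x : 'rV[R]_n) : R :=
  mpoly.meval (x ord0) P.

(* [Q(t, z)] for [Q] in [R[T, T_1, ..., T_d]]; [T] is the variable of index 0. *)
Definition peval_at (R : realType) (d : nat) (Q : mpoly.mpoly (1 + d) R)
    (t : R) (z : 'rV[R]_d) : R :=
  peval Q (row_mx (t%:M : 'rV[R]_1) z).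

Definition dT (R : realType) (d : nat) (Q : mpoly.mpoly (1 + d) R) :
    mpoly.mpoly (1 + d) R :=
  mpoly.mderiv (lshift d ord0) Q.

(* Finite unions of sets {P_1 = ... = P_k = 0, Q_1 > 0, ..., Q_l > 0}. *)
Definition semialgebraic (R : realType) (n : nat) (S : set 'rV[R]_n) : Prop :=
  exists F : seq (seq (mpoly.mpoly n R) * seq (mpoly.mpoly n R)),
    S = [set x | has (fun c => all (fun P => peval P x == 0) c.1 &&
                               all (fun P => 0 < peval P x) c.2) F].

(* Functions on a subset [D] of R^n are total functions whose values outside
   [D] are irrelevant. *)
Definition graph_on (R : realType) (n : nat) (D : set 'rV[R]_n)
    (g : 'rV[R]_n -> R) : set 'rV[R]_(n + 1) :=
  [set row_mx x ((g x)%:M : 'rV[R]_1) | x in D].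

Definition monomial (R : realType) (n : nat) (nu : {ffun 'I_n -> nat})
    (x : 'rV[R]_n) : R :=
  \prod_(i < n) x ord0 i ^+ nu i.

(* Around each point of [D], [g] coincides on [D] with the sum of a power
   series converging absolutely on an open polydisc.  For open [D] this is
   analyticity on [D]; for general [D], existence of local analytic
   extensions. *)
Definition analytic_on (R : realType) (n : nat) (D : set 'rV[R]_n)
    (g : 'rV[R]_n -> R) : Prop :=
  forall a, D a ->
  exists (c : {ffun 'I_n -> nat} -> R) (rho : R), 0 < rho /\
    forall x : 'rV[R]_n, (forall i, `|x ord0 i - a ord0 i| < rho) ->
      summable setT (fun nu => (c nu * monomial nu (x - a))%:E) /\
      (D x ->
        (fun N : nat => \sum_(nu : {ffun 'I_n -> 'I_N})
           let mu := [ffun i => nu i : nat] in c mu * monomial mu (x - a))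
        @ \oo --> g x).

Definition nash (R : realType) (n : nat) (X : set 'rV[R]_n)
    (g : 'rV[R]_n -> R) : Prop :=
  analytic_on X g /\ semialgebraic (graph_on X g).

Definition nash_map (R : realType) (n k : nat) (X : set 'rV[R]_n)
    (F : 'rV[R]_n -> 'rV[R]_k) : Prop :=
  forall j, nash X (fun x => F x ord0 j).

(* A word [:: (a_1, t_1); ...; (a_k, t_k)].  Piecewise-constant inputs are
   words up to [pc_eq]; generalized inputs are words. *)
Definition word (R : realType) (m : nat) : Type := seq ('rV[R]_m * R).

Definition mk_word (R : realType) (m k : nat) (alpha : 'I_k -> 'rV[R]_m)
    (t : 'rV[R]_k) : word R m :=
  [seq (alpha i, t ord0 i) | i <- enum 'I_k].

Definition duration (R : realType) (m : nat) (u : word R m) : R :=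
  \sum_(b <- u) b.2.

Fixpoint input_at (R : realType) (m : nat) (u : word R m) (t : R) : 'rV[R]_m :=
  if u is (alpha, s) :: u' then
    if t < s then alpha else input_at u' (t - s)
  else 0.

(* Two words define the same piecewise-constant function; the value at the
   final time carries no information and is ignored. *)
Definition pc_eq (R : realType) (m : nat) (u v : word R m) : Prop :=
  duration u = duration v /\
  forall t, 0 <= t < duration u -> input_at u t = input_at v t.

Fixpoint restrict_input (R : realType) (m : nat) (u : word R m) (t : R) :
    word R m :=
  if u is (alpha, s) :: u' then
    if t <= s then [:: (alpha, t)]
    else (alpha, s) :: restrict_input u' (t - s)
  else [::].

Definition pc_inputs (R : realType) (m : nat) (U : set 'rV[R]_m) :
    set (word R m) :=
  [set u | forall b, b \in u -> U b.1 /\ 0 <= b.2].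

(* The second conjunct makes [A] a set of inputs rather than of words. *)
Definition admissible (R : realType) (m : nat) (U : set 'rV[R]_m)
    (A : set (word R m)) : Prop :=
  A `<=` pc_inputs U /\
  (forall u v, A u -> pc_inputs U v -> pc_eq u v -> A v) /\
  A !=set0 /\
  (forall u t, A u -> 0 <= t <= duration u -> A (restrict_input u t)) /\
  (forall u alpha, A u -> U alpha ->
     exists t, 0 < t /\ A (u ++ [:: (alpha, t)])) /\
  (forall k (alpha : 'I_k -> 'rV[R]_m) (t : 'rV[R]_k),
     A (mk_word alpha t) ->
     exists delta, 0 < delta /\
       forall s : 'rV[R]_k,
         (forall i, 0 <= s ord0 i <= t ord0 i + delta) ->
         A (mk_word alpha s)).

(* The first conjunct says that [p] is well defined on inputs. *)
Definition response_map (R : realType) (m r : nat) (U : set 'rV[R]_m)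
    (A : set (word R m)) (p : word R m -> 'rV[R]_r) : Prop :=
  (forall u v, A u -> A v -> pc_eq u v -> p u = p v) /\
  forall k (alpha : 'I_k -> 'rV[R]_m), (0 < k)%N -> (forall i, U (alpha i)) ->
  forall j, analytic_on [set t : 'rV[R]_k | A (mk_word alpha t)]
                        (fun t => p (mk_word alpha t) ord0 j).

Definition shift_dom (R : realType) (m : nat) (A : set (word R m))
    (u : word R m) : set (word R m) :=
  [set v | A v /\ A (u ++ v)].

Definition shift_map (R : realType) (m r : nat) (p : word R m -> 'rV[R]_r)
    (u : word R m) : word R m -> 'rV[R]_r :=
  fun v => p (u ++ v).

Definition segment0 (R : realType) (a : R) : set R :=
  if 0 <= a then [set t | 0 <= t <= a] else [set t | a <= t <= 0].

Definition gen_inputs (R : realType) (m : nat) (U : set 'rV[R]_m) :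
    set (word R m) :=
  [set u | forall b, b \in u -> U b.1].

Definition gen_admissible (R : realType) (m : nat) (U : set 'rV[R]_m)
    (B : set (word R m)) : Prop :=
  B `<=` gen_inputs U /\
  B !=set0 /\
  (forall u alpha ti v t, B (u ++ (alpha, ti) :: v) -> segment0 ti t ->
     B (u ++ [:: (alpha, t)])) /\
  (forall u alpha, B u -> U alpha ->
     exists delta, 0 < delta /\
       forall t, - delta < t < delta -> B (u ++ [:: (alpha, t)])) /\
  (forall k (alpha : 'I_k -> 'rV[R]_m) (t : 'rV[R]_k),
     B (mk_word alpha t) ->
     exists delta, 0 < delta /\
       forall s : 'rV[R]_k,
         (forall i, segment0 (Num.sg (t ord0 i) * (`|t ord0 i| + delta))
                             (s ord0 i)) ->
         B (mk_word alpha s)).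

Definition gen_response_map (R : realType) (m r : nat) (U : set 'rV[R]_m)
    (B : set (word R m)) (q : word R m -> 'rV[R]_r) : Prop :=
  (forall k (alpha : 'I_k -> 'rV[R]_m), (forall i, U (alpha i)) ->
   forall j, analytic_on [set t : 'rV[R]_k | B (mk_word alpha t)]
                         (fun t => q (mk_word alpha t) ord0 j)) /\
  (forall u alpha v, B (u ++ (alpha, 0) :: v) -> B (u ++ v) ->
     q (u ++ (alpha, 0) :: v) = q (u ++ v)) /\
  (forall u alpha t1 t2 v,
     B (u ++ (alpha, t1) :: (alpha, t2) :: v) ->
     B (u ++ (alpha, t1 + t2) :: v) ->
     q (u ++ (alpha, t1) :: (alpha, t2) :: v) = q (u ++ (alpha, t1 + t2) :: v)).

Definition has_negative_extension (R : realType) (m r : nat)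
    (U : set 'rV[R]_m) (A : set (word R m)) (p : word R m -> 'rV[R]_r) : Prop :=
  exists (B : set (word R m)) (q : word R m -> 'rV[R]_r),
    gen_admissible U B /\ A `<=` B /\ gen_response_map U B q /\
    forall u, A u -> q u = p u.

Record system (R : realType) (m n r : nat) : Type := System {
  state_space : set 'rV[R]_n;
  dynamics : 'rV[R]_m -> 'rV[R]_n -> 'rV[R]_n;
  output : 'rV[R]_n -> 'rV[R]_r;
  initial_state : 'rV[R]_n
}.

Definition nash_system (R : realType) (m n r : nat) (U : set 'rV[R]_m)
    (S : system R m n r) : Prop :=
  open (state_space S) /\ connected (state_space S) /\
  semialgebraic (state_space S) /\
  (forall alpha, U alpha -> nash_map (state_space S) (dynamics S alpha)) /\
  nash_map (state_space S) (output S) /\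
  state_space S (initial_state S).

(* Continuous on [0, T_u], and solving x' = f(x, alpha) in the interior of
   each interval on which [u] is constant, with value [alpha]. *)
Definition is_trajectory (R : realType) (m n r : nat) (S : system R m n r)
    (u : word R m) (x : R -> 'rV[R]_n) : Prop :=
  x 0 = initial_state S /\
  {within `[0, duration u], continuous x} /\
  (forall t, 0 <= t <= duration u -> state_space S (x t)) /\
  forall v alpha s w, u = v ++ (alpha, s) :: w ->
    forall t, duration v < t < duration v + s ->
      is_derive t (1 : R) x (dynamics S alpha (x t)).

Definition has_unique_trajectory (R : realType) (m n r : nat)
    (S : system R m n r) (u : word R m) : Prop :=
  exists x, is_trajectory S u x /\
    forall y, is_trajectory S u y ->
      forall t, 0 <= t <= duration u -> y t = x t.

(* Meaningful, on [0, T_u], when [has_unique_trajectory S u]. *)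
Definition trajectory (R : realType) (m n r : nat) (S : system R m n r)
    (u : word R m) : R -> 'rV[R]_n :=
  xget (fun=> 0) [set x | is_trajectory S u x].

Definition final_state (R : realType) (m n r : nat) (S : system R m n r)
    (u : word R m) : 'rV[R]_n :=
  trajectory S u (duration u).

(* A nonempty union of admissible sets of inputs is admissible (see
   [admissible_bigcup]), so the largest admissible set of inputs having a
   unique trajectory is the union of all of them. *)
Definition sys_inputs (R : realType) (m n r : nat) (U : set 'rV[R]_m)
    (S : system R m n r) : set (word R m) :=
  \bigcup_(A in [set A | admissible U A /\
                         forall u, A u -> has_unique_trajectory S u]) A.

Lemma admissible_bigcup (R : realType) (m : nat) (U : set 'rV[R]_m)
    (F : set (set (word R m))) :
  F !=set0 -> (forall A, F A -> admissible U A) ->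
  admissible U (\bigcup_(A in F) A).
Proof.
move=> [A0 FA0] FU; split; last split; last split; last split; last split.
- by move=> u [A /FU[+ _] Au]; exact.
- move=> u v [A FA Au] Uv uv; exists A => //.
  by have [_ [+ _]] := FU _ FA; exact: (fun h => h u v Au Uv uv).
- by have [_ [_ [[u A0u] _]]] := FU _ FA0; exists u; exists A0.
- move=> u t [A FA Au] tu; exists A => //.
  by have [_ [_ [_ [+ _]]]] := FU _ FA; exact.
- move=> u alpha [A FA Au] Ua.
  have [_ [_ [_ [_ [+ _]]]]] := FU _ FA.
  by move=> /(_ u alpha Au Ua)[t [t0 At]]; exists t; split => //; exists A.
- move=> k alpha t [A FA At].
  have [_ [_ [_ [_ [_ +]]]]] := FU _ FA.
  move=> /(_ k alpha t At)[delta [delta0 H]]; exists delta; split => // s hs.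
  by exists A => //; exact: H.
Qed.

Definition local_realization (R : realType) (m n r : nat) (U : set 'rV[R]_m)
    (A : set (word R m)) (p : word R m -> 'rV[R]_r) (S : system R m n r) :
    Prop :=
  nash_system U S /\
  forall u, A u -> sys_inputs U S u -> p u = output S (final_state S u).

Definition reachable (R : realType) (m n r : nat) (U : set 'rV[R]_m)
    (S : system R m n r) : set 'rV[R]_n :=
  [set final_state S u | u in sys_inputs U S].

Definition semialgebraically_reachable (R : realType) (m n r : nat)
    (U : set 'rV[R]_m) (S : system R m n r) : Prop :=
  forall g, nash (state_space S) g ->
    (forall x, reachable U S x -> g x = 0) ->
    forall x, state_space S x -> g x = 0.

Definition vanishing_ideal (R : realType) (m n r : nat) (U : set 'rV[R]_m)
    (S : system R m n r) : set ('rV[R]_n -> R) :=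
  [set g | nash (state_space S) g /\ forall x, reachable U S x -> g x = 0].

(* The classes of the components of [Phi] form a transcendence basis of
   N(X)/I over R, [I] being a prime ideal of N(X): they are algebraically
   independent over R, and every class is algebraic over them.  A polynomial
   expression is zero in N(X)/I when the corresponding function is in [I].
   Given independence, [Q <> 0] says that some coefficient of [Q], viewed as
   a polynomial in T over R[Phi], is nonzero in N(X)/I. *)
Definition transcendence_basis_mod (R : realType) (n d : nat)
    (X : set 'rV[R]_n) (I : set ('rV[R]_n -> R))
    (Phi : 'rV[R]_n -> 'rV[R]_d) : Prop :=
  nash_map X Phi /\
  (forall P : mpoly.mpoly d R, I (fun x => peval P (Phi x)) -> P = 0) /\
  forall g, nash X g ->
    exists Q : mpoly.mpoly (1 + d) R,
      Q <> 0 /\ I (fun x => peval_at Q (g x) (Phi x)).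

Definition annihilates (R : realType) (m n r d : nat) (U : set 'rV[R]_m)
    (S : system R m n r) (Phi : 'rV[R]_n -> 'rV[R]_d) (i : 'I_n)
    (P : mpoly.mpoly (1 + d) R) : Prop :=
  forall x, reachable U S x -> peval_at P (x ord0 i) (Phi x) = 0.

Definition step1 (R : realType) (m n r d : nat) (U : set 'rV[R]_m)
    (S : system R m n r) (Phi : 'rV[R]_n -> 'rV[R]_d) : Prop :=
  transcendence_basis_mod (state_space S) (vanishing_ideal U S) Phi.

(* [mpoly.msize P] is 1 + the total degree of a nonzero polynomial [P]. *)
Definition step2_polynomials (R : realType) (m n r d : nat)
    (U : set 'rV[R]_m) (S : system R m n r) (Phi : 'rV[R]_n -> 'rV[R]_d)
    (Q : 'I_n -> mpoly.mpoly (1 + d) R) : Prop :=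
  forall i,
    Q i <> 0 /\ annihilates U S Phi i (Q i) /\
    forall P : mpoly.mpoly (1 + d) R, P <> 0 -> annihilates U S Phi i P ->
      (mpoly.msize (Q i) <= mpoly.msize P)%N.

Definition step2_input (R : realType) (m n r d : nat) (U : set 'rV[R]_m)
    (A : set (word R m)) (eps : R) (S : system R m n r)
    (Phi : 'rV[R]_n -> 'rV[R]_d) (Q : 'I_n -> mpoly.mpoly (1 + d) R)
    (u : word R m) : Prop :=
  sys_inputs U S u /\ A u /\ duration u < eps /\
  forall i, peval_at (dT (Q i)) (final_state S u ord0 i)
                     (Phi (final_state S u)) <> 0.

Definition step3 (R : realType) (m n r d : nat) (U : set 'rV[R]_m)
    (S : system R m n r) (Phi : 'rV[R]_n -> 'rV[R]_d) (u : word R m)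
    (V : set 'rV[R]_d) (W : set 'rV[R]_n) (G : 'rV[R]_d -> 'rV[R]_n) : Prop :=
  open V /\ connected V /\ semialgebraic V /\
  open W /\ semialgebraic W /\ W `<=` state_space S /\
  nash_map V G /\ (forall z, V z -> W (G z)) /\
  V (Phi (final_state S u)) /\ W (final_state S u) /\
  forall v, sys_inputs U S (u ++ v) ->
    (forall t, 0 <= t <= duration v -> W (trajectory S (u ++ v) (duration u + t))) ->
    V (Phi (final_state S (u ++ v))) /\
    G (Phi (final_state S (u ++ v))) = final_state S (u ++ v).

(* ['J] is the Jacobian acting on row vectors from the right, i.e. the
   transpose of D Phi. *)
Definition step4 (R : realType) (m n r d : nat) (S : system R m n r)
    (Phi : 'rV[R]_n -> 'rV[R]_d) (u : word R m)
    (V : set 'rV[R]_d) (G : 'rV[R]_d -> 'rV[R]_n) : system R m d r :=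
  System V
    (fun alpha z => dynamics S alpha (G z) *m jacobian Phi (G z))
    (fun z => output S (G z))
    (Phi (final_state S u)).

(* Main.v *)
(** The vanishing ideal [I] is handled infinitesimally. An analytic function vanishes at the ends of
    all short inputs issued from a state exactly when all its iterated Lie derivatives along words of
    input values vanish there. This condition is transported forwards and backwards along
    trajectories: if all iterated Lie derivatives of two functions along two analytic curves agree at
    one time, they agree at all times, by the estimate [|L^k g| <= C M^k k!]. Hence [I] is prime, and
    a function outside [I] is nonzero at the end of some arbitrarily short input. This gives Steps 1
    and 2; [d <= n] because a Lipschitz image of a cube of dimension [n] contains no polydisc of
    larger dimension.

    By quantifier elimination a semialgebraic set either contains a polydisc or lies in a
    hypersurface. Applied to the zero set of a Nash function [g] on [V], with the independence of
    [Phi], it shows that [g = 0] as soon as [g] vanishes at the points [Phi x], [x] reached shortly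
    after [u]. So [Phi] is a left inverse of [G], and [Sigma_V] is semialgebraically reachable.

    [Phi] carries the trajectories issued from the state reached by [u] to those of [Sigma_V] for a
    short time, whence [p (u v) = h^V (x_V v)] for short [v]. The equality is continued letter by
    letter to all [v]: near each time, [p] has an analytic extension in the durations, the
    derivatives of the right-hand side in the durations of later letters are, at duration 0,
    iterated Lie derivatives of [h^V], and the equality of all of these with the derivatives of the
    extension is transported along the current letter as above. *)
Require Import Defs.
From HB Require Import structures.
From mathcomp Require Import all_boot all_order all_algebra.
From mathcomp Require Import all_classical all_reals all_analysis.
From mathcomp Require ordered_qelim qe_rcf.
From mathcomp Require Import (canonicals, coercions) mpoly.
From mathcomp Require mpoly.
From mathcomp Require Import lra zify.

Import Order.TTheory GRing.Theory Num.Theory.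
Import numFieldNormedType.Exports.

Local Open Scope classical_set_scope.
Local Open Scope ring_scope.

Set Implicit Arguments.
Unset Strict Implicit.
Unset Printing Implicit Defensive.

(** Analyticity is handled through one weighted l1 norm on polynomials. A function is presented as
    the limit of a Cauchy sequence for that norm, so every estimate (product, substitution,
    derivative, Taylor remainder) reduces to monomials, and the flow and the implicit functions are
    iterations on polynomials. Analyticity of trajectories in time is never established: factorial
    bounds on iterated Lie derivatives take its place. The obstacle for the ideal is that
    reachability is global while every construction after [u] is local; the Lie derivatives at a
    single state carry both. Finiteness of [U] gives one time during which all inputs can be run,
    however often they switch, and this makes [sys_inputs] admissible. The obstacle for the
    realization is that, beyond the first moments after [u], a trajectory of [Sigma_V] need not come
    from one of [Sigma], so that only [p] remains for comparison; and [p] is analytic only for a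
    fixed list of letters, on a set of durations with corners. Hence agreement is carried along for
    all short continuations at once. *)

Local Notation mpoly := mpoly.mpoly.
Local Notation mcoeff := mpoly.mcoeff.
Local Notation msupp := mpoly.msupp.
Local Notation mdeg := mpoly.mdeg.
Local Notation multinom := mpoly.multinom.
Local Notation mpolyX := mpoly.mpolyX.
Local Notation mpolyC := mpoly.mpolyC.
Local Notation mderiv := mpoly.mderiv.
Local Notation meval := mpoly.meval.
Local Notation mmap := mpoly.mmap.
Local Notation mmap1 := mpoly.mmap1.

(** * Polynomial norms and analytic functions *)

Section PolynomialNorm.
Variables (R : realType) (n : nat).
Implicit Types (P Q : mpoly n R) (rho sigma : R).

(** Weighted l1 norm of the coefficients. It is submultiplicative and bounds the values of [P] on
    the polydisc of radius [rho] about 0. *)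
Definition pnorm rho P : R :=
  \sum_(m <- msupp P) `|mcoeff m P| * rho ^+ mdeg m.

(** Norms of polynomials with different supports become comparable once all sums run over one
    duplicate-free list. *)
Lemma pnorm_sub rho P (s : seq (multinom n)) :
  uniq s -> {subset msupp P <= s} ->
  pnorm rho P = \sum_(m <- s) `|mcoeff m P| * rho ^+ mdeg m.
Proof.
move=> us sub; rewrite /pnorm.
rewrite [RHS](bigID (mem (msupp P))) /= [X in _ + X]big1 ?addr0; last first.
  by move=> m mP; rewrite mpoly.memN_msupp_eq0 // normr0 mul0r.
rewrite -[RHS]big_filter; apply: perm_big; apply: uniq_perm.
- exact: mpoly.msupp_uniq.
- exact: filter_uniq.
by move=> m; rewrite mem_filter; case: (boolP (m \in msupp P)) => //= /sub.
Qed.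

Lemma pnorm_ge0 rho P : 0 <= rho -> 0 <= pnorm rho P.
Proof. by move=> r0; apply: sumr_ge0 => m _; rewrite mulr_ge0 ?exprn_ge0. Qed.

Lemma pnorm_le_radius rho sigma P : 0 <= sigma <= rho -> pnorm sigma P <= pnorm rho P.
Proof.
move=> /andP[s0 sr]; apply: ler_sum => m _.
by rewrite ler_wpM2l // lerXn2r // nnegrE ?(le_trans s0).
Qed.

Lemma pnormD rho P Q : 0 <= rho -> pnorm rho (P + Q) <= pnorm rho P + pnorm rho Q.
Proof.
move=> r0; pose s := undup (msupp P ++ msupp Q ++ msupp (P + Q)).
rewrite !(@pnorm_sub rho _ s) ?undup_uniq //; try by
  move=> m mP; rewrite mem_undup !mem_cat mP ?orbT.
rewrite -big_split; apply: ler_sum => m _ /=.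
by rewrite -mulrDl ler_wpM2r ?exprn_ge0 // mpoly.mcoeffD ler_normD.
Qed.

Lemma pnormZ rho c P : pnorm rho (c *: P) = `|c| * pnorm rho P.
Proof.
rewrite (@pnorm_sub rho (c *: P) (msupp P)) ?mpoly.msupp_uniq //; last first.
  exact: mpoly.msuppZ_le.
by rewrite mulr_sumr; apply: eq_bigr => m _; rewrite mpoly.mcoeffZ normrM mulrA.
Qed.

Lemma pnormN rho P : pnorm rho (- P) = pnorm rho P.
Proof. by rewrite -scaleN1r pnormZ normrN1 mul1r. Qed.

Lemma pnormB rho P Q : 0 <= rho -> pnorm rho (P - Q) <= pnorm rho P + pnorm rho Q.
Proof. by move=> r0; rewrite -(pnormN rho Q) pnormD. Qed.

Lemma pnorm0 rho : pnorm rho 0 = 0.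
Proof. by rewrite -[0 in LHS](scale0r 0) pnormZ normr0 mul0r. Qed.

Lemma pnormX rho m : pnorm rho (mpolyX R m) = rho ^+ mdeg m.
Proof. by rewrite /pnorm mpoly.msuppX big_seq1 mpoly.mcoeffX eqxx normr1 mul1r. Qed.

Lemma pnormC rho c : pnorm rho (mpolyC n c) = `|c|.
Proof.
rewrite -[mpolyC n c]mulr1 mpoly.mul_mpolyC pnormZ.
by rewrite -mpoly.mpolyX0 pnormX mpoly.mdeg0 expr0 mulr1.
Qed.

Lemma pnorm_sum rho (I : Type) (s : seq I) (p : pred I) (F : I -> mpoly n R) :
  0 <= rho ->
  pnorm rho (\sum_(i <- s | p i) F i) <= \sum_(i <- s | p i) pnorm rho (F i).
Proof.
move=> r0; elim: s => [|i s IH]; first by rewrite !big_nil pnorm0.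
rewrite !big_cons; case: (p i) => //.
exact: le_trans (pnormD _ _ r0) (lerD (lexx _) IH).
Qed.

Lemma pnormM rho P Q : 0 <= rho -> pnorm rho (P * Q) <= pnorm rho P * pnorm rho Q.
Proof.
move=> r0; rewrite mpoly.mpolyME big_allpairs /=.
apply: le_trans (pnorm_sum _ _ _ r0) _.
rewrite /pnorm mulr_suml; apply: ler_sum => m _.
apply: le_trans (pnorm_sum _ _ _ r0) _.
rewrite mulr_sumr; apply: ler_sum => m' _.
rewrite pnormZ pnormX /= normrM mpoly.mdegD exprD.
by rewrite mulrACA.
Qed.

Lemma pnorm1 rho : pnorm rho 1 = 1.
Proof. by rewrite -mpoly.mpolyC1 pnormC normr1. Qed.

Lemma pnorm_meval rho P (v : 'I_n -> R) : 0 <= rho -> (forall i, `|v i| <= rho) ->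
  `|meval v P| <= pnorm rho P.
Proof.
move=> r0 vr; rewrite mpoly.mevalE; apply: le_trans (ler_norm_sum _ _ _) _.
apply: ler_sum => m _; rewrite normrM ler_wpM2l // normr_prod.
rewrite mpoly.mdegE -prodrXr; apply: ler_prod => i _.
by rewrite normr_ge0 /= normrX lerXn2r // nnegrE.
Qed.

Lemma pnorm_mcoeff rho P m : 0 <= rho -> `|mcoeff m P| * rho ^+ mdeg m <= pnorm rho P.
Proof.
move=> r0; have [mP|mP] := boolP (m \in msupp P); last first.
  by rewrite mpoly.memN_msupp_eq0 // normr0 mul0r pnorm_ge0.
rewrite /pnorm (big_rem m) //= lerDl; apply: sumr_ge0 => m' _.
by rewrite mulr_ge0 ?exprn_ge0.
Qed.

(** Cauchy's inequality for a single power; it is a weak form of k sigma^(k-1) (rho - sigma) <=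
    rho^k - sigma^k. *)
Lemma mul_exp_le rho sigma k : 0 <= sigma -> sigma < rho ->
  k%:R * sigma ^+ k.-1 * (rho - sigma) <= rho ^+ k.
Proof.
move=> s0 sr; have r0 := le_trans s0 (ltW sr).
elim: k => [|[|k] IH]; first by rewrite !mul0r expr0.
  by rewrite expr0 expr1; lra.
rewrite /= in IH *.
have le : sigma ^+ k.+1 <= rho ^+ k.+1 by rewrite lerXn2r ?nnegrE // ltW.
have -> : k.+2%:R * sigma ^+ k.+1 * (rho - sigma) =
  sigma * (k.+1%:R * sigma ^+ k * (rho - sigma)) + (rho - sigma) * sigma ^+ k.+1.
  by rewrite [k.+2%:R]mulrS exprS; lra.
rewrite [leRHS]exprS.
have := ler_wpM2l s0 IH.
have : (rho - sigma) * sigma ^+ k.+1 <= (rho - sigma) * rho ^+ k.+1.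
  by rewrite ler_wpM2l // subr_ge0 ltW.
lra.
Qed.

(** Cauchy's inequality for the weighted norm: on a monomial, the factor [m i] produced by the
    derivative is at most the total degree, and [mul_exp_le] absorbs it into the change of
    radius. *)
Lemma pnorm_mderiv rho sigma i P : 0 <= sigma -> sigma < rho ->
  pnorm sigma (mderiv i P) * (rho - sigma) <= pnorm rho P.
Proof.
move=> s0 sr; have d0 : 0 < rho - sigma by rewrite subr_gt0.
have r0 := le_trans s0 (ltW sr).
rewrite {1}(mpoly.mpolyE P) raddf_sum /=.
apply: le_trans (ler_wpM2r (ltW d0) (pnorm_sum _ _ _ s0)) _.
rewrite mulr_suml; apply: ler_sum => m _.
rewrite mpoly.mderivZ mpoly.mderivX !pnormZ pnormX normr_nat -mulrA ler_wpM2l //.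
have [->|mi] := eqVneq (m i) 0%N; first by rewrite !mul0r exprn_ge0.
have lem : mpoly.lem (mpoly.mnm1 i) m by rewrite mpoly.lep1mP.
have -> : mdeg (mpoly.mnm_sub m (mpoly.mnm1 i)) = (mdeg m).-1.
  by rewrite -[in RHS](mpoly.submK lem) mpoly.mdegD mpoly.mdeg1 addn1.
apply: le_trans (mul_exp_le (mdeg m) s0 sr); rewrite ler_pM2r //.
apply: ler_wpM2r; first exact: exprn_ge0.
by rewrite ler_nat mpoly.mdegE (bigD1 i) //= leq_addr.
Qed.

End PolynomialNorm.

(** * Substitution of polynomials into polynomials *)

Section PolynomialComposition.
Variable (R : realType).

Definition pcomp (n k : nat) (F : 'I_n -> mpoly k R) (P : mpoly n R) : mpoly k R :=
  mmap (mpolyC k (R := R)) F P.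

Lemma meval_pcomp n k (F : 'I_n -> mpoly k R) P v :
  meval v (pcomp F P) = meval (fun i => meval v (F i)) P.
Proof.
rewrite /pcomp /mpoly.mmap raddf_sum mpoly.mevalE /=; apply: eq_bigr => m _.
rewrite mpoly.mevalM mpoly.mevalC; congr (_ * _).
rewrite /mpoly.mmap1 rmorph_prod /=; apply: eq_bigr => i _.
by rewrite rmorphXn.
Qed.

Lemma pcompB n k (F : 'I_n -> mpoly k R) P Q :
  pcomp F (P - Q) = pcomp F P - pcomp F Q.
Proof. exact: mpoly.mmapB. Qed.

Lemma pnorm_prodX_le n k (F : 'I_n -> mpoly k R) (rho sigma : R) m : 0 <= sigma ->
  (forall i, pnorm sigma (F i) <= rho) -> pnorm sigma (mmap1 F m) <= rho ^+ mdeg m.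
Proof.
move=> s0 Fr; have X i j : pnorm sigma (F i ^+ j) <= rho ^+ j.
  elim: j => [|j IH]; first by rewrite !expr0 pnorm1.
  rewrite !exprS (le_trans (pnormM _ _ s0)) // ler_pM ?pnorm_ge0 //.
rewrite /mpoly.mmap1 mpoly.mdegE.
elim: (index_enum _) => [|i s IH]; first by rewrite !big_nil pnorm1.
rewrite !big_cons exprD (le_trans (pnormM _ _ s0)) // ler_pM ?pnorm_ge0 //.
Qed.

Lemma pnorm_pcomp n k (F : 'I_n -> mpoly k R) (rho sigma : R) P : 0 <= sigma ->
  (forall i, pnorm sigma (F i) <= rho) -> pnorm sigma (pcomp F P) <= pnorm rho P.
Proof.
move=> s0 Fr; rewrite /pcomp /mpoly.mmap.
apply: le_trans (pnorm_sum _ _ _ s0) _; apply: ler_sum => m _.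
rewrite mpoly.mul_mpolyC pnormZ ler_wpM2l //; exact: pnorm_prodX_le.
Qed.

(* The telescoping bound is stated after multiplication by [rho' - rho], which
   makes it an immediate induction on the number of factors. *)
Lemma pnorm_prodXB_le n k (F G : 'I_n -> mpoly k R) (rho rho' sigma delta : R) m :
  0 <= sigma -> 0 <= rho -> rho <= rho' -> 0 <= delta ->
  (forall i, pnorm sigma (F i) <= rho) -> (forall i, pnorm sigma (G i) <= rho) ->
  (forall i, pnorm sigma (F i - G i) <= delta) ->
  pnorm sigma (mmap1 F m - mmap1 G m) * (rho' - rho) <= delta * rho' ^+ mdeg m.
Proof.
move=> s0 r0 rr' d0 Fr Gr FG.
have rr0 : 0 <= rho' - rho by rewrite subr_ge0.
have r'0 : 0 <= rho' by exact: le_trans rr'.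
(* Adding one factor: A C - B D = A (C - D) + (A - B) D, where the first term contributes [rho] and
   the second [rho' - rho] to the new factor [rho']. *)
have step (A B : mpoly k R) C D a b : pnorm sigma A <= rho ^+ a -> pnorm sigma D <= rho ^+ b ->
    pnorm sigma (A - B) * (rho' - rho) <= delta * rho' ^+ a ->
    pnorm sigma (C - D) * (rho' - rho) <= delta * rho' ^+ b ->
    a = 1%N -> pnorm sigma (A - B) <= delta ->
    pnorm sigma (A * C - B * D) * (rho' - rho) <= delta * rho' ^+ (a + b).
  move=> hA hD hAB hCD a1 AB; subst a.
  have -> : A * C - B * D = A * (C - D) + (A - B) * D.
    by rewrite mulrBr mulrBl addrA subrK.
  have h1 : pnorm sigma (A * (C - D)) * (rho' - rho) <= rho * (delta * rho' ^+ b).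
    apply: le_trans (ler_wpM2r rr0 (pnormM _ _ s0)) _.
    by rewrite -mulrA ler_pM ?mulr_ge0 ?pnorm_ge0.
  have h2 : pnorm sigma ((A - B) * D) * (rho' - rho) <= delta * rho' ^+ b * (rho' - rho).
    apply: ler_wpM2r => //; apply: le_trans (pnormM _ _ s0) _.
    rewrite ler_pM ?pnorm_ge0 // (le_trans hD) // lerXn2r ?nnegrE //.
  apply: le_trans (ler_wpM2r rr0 (pnormD _ _ s0)) _.
  rewrite mulrDl exprD expr1; lra.
have P1 (H : 'I_n -> mpoly k R) i j : (forall i, pnorm sigma (H i) <= rho) ->
    pnorm sigma (H i ^+ j) <= rho ^+ j.
  move=> hH; elim: j => [|j IH]; first by rewrite !expr0 pnorm1.
  rewrite !exprS (le_trans (pnormM _ _ s0)) // ler_pM ?pnorm_ge0 //.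
have base1 i : pnorm sigma (F i - G i) * (rho' - rho) <= delta * rho' ^+ 1.
  rewrite expr1 ler_pM ?pnorm_ge0 //; lra.
have base : pnorm sigma (1 - 1 : mpoly k R) * (rho' - rho) <= delta * rho' ^+ 0.
  by rewrite subrr pnorm0 mul0r expr0 mulr1.
have pw i j Y Z b : pnorm sigma Z <= rho ^+ b -> pnorm sigma (Y - Z) * (rho' - rho) <= delta * rho' ^+ b ->
   pnorm sigma (F i ^+ j * Y - G i ^+ j * Z) * (rho' - rho) <= delta * rho' ^+ (j + b).
  move=> hZ hYZ; elim: j => [|j IH]; first by rewrite !expr0 !mul1r.
  rewrite (exprS (F i)) (exprS (G i)) -!mulrA addSn -add1n; apply: step => //.
  rewrite exprD (le_trans (pnormM _ _ s0)) // ler_pM ?pnorm_ge0 //; exact: P1.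
rewrite /mpoly.mmap1 mpoly.mdegE.
suff [] : pnorm sigma (\prod_(i < n) G i ^+ m i) <= rho ^+ (\sum_(i < n) m i) /\
  pnorm sigma (\prod_(i < n) F i ^+ m i - \prod_(i < n) G i ^+ m i) * (rho' - rho) <=
  delta * rho' ^+ (\sum_(i < n) m i) by [].
elim: (index_enum _) => [|i s [IH1 IH2]]; first by rewrite !big_nil expr0 pnorm1 -{2}(expr0 rho').
rewrite !big_cons; split; last exact: pw.
rewrite exprD (le_trans (pnormM _ _ s0)) // ler_pM ?pnorm_ge0 //; exact: P1.
Qed.

(** Lipschitz dependence on the substituted polynomials. It underlies the composition of analytic
    functions and both contraction arguments, for the flow and for the implicit functions. *)
Lemma pnorm_pcompB n k (F G : 'I_n -> mpoly k R) (rho rho' sigma delta : R) P :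
  0 <= sigma -> 0 <= rho -> rho <= rho' -> 0 <= delta ->
  (forall i, pnorm sigma (F i) <= rho) -> (forall i, pnorm sigma (G i) <= rho) ->
  (forall i, pnorm sigma (F i - G i) <= delta) ->
  pnorm sigma (pcomp F P - pcomp G P) * (rho' - rho) <= delta * pnorm rho' P.
Proof.
move=> s0 r0 rr' d0 Fr Gr FG.
rewrite /pcomp /mpoly.mmap -sumrB.
apply: le_trans (ler_wpM2r _ (pnorm_sum _ _ _ s0)) _; first by rewrite subr_ge0.
rewrite mulr_suml [pnorm rho' P]/pnorm mulr_sumr; apply: ler_sum => m _.
rewrite -mulrBr mpoly.mul_mpolyC pnormZ -mulrA [leRHS]mulrCA.
by apply: ler_wpM2l => //; exact: pnorm_prodXB_le.
Qed.

End PolynomialComposition.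

(** * Functions represented by norm-convergent sequences of polynomials *)

Section Representation.
Variable (R : realType).

Lemma cvg_dist_le (u : nat -> R) (l c e : R) N : u @ \oo --> l ->
  (forall i, (N <= i)%N -> `|u i - c| <= e) -> `|l - c| <= e.
Proof.
move=> /cvgrPdist_le ul uN; apply/ler_addgt0Pl => e' e'0.
have [M _ HM] := ul _ e'0.
have h1 := HM (maxn N M) (leq_maxr _ _); have h2 := uN _ (leq_maxl N M).
have -> : l - c = (l - u (maxn N M)) + (u (maxn N M) - c) by rewrite addrA subrK.
exact: le_trans (ler_normD _ _) (lerD h1 h2).
Qed.

(** A single limit inherits every Cauchy modulus of [u], so error bounds can be read off later for
    any [e] and [N]. *)
Lemma cauchy_limit (u : nat -> R) :
  (forall e : R, 0 < e ->
     exists N, forall i j, (N <= i)%N -> (N <= j)%N -> `|u i - u j| <= e) ->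
  exists l : R, forall (e : R) N,
    (forall i j, (N <= i)%N -> (N <= j)%N -> `|u i - u j| <= e) ->
    forall j, (N <= j)%N -> `|l - u j| <= e.
Proof.
move=> uc; have cu : cvgn u.
  apply/cauchy_cvgP/cauchyP => e e0.
  have e2 : 0 < e / 2 by rewrite divr_gt0.
  have [N HN] := uc _ e2; exists (u N); exists N => // j /= Nj.
  rewrite /ball /= (le_lt_trans (HN _ _ (leqnn _) Nj)) //; lra.
exists (limn u) => e N HN j Nj.
by apply: (@cvg_dist_le u _ _ _ N) => // i Ni; exact: HN.
Qed.

Definition inbox n (a : 'rV[R]_n) (rho : R) (x : 'rV[R]_n) : Prop :=
  forall i, `|x ord0 i - a ord0 i| <= rho.

Definition aprx n (a : 'rV[R]_n) (rho K : R) (P : nat -> mpoly n R)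
    (g : 'rV[R]_n -> R) : Prop :=
  (forall j, pnorm rho (P j) <= K) /\
  forall e : R, 0 < e -> exists N, forall j, (N <= j)%N ->
    (forall i, (N <= i)%N -> pnorm rho (P i - P j) <= e) /\
    (forall x, inbox a rho x -> `|g x - peval (P j) (x - a)| <= e).

(* [g] is, on the closed polydisc of radius [rho], the sum of a power series
   centred at [a] whose coefficients satisfy [sum |c_nu| rho^|nu| <= K]; the
   series is presented by a Cauchy sequence of polynomials for that norm. *)
Definition repr n (a : 'rV[R]_n) (rho K : R) (g : 'rV[R]_n -> R) : Prop :=
  exists P, aprx a rho K P g.

Lemma peval_le n (a : 'rV[R]_n) (rho : R) P x : 0 <= rho -> inbox a rho x ->
  `|peval P (x - a)| <= pnorm rho P.
Proof. by move=> r0 ax; apply: pnorm_meval => // i; rewrite !mxE; exact: ax. Qed.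

Lemma pevalB n (P Q : mpoly n R) x : peval (P - Q) x = peval P x - peval Q x.
Proof. exact: mpoly.mevalB. Qed.

Lemma pevalD n (P Q : mpoly n R) x : peval (P + Q) x = peval P x + peval Q x.
Proof. exact: mpoly.mevalD. Qed.

Lemma pevalM n (P Q : mpoly n R) x : peval (P * Q) x = peval P x * peval Q x.
Proof. exact: mpoly.mevalM. Qed.

Lemma pevalZ n c (P : mpoly n R) x : peval (c *: P) x = c * peval P x.
Proof. exact: mpoly.mevalZ. Qed.

Lemma pevalC n c (x : 'rV[R]_n) : peval (mpolyC n c) x = c.
Proof. exact: mpoly.mevalC. Qed.

Lemma peval_pcomp n k (F : 'I_n -> mpoly k R) P x :
  peval (pcomp F P) x = peval P (\row_i peval (F i) x).
Proof.
by rewrite /peval meval_pcomp; apply: mpoly.meval_eq => i; rewrite mxE.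
Qed.

Lemma aprx_cauchy n (a : 'rV[R]_n) (rho K : R) (P : nat -> mpoly n R) : 0 <= rho ->
  (forall j, pnorm rho (P j) <= K) ->
  (forall e : R, 0 < e -> exists N, forall i j, (N <= i)%N -> (N <= j)%N ->
     pnorm rho (P i - P j) <= e) ->
  exists g, aprx a rho K P g.
Proof.
move=> r0 PK PC.
have /choice[g gP] : forall x, exists l : R, inbox a rho x -> forall (e : R) N,
    (forall i j, (N <= i)%N -> (N <= j)%N -> `|peval (P i) (x - a) - peval (P j) (x - a)| <= e) ->
    forall j, (N <= j)%N -> `|l - peval (P j) (x - a)| <= e.
  move=> x; have [ax|nax] := pselect (inbox a rho x); last by exists 0.
  have [|l lP] := @cauchy_limit (fun j => peval (P j) (x - a)).
    move=> e /PC[N HN]; exists N => i j Ni Nj; rewrite -pevalB.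
    exact: le_trans (peval_le _ r0 ax) (HN _ _ Ni Nj).
  by exists l.
exists g; split=> // e /PC[N HN]; exists N => j Nj; split=> [i Ni|x ax].
  exact: HN.
apply: (gP x ax e N) => // i i' Ni Ni'; rewrite -pevalB.
exact: le_trans (peval_le _ r0 ax) (HN _ _ Ni Ni').
Qed.

Lemma aprx_cvg n (a : 'rV[R]_n) (rho K : R) P g x : aprx a rho K P g -> inbox a rho x ->
  (fun j => peval (P j) (x - a)) @ \oo --> g x.
Proof.
move=> [_ PC] ax; apply/cvgrPdist_le => e e0; have [N HN] := PC _ e0.
by exists N => // j /= Nj; have [_ ->] := HN _ Nj.
Qed.

Lemma repr_bound n (a : 'rV[R]_n) (rho K : R) g x : 0 <= rho -> repr a rho K g ->
  inbox a rho x -> `|g x| <= K.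
Proof.
move=> r0 [P PP] ax; apply/ler_addgt0Pl => e e0.
have [PK /(_ _ e0)[N /(_ N (leqnn _))[_ /(_ x ax) H]]] := PP.
have h1 := le_trans (peval_le (P N) r0 ax) (PK N).
have := ler_normD (g x - peval (P N) (x - a)) (peval (P N) (x - a)); rewrite subrK; lra.
Qed.

Lemma repr_ext n (a : 'rV[R]_n) (rho K : R) g h : (forall x, inbox a rho x -> g x = h x) ->
  repr a rho K g -> repr a rho K h.
Proof.
move=> gh [P [PK PC]]; exists P; split => // e /PC[N HN]; exists N => j /HN[? H].
by split=> // x ax; rewrite -gh //; exact: H.
Qed.

Lemma repr_le n (a : 'rV[R]_n) (rho sigma K L : R) g :  0 <= sigma <= rho -> K <= L ->
  repr a rho K g -> repr a sigma L g.
Proof.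
move=> sr KL [P [PK PC]]; exists P; split=> [j|e /PC[N HN]].
  exact: le_trans (pnorm_le_radius _ sr) (le_trans (PK j) KL).
exists N => j /HN[H1 H2]; split=> [i Ni|x ax].
  exact: le_trans (pnorm_le_radius _ sr) (H1 _ Ni).
by apply: H2 => i; case/andP: sr => _; exact: le_trans.
Qed.

Lemma repr_poly n (a : 'rV[R]_n) (rho : R) P : repr a rho (pnorm rho P) (fun x => peval P (x - a)).
Proof.
exists (fun=> P); split=> // e e0; exists 0%N => j _; split=> [i|x] _.
  by rewrite subrr pnorm0 ltW.
by rewrite subrr normr0 ltW.
Qed.

Lemma repr_cst n (a : 'rV[R]_n) (rho c : R) : repr a rho `|c| (fun=> c).
Proof.
have := repr_poly a rho (mpolyC n c); rewrite pnormC; apply: repr_ext => x _.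
exact: pevalC.
Qed.

Lemma peval_var n i (x : 'rV[R]_n) : peval (mpolyX R (mpoly.mnm1 i)) x = x ord0 i.
Proof. exact: mpoly.mevalXU. Qed.

Lemma repr_coord n (a : 'rV[R]_n) (rho : R) i : 0 <= rho ->
  repr a rho (`|a ord0 i| + rho) (fun x => x ord0 i).
Proof.
move=> r0; have := repr_poly a rho (mpolyC n (a ord0 i) + mpolyX R (mpoly.mnm1 i)).
move=> /(@repr_ext n a rho _ _ (fun x => x ord0 i)) H.
apply: repr_le (H _); rewrite ?lexx ?r0 //.
  by apply: le_trans (pnormD _ _ r0) _; rewrite pnormC pnormX mpoly.mdeg1 expr1.
by move=> x _; rewrite pevalD pevalC peval_var !mxE; lra.
Qed.

Lemma reprD n (a : 'rV[R]_n) (rho K L : R) g h : 0 <= rho ->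
  repr a rho K g -> repr a rho L h -> repr a rho (K + L) (fun x => g x + h x).
Proof.
move=> r0 [P [PK PC]] [Q [QL QC]]; exists (fun j => P j + Q j); split=> [j|e e0].
  exact: le_trans (pnormD _ _ r0) (lerD (PK _) (QL _)).
have e2 : 0 < e / 2 by rewrite divr_gt0.
have [N HN] := PC _ e2; have [M HM] := QC _ e2.
exists (maxn N M) => j; rewrite geq_max => /andP[/HN[P1 P2] /HM[Q1 Q2]].
split=> [i|x ax].
  rewrite geq_max => /andP[/P1 h1 /Q1 h2].
  rewrite opprD addrACA; apply: le_trans (pnormD _ _ r0) _; lra.
rewrite pevalD opprD addrACA; apply: le_trans (ler_normD _ _) _.
have := P2 _ ax; have := Q2 _ ax; lra.
Qed.

Lemma reprM n (a : 'rV[R]_n) (rho K L : R) g h : 0 <= rho ->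
  repr a rho K g -> repr a rho L h -> repr a rho (K * L) (fun x => g x * h x).
Proof.
move=> r0 rg [Q [QL QC]]; have gK := fun x => repr_bound (x := x) r0 rg.
have [P [PK PC]] := rg.
have K0 : 0 <= K by apply: le_trans (PK 0%N); exact: pnorm_ge0.
have L0 : 0 <= L by apply: le_trans (QL 0%N); exact: pnorm_ge0.
exists (fun j => P j * Q j); split=> [j|e e0].
  by apply: le_trans (pnormM _ _ r0) _; rewrite ler_pM ?pnorm_ge0.
pose d := e / (K + L + 1).
have d0 : 0 < d by rewrite divr_gt0 //; lra.
have dE : d * (K + L) <= e.
  rewrite /d -mulrA; apply: le_trans (_ : e * 1 <= _); last by rewrite mulr1.
  apply: ler_wpM2l; first exact: ltW.
  by rewrite mulrC ler_pdivrMr ?mul1r; lra.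
have [N HN] := PC _ d0; have [M HM] := QC _ d0.
exists (maxn N M) => j; rewrite geq_max => /andP[/HN[P1 P2] /HM[Q1 Q2]].
split=> [i|x ax].
  rewrite geq_max => /andP[/P1 h1 /Q1 h2].
  have -> : P i * Q i - P j * Q j = P i * (Q i - Q j) + (P i - P j) * Q j.
    by rewrite mulrBr mulrBl addrA subrK.
  apply: le_trans (pnormD _ _ r0) _.
  have a1 : pnorm rho (P i * (Q i - Q j)) <= K * d.
    by apply: le_trans (pnormM _ _ r0) _; rewrite ler_pM ?pnorm_ge0.
  have a2 : pnorm rho ((P i - P j) * Q j) <= d * L.
    by apply: le_trans (pnormM _ _ r0) _; rewrite ler_pM ?pnorm_ge0.
  lra.
rewrite pevalM.
have -> : g x * h x - peval (P j) (x - a) * peval (Q j) (x - a) =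
   g x * (h x - peval (Q j) (x - a)) + (g x - peval (P j) (x - a)) * peval (Q j) (x - a).
  by rewrite mulrBr mulrBl addrA subrK.
apply: le_trans (ler_normD _ _) _; rewrite !normrM.
have a1 : `|g x| * `|h x - peval (Q j) (x - a)| <= K * d by rewrite ler_pM ?gK ?Q2.
have a2 : `|g x - peval (P j) (x - a)| * `|peval (Q j) (x - a)| <= d * L.
  by rewrite ler_pM ?P2 // (le_trans (peval_le _ r0 ax)).
lra.
Qed.

Lemma repr_sum n (a : 'rV[R]_n) (rho : R) (I : Type) (s : seq I) (K : I -> R) (g : I -> _ -> R) : 0 <= rho ->
  (forall i, repr a rho (K i) (g i)) ->
  repr a rho (\sum_(i <- s) K i) (fun x => \sum_(i <- s) g i x).
Proof.
move=> r0 gK; elim: s => [|i s IH].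
  have := repr_cst a rho 0; rewrite normr0 big_nil; apply: repr_ext => x _.
  by rewrite big_nil.
rewrite big_cons; apply: repr_ext (reprD r0 (gK i) IH) => x _; by rewrite big_cons.
Qed.

(** The difference of two composed approximants splits into a change of the outer polynomial, which
    substitution does not amplify, and a change of the inner ones, bounded by [pnorm_pcompB]. The
    latter is why a gap between [rho] and [rho'] is required. *)
Lemma aprx_comp n k (a : 'rV[R]_n) (b : 'rV[R]_k) (rho rho' sigma K : R) P G
    (g : 'rV[R]_n -> R) (F : 'I_n -> 'rV[R]_k -> R) : 0 <= sigma -> 0 <= rho < rho' ->
  aprx a rho' K P g -> (forall i, aprx b sigma rho (G i) (fun x => F i x - a ord0 i)) ->
  aprx b sigma K (fun j => pcomp (fun i => G i j) (P j)) (fun x => g (\row_i F i x)).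
Proof.
move=> s0 /andP[r0 rr'] [PK PC] GP.
have GK i j : pnorm sigma (G i j) <= rho by have [] := GP i.
have r'0 : 0 <= rho' := le_trans r0 (ltW rr').
have K0 : 0 <= K by apply: le_trans (PK 0%N); exact: pnorm_ge0.
have Fb x i : inbox b sigma x -> `|F i x - a ord0 i| <= rho.
  have rF : repr b sigma rho (fun x => F i x - a ord0 i) by exists (G i).
  exact: repr_bound s0 rF.
split=> [j|e e0].
  apply: le_trans (PK j); apply: le_trans (pnorm_pcomp _ s0 (GK^~ j)) _.
  by apply: pnorm_le_radius; rewrite r0 ltW.
have d0 : 0 < rho' - rho by rewrite subr_gt0.
have e2 : 0 < e / 2 by rewrite divr_gt0.
(* Inner error that the Lipschitz constant K / (rho' - rho) turns into at most e / 2; [K + 1] is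
   used since [K] may be 0. *)
pose d := e * (rho' - rho) / (2 * (K + 1)).
have dp : 0 < d by rewrite /d divr_gt0 ?mulr_gt0 //; lra.
have dE : d * K <= e / 2 * (rho' - rho).
  have -> : d * K = (e / 2 * (rho' - rho)) * (K / (K + 1)).
    by rewrite /d invfM; lra.
  rewrite -[leRHS]mulr1; apply: ler_wpM2l; first by rewrite mulr_ge0 ?ltW.
  by rewrite ler_pdivrMr ?mul1r; lra.
have [N HN] := PC _ e2.
have [M HM] : exists M, forall j, (M <= j)%N -> forall l,
   (forall i, (M <= i)%N -> pnorm sigma (G l i - G l j) <= d) /\
   (forall x, inbox b sigma x -> `|F l x - a ord0 l - peval (G l j) (x - b)| <= d).
  have /choice[M HM] := fun l => (GP l).2 _ dp.
  exists (\max_l M l) => j Mj l.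
  have Ml : (M l <= \max_l M l)%N by apply: leq_bigmax.
  have [H1 H2] := HM l j (leq_trans Ml Mj); split=> // i Mi.
  exact: H1 (leq_trans Ml Mi).
have main j i : (maxn N M <= j)%N -> (maxn N M <= i)%N ->
    pnorm sigma (pcomp (G^~ i) (P i) - pcomp (G^~ j) (P j)) <= e.
  rewrite !geq_max => /andP[Nj Mj] /andP[Ni Mi].
  have -> : pcomp (G^~ i) (P i) - pcomp (G^~ j) (P j) =
     pcomp (G^~ i) (P i - P j) + (pcomp (G^~ i) (P j) - pcomp (G^~ j) (P j)).
    by rewrite pcompB addrA subrK.
  apply: le_trans (pnormD _ _ s0) _; rewrite [leRHS](splitr e); apply: lerD.
    apply: le_trans (pnorm_pcomp _ s0 (GK^~ i)) _.
    apply: le_trans (pnorm_le_radius _ _) ((HN _ Nj).1 _ Ni); by rewrite r0 ltW.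
  rewrite -(ler_pM2r d0); apply: le_trans dE.
  apply: le_trans (@pnorm_pcompB _ _ _ _ _ rho rho' sigma d _ _ _ _ _ _ _ _) _ => //.
  - exact: ltW.
  - exact: ltW.
  - by move=> l; apply: (HM _ Mj l).1.
  by apply: ler_wpM2l => //; exact: ltW.
exists (maxn N M) => j Hj; split=> [i|x bx]; first exact: main.
pose y : 'rV[R]_k := x - b.
rewrite peval_pcomp.
have lim1 : (fun i => peval (pcomp (G^~ i) (P i)) (x - b)) @ \oo --> g (\row_i F i x).
  apply/cvgrPdist_le => e' e'0.
  have e'2 : 0 < e' / 2 by rewrite divr_gt0.
  pose d' := e' * (rho' - rho) / (2 * (K + 1)).
  have d'p : 0 < d' by rewrite /d' divr_gt0 ?mulr_gt0 //; lra.
  have d'E : d' * K <= e' / 2 * (rho' - rho).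
    have -> : d' * K = (e' / 2 * (rho' - rho)) * (K / (K + 1)) by rewrite /d' invfM; lra.
    rewrite -[leRHS]mulr1; apply: ler_wpM2l; first by rewrite mulr_ge0 ?ltW.
    by rewrite ler_pdivrMr ?mul1r; lra.
  have [N' HN'] := PC _ e'2.
  have /choice[M' HM'] := fun l => (GP l).2 _ d'p.
  exists (maxn N' (\max_l M' l)) => // i /=; rewrite geq_max => /andP[Ni Mi].
  rewrite peval_pcomp.
  have rowin : inbox a rho' (\row_l F l x).
    move=> l; rewrite mxE; exact: le_trans (Fb _ _ bx) (ltW rr').
  have h1 := (HN' _ Ni).2 _ rowin.
  have h2 : `|peval (P i) (\row_l F l x - a) - peval (P i) (\row_l peval (G l i) (x - b))| <= e' / 2.
    (* Points are polynomials in no variables, so the Lipschitz bound for substitution also bounds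
       differences of values. *)
    have E (z : 'rV[R]_n) : peval (P i) z = peval (pcomp (fun l => mpolyC 0 (z ord0 l)) (P i)) 0.
      by rewrite peval_pcomp; congr peval; apply/rowP => l; rewrite mxE pevalC.
    rewrite (E (_ - _)) (E (\row_l _)) -pevalB.
    rewrite -(ler_pM2r d0); apply: le_trans d'E.
    have z0 : `|peval (pcomp (fun l => mpolyC 0 ((\row_l F l x - a) ord0 l)) (P i) -
       pcomp (fun l => mpolyC 0 ((\row_l peval (G l i) (x - b)) ord0 l)) (P i)) (0 : 'rV[R]_0)| <=
       pnorm 0 (pcomp (fun l => mpolyC 0 ((\row_l F l x - a) ord0 l)) (P i) -
       pcomp (fun l => mpolyC 0 ((\row_l peval (G l i) (x - b)) ord0 l)) (P i)).
      by apply: pnorm_meval => // -[].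
    apply: le_trans (ler_wpM2r (ltW d0) z0) _.
    apply: le_trans (@pnorm_pcompB _ _ _ _ _ rho rho' 0 d' _ _ _ _ _ _ _ _) _ => //.
    - exact: ltW.
    - exact: ltW.
    - by move=> l; rewrite pnormC !mxE; exact: Fb.
    - move=> l; rewrite pnormC !mxE; exact: le_trans (peval_le _ s0 bx) (GK _ _).
    - move=> l; rewrite -mpoly.mpolyCB pnormC !mxE.
      have Ml : (M' l <= \max_l M' l)%N by apply: leq_bigmax.
      exact: (HM' l _ (leq_trans Ml Mi)).2.
    by apply: ler_wpM2l => //; exact: ltW.
  rewrite [leRHS]splitr; apply: le_trans (lerD h1 h2).
  by apply: le_trans (ler_normD _ _); rewrite addrA subrK.
rewrite -(peval_pcomp (G^~ j)); apply: (@cvg_dist_le _ _ _ _ (maxn N M) lim1) => i Hi.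
rewrite -pevalB; exact: le_trans (peval_le _ s0 bx) (main _ _ Hj Hi).
Qed.

Lemma repr_comp n k (a : 'rV[R]_n) (b : 'rV[R]_k) (rho rho' sigma K : R)
    (g : 'rV[R]_n -> R) (F : 'I_n -> 'rV[R]_k -> R) : 0 <= sigma -> 0 <= rho < rho' ->
  repr a rho' K g -> (forall i, repr b sigma rho (fun x => F i x - a ord0 i)) ->
  repr b sigma K (fun x => g (\row_i F i x)).
Proof.
move=> s0 rr' [P aP] /choice[G GP]; exists (fun j => pcomp (fun i => G i j) (P j)).
exact: aprx_comp aP GP.
Qed.

(** The translated coordinates have norm at most (rho - sigma) + sigma at radius [sigma], so
    substituting them does not increase the norm. *)
Lemma repr_recenter n (a b : 'rV[R]_n) (rho sigma K : R) g : 0 <= sigma ->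
  inbox a (rho - sigma) b -> repr a rho K g -> repr b sigma K g.
Proof.
move=> s0 ab [P [PK PC]].
pose F i := mpolyC n (b ord0 i - a ord0 i) + mpolyX R (mpoly.mnm1 i).
have FK i : pnorm sigma (F i) <= rho.
  apply: le_trans (pnormD _ _ s0) _; rewrite pnormC pnormX mpoly.mdeg1 expr1.
  have := ab i; lra.
have ev j x : peval (pcomp F (P j)) (x - b) = peval (P j) (x - a).
  rewrite peval_pcomp; congr peval; apply/rowP => i.
  rewrite mxE pevalD pevalC peval_var !mxE; lra.
exists (fun j => pcomp F (P j)); split=> [j|e /PC[N HN]].
  exact: le_trans (pnorm_pcomp _ s0 FK) (PK j).
exists N => j /HN[H1 H2]; split=> [i /H1 H|x bx].
  by rewrite -pcompB; exact: le_trans (pnorm_pcomp _ s0 FK) H.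
rewrite ev; apply: H2 => i.
have := ab i; have := bx i => h1 h2.
have -> : x ord0 i - a ord0 i = (x ord0 i - b ord0 i) + (b ord0 i - a ord0 i) by lra.
apply: le_trans (ler_normD _ _) _; lra.
Qed.

End Representation.

(** * Differentiation of represented functions *)

Section Differentiation.
Variable (R : realType).

Lemma rV_entry_le_norm n (h : 'rV[R]_n) i : `|h ord0 i| <= `|h|.
Proof.
rewrite [X in _ <= X]mx_normrE.
exact: (@le_bigmax _ _ _ 0 (fun j : 'I_1 * 'I_n => `|h j.1 j.2|) (ord0, i)).
Qed.

Lemma rV_norm_le n (h : 'rV[R]_n) (e : R) : 0 <= e ->
  (forall i, `|h ord0 i| <= e) -> `|h| <= e.
Proof.
move=> e0 he; rewrite [X in X <= _]mx_normrE; apply/bigmax_leP; split => // -[j i] _ /=.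
by rewrite (ord1 j).
Qed.

Lemma inboxP n (a : 'rV[R]_n) (rho : R) x : 0 <= rho -> inbox a rho x <-> `|x - a| <= rho.
Proof.
move=> r0; split=> [ax|xa i].
  by apply: rV_norm_le => // i; rewrite !mxE.
by have := le_trans (rV_entry_le_norm (x - a) i) xa; rewrite !mxE.
Qed.

Lemma inbox_nbhs n (a : 'rV[R]_n) (rho : R) : 0 < rho -> nbhs a [set x | inbox a rho x].
Proof.
move=> r0; apply/nbhs_ballP; exists rho => // x; rewrite -ball_normE /= => ax.
by apply/inboxP; [exact: ltW|rewrite distrC ltW].
Qed.

Lemma nbhs_inbox n (a : 'rV[R]_n) (A : set 'rV[R]_n) : nbhs a A ->
  exists2 rho : R, 0 < rho & forall x, inbox a rho x -> A x.
Proof.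
move=> /nbhs_ballP[e /= e0 eA]; have e2 : 0 < e / 2 by rewrite divr_gt0.
exists (e / 2) => // x /(inboxP _ _ (ltW e2)) ax; apply: eA.
by rewrite -ball_normE /= distrC (le_lt_trans ax) //; lra.
Qed.

Lemma cvg_sumr (T I : Type) (F : set_system T) {FF : Filter F} (s : seq I) (f : I -> T -> R)
    (l : I -> R) : (forall i, f i @ F --> l i) ->
  (fun x => \sum_(i <- s) f i x) @ F --> \sum_(i <- s) l i.
Proof.
move=> fl; elim: s => [|i s IH].
  rewrite big_nil; under eq_fun do rewrite big_nil; exact: cvg_cst.
rewrite big_cons; under eq_fun do rewrite big_cons; exact: cvgD.
Qed.

Definition lform n (c : 'I_n -> R) (h : 'rV[R]_n) : R := \sum_i c i * h ord0 i.

Lemma lform_linear n (c : 'I_n -> R) : linear (lform c).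
Proof.
move=> k u v; rewrite /lform scaler_sumr -big_split; apply: eq_bigr => i _ /=.
by rewrite !mxE mulrDr scalerAr /= mulrCA.
Qed.

HB.instance Definition _ n (c : 'I_n -> R) :=
  GRing.isLinear.Build R 'rV[R]_n R _ (lform c) (@lform_linear n c).

Lemma lform_continuous n (c : 'I_n -> R) : continuous (lform c).
Proof.
move=> x; apply: (@cvg_sumr _ _ _ (nbhs_filter x) _ (fun i y => c i * y ord0 i)) => i; apply: cvgM; first exact: cvg_cst.
exact: coord_continuous.
Qed.

Lemma diff_quadratic n (g : 'rV[R]_n -> R) (c : 'I_n -> R) (x : 'rV[R]_n) (d C : R) : 0 < d -> 0 <= C ->
  (forall (h : 'rV[R]_n) (e : R), 0 <= e <= d -> (forall i, `|h ord0 i| <= e) ->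
     `|g (x + h) - g x - lform c h| <= C * e ^+ 2) ->
  differentiable g x /\ 'd g x = lform c :> (_ -> _).
Proof.
move=> d0 C0 H.
have E : g \o shift x = cst (g x) + lform c +o_ (0 : 'rV[R]_n) id.
  apply/eqaddoP => _/posnumP[e].
  apply/nbhs_ballP; exists (Num.min d (e%:num / (C + 1))).
    by rewrite /= lt_min d0 /= divr_gt0 //; lra.
  move=> h; rewrite -ball_normE /= sub0r normrN lt_min => /andP[hd he].
  have := H h `|h| _ (rV_entry_le_norm h).
  rewrite normr_ge0 ltW //= => /(_ isT).
  rewrite [x + h]addrC.
  rewrite -[X in _ -> `|X| <= _]/(g (h + x) - (g x + lform c h)) opprD addrA => le1.
  apply: le_trans le1 _; rewrite expr2 mulrA ler_wpM2r //.
  apply: le_trans (_ : C * (e%:num / (C + 1)) <= _); first by apply: ler_wpM2l => //; exact: ltW.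
  rewrite mulrA mulrC mulrA -[leRHS]mul1r ler_wpM2r //.
  by rewrite mulrC ler_pdivrMr ?mul1r; lra.
have dE := diff_unique (@lform_continuous n c) E.
split=> //; apply/diff_locallyP; rewrite dE; split=> //; exact: lform_continuous.
Qed.

(** The constant does not depend on the degree, so the estimate survives the passage to limits. It
    is proved for monomials by multiplying in one variable at a time: the bound on the difference
    then uses the one on the value at y + h, and the second-order bound uses the one on the
    difference, whence the joint statement [T]. *)
Lemma pnorm_taylor n (rho sigma : R) (Q : mpoly n R) (y h : 'rV[R]_n) (d : R) :
  0 <= sigma -> 0 <= d -> sigma + d <= rho -> sigma < rho ->
  (forall i, `|y ord0 i| <= sigma) -> (forall i, `|h ord0 i| <= d) ->
  `|peval Q (y + h) - peval Q y - \sum_i peval (mderiv i Q) y * h ord0 i|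
    * (rho - sigma) ^+ 2 <= d ^+ 2 * pnorm rho Q.
Proof.
move=> s0 d0 sdr sr ys hd; set t := rho - sigma.
have t0 : 0 < t by rewrite subr_gt0.
have r0 : 0 < rho by apply: le_lt_trans sr.
pose D A := \sum_i peval (mderiv i A) y * h ord0 i.
pose T A a := [/\ `|peval A y| <= sigma ^+ a,
   `|peval A (y + h)| <= rho ^+ a,
   `|peval A (y + h) - peval A y| * t <= d * rho ^+ a &
   `|peval A (y + h) - peval A y - D A| * t ^+ 2 <= d ^+ 2 * rho ^+ a].
have TX i A a : T A a -> T (mpolyX R (mpoly.mnm1 i) * A) a.+1.
  move=> [T1 T2 T3 T4].
  have DX : D (mpolyX R (mpoly.mnm1 i) * A) = h ord0 i * peval A y + y ord0 i * D A.
    rewrite /D mulr_sumr.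
    have -> : h ord0 i * peval A y = \sum_j (i == j)%:R * h ord0 j * peval A y.
      rewrite (bigD1 i) //= eqxx mul1r big1 ?addr0 // => j /negbTE; rewrite eq_sym => ->.
      by rewrite !mul0r.
    rewrite -big_split; apply: eq_bigr => j _ /=.
    rewrite mpoly.mderivM pevalD !pevalM mpoly.mderivX pevalZ peval_var mulrDl.
    congr (_ + _); last by rewrite mulrA.
    rewrite mpoly.mnm1E; have [->|ij] := eqVneq i j; last by rewrite !mul0r.
    have -> : mpoly.mnm_sub (mpoly.mnm1 j) (mpoly.mnm1 j) = @mpoly.mnm0 n.
      by apply/mpoly.mnmP => k; rewrite mpoly.mnmBE subnn mpoly.mnm0E.
    by rewrite mpoly.mpolyX0 /peval mpoly.meval1 /= !mulr1n !mul1r mulrC.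
  have yi := ys i; have hi := hd i.
  have yhi : `|y ord0 i + h ord0 i| <= rho by apply: le_trans (ler_normD _ _) _; lra.
  have rr : 0 <= rho ^+ a by rewrite exprn_ge0 // ltW.
  split; rewrite ?DX !pevalM !peval_var ?mxE ?(exprS rho) ?(exprS sigma) ?normrM; try by rewrite ler_pM.
  - have -> : (y ord0 i + h ord0 i) * peval A (y + h) - y ord0 i * peval A y =
       y ord0 i * (peval A (y + h) - peval A y) + h ord0 i * peval A (y + h) by lra.
    apply: le_trans (ler_wpM2r (ltW t0) (ler_normD _ _)) _; rewrite !normrM mulrDl.
    have a1 : `|y ord0 i| * `|peval A (y + h) - peval A y| * t <= sigma * (d * rho ^+ a).
      by rewrite -mulrA ler_pM // mulr_ge0 // ltW.
    have a2 : `|h ord0 i| * `|peval A (y + h)| * t <= d * rho ^+ a * t.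
      by rewrite ler_pM2r // ler_pM.
    by rewrite /t in a1 a2 *; lra.
  - have -> : (y ord0 i + h ord0 i) * peval A (y + h) - y ord0 i * peval A y -
       (h ord0 i * peval A y + y ord0 i * D A) =
       y ord0 i * (peval A (y + h) - peval A y - D A) + h ord0 i * (peval A (y + h) - peval A y).
      by lra.
    have t2 : 0 <= t ^+ 2 by rewrite exprn_ge0 // ltW.
    apply: le_trans (ler_wpM2r t2 (ler_normD _ _)) _; rewrite !normrM mulrDl.
    have a1 : `|y ord0 i| * `|peval A (y + h) - peval A y - D A| * t ^+ 2 <=
       sigma * (d ^+ 2 * rho ^+ a).
      by rewrite -mulrA ler_pM // mulr_ge0.
    have a2 : `|h ord0 i| * `|peval A (y + h) - peval A y| * t ^+ 2 <=
       d * (d * rho ^+ a) * t.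
      rewrite expr2 !mulrA ler_pM2r // -!mulrA ler_pM // ?mulr_ge0 ?(ltW t0) //.
    by rewrite /t in a1 a2 *; lra.
have TXn i j A a : T A a -> T (mpolyX R (mpoly.mnm1 i) ^+ j * A) (j + a).
  move=> TA; elim: j => [|j IH]; first by rewrite expr0 mul1r.
  by rewrite exprS -mulrA; exact: TX.
have T1 : T 1 0%N.
  rewrite /T /D !expr0 /peval !mpoly.meval1 normr1 subrr normr0 mul0r big1; last first.
    by move=> i _; rewrite -mpoly.mpolyC1 mpoly.mderivC mpoly.meval0 mul0r.
  by rewrite subr0 normr0 mul0r !mulr1 sqr_ge0; split.
have Tm m : T (mpolyX R m) (mdeg m).
  rewrite mpoly.mpolyXE_id mpoly.mdegE; elim: (index_enum _) => [|i s IH].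
    by rewrite !big_nil.
  by rewrite !big_cons; exact: TXn.
have -> : peval Q (y + h) - peval Q y - \sum_i peval (mderiv i Q) y * h ord0 i =
  \sum_(m <- msupp Q) mcoeff m Q * (peval (mpolyX R m) (y + h) - peval (mpolyX R m) y - D (mpolyX R m)).
  have E z : peval Q z = \sum_(m <- msupp Q) mcoeff m Q * peval (mpolyX R m) z.
    rewrite {1}(mpoly.mpolyE Q) /peval raddf_sum; apply: eq_bigr => m _; exact: mpoly.mevalZ.
  rewrite !E -sumrB.
  have -> : \sum_i peval (mderiv i Q) y * h ord0 i = \sum_(m <- msupp Q) mcoeff m Q * D (mpolyX R m).
    under eq_bigr => i _.
      rewrite {1}(mpoly.mpolyE Q) raddf_sum /peval raddf_sum mulr_suml.
      under eq_bigr do rewrite /= mpoly.mderivZ mpoly.mevalZ -mulrA.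
      over.
    by rewrite exchange_big; apply: eq_bigr => m _; rewrite mulr_sumr.
  by rewrite -sumrB; apply: eq_bigr => m _; rewrite !mulrBr.
apply: le_trans (ler_wpM2r _ (ler_norm_sum _ _ _)) _; first by rewrite exprn_ge0 // ltW.
rewrite mulr_suml /pnorm mulr_sumr; apply: ler_sum => m _.
rewrite normrM -mulrA [leRHS]mulrCA ler_wpM2l //.
by have [_ _ _ ] := Tm m.
Qed.

(** By Cauchy's inequality the derivatives of the approximants form Cauchy sequences, and the
    quadratic Taylor remainder, uniform in the approximant, passes to the limit. *)
Lemma repr_deriv n (a : 'rV[R]_n) (rho sigma K : R) g : 0 <= sigma -> sigma < rho ->
  repr a rho K g ->
  exists dg : 'I_n -> 'rV[R]_n -> R,
    (forall i, repr a sigma (K / (rho - sigma)) (dg i)) /\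
    forall x, inbox a sigma x -> differentiable g x /\ 'd g x = lform (dg^~ x) :> (_ -> _).
Proof.
move=> s0 sr [P PP]; have [PK PC] := PP; have t0 : 0 < rho - sigma by rewrite subr_gt0.
have K0 : 0 <= K by apply: le_trans (PK 0%N); apply: pnorm_ge0; lra.
have /choice[dg dgP] : forall i, exists dgi, aprx a sigma (K / (rho - sigma)) (fun j => mderiv i (P j)) dgi.
  move=> i; apply: aprx_cauchy => // [j|e e0].
    by rewrite ler_pdivlMr //; apply: le_trans (pnorm_mderiv _ _ s0 sr) (PK j).
  have e1 : 0 < e * (rho - sigma) by rewrite mulr_gt0.
  have [N HN] := PC _ e1; exists N => j k Nj Nk.
  rewrite -mpoly.mderivB -(ler_pM2r t0).
  exact: le_trans (pnorm_mderiv _ _ s0 sr) ((HN _ Nk).1 _ Nj).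
exists dg; split=> [i|x ax]; first by exists (fun j => mderiv i (P j)).
apply: (@diff_quadratic _ _ _ _ (rho - sigma) (K / (rho - sigma) ^+ 2)) => //.
  by rewrite divr_ge0 // exprn_ge0 // ltW.
move=> h e /andP[e0 et] he.
have ax' : inbox a rho x by move=> i; apply: le_trans (ax i) (ltW sr).
have axh : inbox a rho (x + h).
  move=> i; rewrite mxE addrAC; apply: le_trans (ler_normD _ _) _.
  have := ax i; have := he i; lra.
have l1 := aprx_cvg PP axh; have l2 := aprx_cvg PP ax'.
have l3 : (fun j => \sum_i peval (mderiv i (P j)) (x - a) * h ord0 i) @ \oo --> lform (dg^~ x) h.
  apply: (@cvg_sumr _ _ _ _ _ (fun i j => peval (mderiv i (P j)) (x - a) * h ord0 i)
    (fun i => dg i x * h ord0 i)) => i; apply: cvgM; last exact: cvg_cst.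
  exact: (aprx_cvg (dgP i) ax).
have l4 := cvgB (cvgB l1 l2) l3.
rewrite -[X in `|X|]subr0; apply: (@cvg_dist_le _ _ _ _ _ 0%N (l4 _ _)) => j _.
rewrite subr0 /= mulrAC ler_pdivlMr ?exprn_gt0 // mulrC [leRHS]mulrC.
have := @pnorm_taylor n rho sigma (P j) (x - a) h e s0 e0.
rewrite [x - a + h]addrAC => H.
rewrite mulrC; apply: le_trans (H _ sr _ he) _.
- lra.
- by move=> i; rewrite !mxE; exact: ax.
- by rewrite ler_wpM2l // exprn_ge0.
Qed.

End Differentiation.

(** * Comparison with sums of power series *)

Section PowerSeries.
Variable (R : realType).

Lemma summable_bounded (T : choiceType) (f : T -> R) :
  summable setT (fun t => (f t)%:E) <->
  exists K : R, forall s : seq T, uniq s -> \sum_(t <- s) `|f t| <= K.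
Proof.
split=> [sf|[K HK]].
  exists (fine (\esum_(t in setT) `|(f t)%:E|%E)) => s us.
  have fin : \esum_(t in setT) `|(f t)%:E|%E \is a fin_num by rewrite -summableE.
  rewrite -lee_fin fineK // -sumEFin; apply: ereal_sup_ubound; exists [set` s].
    by split=> //; exact: finite_seq.
  by rewrite -fsbig_seq.
apply: le_lt_trans (ltry K); apply: ge_ereal_sup => _ [X [finX _] <-].
rewrite (fsbig_finite _ _ finX) /= sumEFin lee_fin; apply: HK; exact: finmap.fset_uniq.
Qed.

Definition multinom_of n (nu : {ffun 'I_n -> nat}) : multinom n :=
  mpoly.Multinom [tuple nu i | i < n].
Definition ffun_of_multinom n (m : multinom n) : {ffun 'I_n -> nat} := [ffun i => m i].

Lemma multinom_ofK n : cancel (@multinom_of n) (@ffun_of_multinom n).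
Proof. by move=> nu; apply/ffunP => i; rewrite ffunE mpoly.mnmE. Qed.

Lemma ffun_of_multinomK n : cancel (@ffun_of_multinom n) (@multinom_of n).
Proof. by move=> m; apply/mpoly.mnmP => i; rewrite mpoly.mnmE ffunE. Qed.

Lemma peval_monomial n (nu : {ffun 'I_n -> nat}) (x : 'rV[R]_n) :
  peval (mpolyX R (multinom_of nu)) x = monomial nu x.
Proof.
by rewrite /peval mpoly.mevalX; apply: eq_bigr => i _; rewrite mpoly.mnmE.
Qed.

Lemma monomial_cst n (nu : {ffun 'I_n -> nat}) (r : R) :
  monomial nu (const_mx r) = r ^+ mdeg (multinom_of nu).
Proof.
rewrite mpoly.mdegE -prodrXr; apply: eq_bigr => i _.
by rewrite mxE mpoly.mnmE.
Qed.

Definition box_indices n N : seq {ffun 'I_n -> nat} :=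
  [seq [ffun i => nu i : nat] | nu : {ffun 'I_n -> 'I_N}].

Lemma box_indices_uniq n N : uniq (box_indices n N).
Proof.
rewrite map_inj_uniq ?enum_uniq // => nu mu /ffunP e; apply/ffunP => i.
by apply: val_inj; have := e i; rewrite !ffunE.
Qed.

Lemma mem_box_indices n N (mu : {ffun 'I_n -> nat}) :
  (mu \in box_indices n N) = [forall i, (mu i < N)%N].
Proof.
apply/mapP/forallP => [[nu _ -> i]|H]; first by rewrite ffunE.
by exists [ffun i => Ordinal (H i)]; rewrite ?mem_enum //; apply/ffunP => i; rewrite !ffunE.
Qed.

Lemma box_indices_sub n M N : (M <= N)%N -> {subset box_indices n M <= box_indices n N}.
Proof.
move=> MN mu; rewrite !mem_box_indices => /forallP H; apply/forallP => i.
exact: leq_trans (H i) MN.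
Qed.

Lemma sum_box_indices n N (F : {ffun 'I_n -> nat} -> R) :
  \sum_(nu <- box_indices n N) F nu =
  \sum_(nu : {ffun 'I_n -> 'I_N}) F [ffun i => nu i : nat].
Proof. by rewrite big_map big_enum. Qed.

Definition series_poly n (c : {ffun 'I_n -> nat} -> R) (s : seq {ffun 'I_n -> nat}) : mpoly n R :=
  \sum_(nu <- s) c nu *: mpolyX R (multinom_of nu).

Lemma peval_series_poly n c s (x : 'rV[R]_n) :
  peval (series_poly c s) x = \sum_(nu <- s) c nu * monomial nu x.
Proof.
rewrite /peval /series_poly raddf_sum; apply: eq_bigr => nu _.
by rewrite /= mpoly.mevalZ -/(peval _ _) peval_monomial.
Qed.

Definition weight n (rho : R) (c : {ffun 'I_n -> nat} -> R) (s : seq {ffun 'I_n -> nat}) : R :=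
  \sum_(nu <- s) `|c nu| * rho ^+ mdeg (multinom_of nu).

Lemma pnorm_series_poly n (rho : R) c (s : seq {ffun 'I_n -> nat}) : 0 <= rho ->
  pnorm rho (series_poly c s) <= weight rho c s.
Proof.
move=> r0; apply: le_trans (pnorm_sum _ _ _ r0) _; apply: ler_sum => nu _.
by rewrite pnormZ pnormX.
Qed.

Lemma subseq_split (T : eqType) (s t : seq T) : uniq s -> uniq t -> {subset s <= t} ->
  perm_eq t (s ++ [seq x <- t | x \notin s]).
Proof.
move=> us ut st; apply: uniq_perm => //.
  rewrite cat_uniq us filter_uniq // andbT; apply/hasPn => x.
  by rewrite mem_filter => /andP[].
move=> x; rewrite mem_cat mem_filter; case: (boolP (x \in s)) => //= /st ->.
by [].
Qed.

(** [gh] is the sum of the local series on a whole polydisc, and equals [g] only on [D]. In this way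
    [p], analytic on a set of durations with corners, acquires local extensions. *)
Lemma analytic_on_repr n (D : set 'rV[R]_n) g a : analytic_on D g -> D a ->
  exists (gh : 'rV[R]_n -> R) (rho K : R), [/\ 0 < rho, repr a rho K gh &
    forall x, D x -> inbox a rho x -> g x = gh x].
Proof.
move=> Dg /Dg[c [r [r0 H]]]; pose rho := r / 2.
have rho0 : 0 < rho by rewrite divr_gt0.
have rr : rho < r by rewrite /rho; lra.
(* At the corner a + (rho, ..., rho) the monomials take the value rho^|nu|, so absolute convergence
   there is weighted summability of the coefficients. *)
have ain : forall i, `|(a + const_mx rho) ord0 i - a ord0 i| < r.
  by move=> i; rewrite !mxE addrAC subrr add0r gtr0_norm.
have [/summable_bounded[K HK] _] := H _ ain.
have WK s : uniq s -> weight rho c s <= K.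
  move=> us; apply: le_trans (HK _ us); apply: ler_sum => nu _.
  by rewrite addrAC subrr add0r monomial_cst normrM normrX (gtr0_norm rho0).
pose P N := series_poly c (box_indices n N).
(* These sums increase and are bounded, and their differences dominate the norms of the differences
   of the [P N]. *)
pose W N := weight rho c (box_indices n N).
have split_le M N : (M <= N)%N -> pnorm rho (P N - P M) <= W N - W M.
  move=> MN.
  have pe := subseq_split (box_indices_uniq n M) (box_indices_uniq n N) (box_indices_sub MN).
  rewrite /P /W /series_poly /weight !(perm_big _ pe) /= !big_cat /=.
  rewrite addrAC subrr add0r addrAC subrr add0r; apply: pnorm_series_poly; exact: ltW.
have WM M N : (M <= N)%N -> W M <= W N.
  move=> /split_le h; rewrite -subr_ge0; apply: le_trans h; apply: pnorm_ge0; exact: ltW.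
have Wcvg : cvgn W.
  apply: nondecreasing_is_cvgn => //; exists K => _ [N _ <-]; apply: WK; exact: box_indices_uniq.
have [|N'|gh ghP] := @aprx_cauchy R n a rho K P (ltW rho0).
- move=> N; apply: le_trans (pnorm_series_poly _ _ (ltW rho0)) _.
  by apply: WK; exact: box_indices_uniq.
- move=> e0; have [N _ HN] : \forall N \near \oo, `|limn W - W N| <= N' / 2.
    by move/cvgrPdist_le: Wcvg; apply; rewrite divr_gt0.
  exists N => i j Ni Nj.
  have hi := HN i Ni; have hj := HN j Nj.
  suff HW : `|W i - W j| <= N'.
    have [ij|/ltnW ij] := leqP i j; apply: le_trans HW.
      rewrite -pnormN opprB; apply: le_trans (split_le _ _ ij) _.
      by rewrite distrC ger0_norm // subr_ge0; exact: WM.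
    apply: le_trans (split_le _ _ ij) _.
    by rewrite ger0_norm // subr_ge0; exact: WM.
  have -> : W i - W j = (limn W - W j) - (limn W - W i) by lra.
  apply: le_trans (ler_normB _ _) _; lra.
exists gh, rho, K; split=> //; first by exists P.
move=> x Dx ax.
have [_ /(_ Dx) h1] := H x (fun i => le_lt_trans (ax i) rr).
have h2 := aprx_cvg ghP ax.
apply: cvg_unique h1 _ => //.
move: h2; apply: cvg_trans; apply: near_eq_cvg; near=> N.
by rewrite peval_series_poly sum_box_indices.
Unshelve. all: by end_near. Qed.

(** The representation holds on a full polydisc around each point of [D], also outside [D]; for open
    [D] this is the same as [analytic_on]. *)
Definition anl n (D : set 'rV[R]_n) (g : 'rV[R]_n -> R) : Prop :=
  forall a, D a -> exists rho K : R, 0 < rho /\ repr a rho K g.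

Lemma analytic_on_anl n (D : set 'rV[R]_n) g : open D -> analytic_on D g -> anl D g.
Proof.
move=> oD Dg a Da; have [gh [rho [K [r0 rg E]]]] := analytic_on_repr Dg Da.
have [s s0 sD] := nbhs_inbox (open_nbhs_nbhs (conj oD Da)).
exists (Num.min rho s), K; split; first by rewrite lt_min r0.
have mr : Num.min rho s <= rho by rewrite ge_min lexx.
have ms : Num.min rho s <= s by rewrite ge_min lexx orbT.
have m0 : 0 <= Num.min rho s by rewrite le_min !ltW.
apply: repr_ext (repr_le _ (lexx _) rg); last by rewrite m0.
move=> x ax; rewrite E //; last by move=> i; exact: le_trans (ax i) mr.
by apply: sD => i; exact: le_trans (ax i) ms.
Qed.

Lemma sum_mcoeff_le n (rho : R) (Q : mpoly n R) (s : seq {ffun 'I_n -> nat}) : 0 <= rho -> uniq s ->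
  weight rho (fun nu => mcoeff (multinom_of nu) Q) s <= pnorm rho Q.
Proof.
move=> r0 us.
rewrite (@pnorm_sub _ _ _ _ (undup ([seq multinom_of nu | nu <- s] ++ msupp Q))) ?undup_uniq //; last first.
  by move=> m mQ; rewrite mem_undup mem_cat mQ orbT.
have uS : uniq [seq multinom_of nu | nu <- s].
  by rewrite map_inj_uniq //; exact: can_inj (@multinom_ofK n).
have sS : {subset [seq multinom_of nu | nu <- s] <= undup ([seq multinom_of nu | nu <- s] ++ msupp Q)}.
  by move=> m mS; rewrite mem_undup mem_cat mS.
rewrite (perm_big _ (subseq_split uS (undup_uniq _) sS)) /=.
rewrite big_cat big_map /= lerDl; apply: sumr_ge0 => m _.
by rewrite mulr_ge0 // exprn_ge0.
Qed.

(** Each coefficient of the series is the limit of the corresponding coefficients of the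
    approximants. Weighted bounds on finite sets of indices pass to this limit ([wlim]), which gives
    both summability and convergence. *)
Lemma anl_analytic_on n (D : set 'rV[R]_n) g : anl D g -> analytic_on D g.
Proof.
move=> Dg a /Dg[rho [K [r0 [P PP]]]]; have [PK PC] := PP.
have rw := ltW r0.
have /choice[c cP] : forall nu : {ffun 'I_n -> nat}, exists l : R, forall (e : R) N,
    (forall i j, (N <= i)%N -> (N <= j)%N ->
       `|mcoeff (multinom_of nu) (P i) - mcoeff (multinom_of nu) (P j)| <= e) ->
    forall j, (N <= j)%N -> `|l - mcoeff (multinom_of nu) (P j)| <= e.
  move=> nu; apply: cauchy_limit => e e0.
  have rn : 0 < rho ^+ mdeg (multinom_of nu) by rewrite exprn_gt0.
  have e1 : 0 < e * rho ^+ mdeg (multinom_of nu) by rewrite mulr_gt0.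
  have [N HN] := PC _ e1; exists N => i j Ni Nj.
  rewrite -(ler_pM2r rn) -mpoly.mcoeffB; apply: le_trans (pnorm_mcoeff _ _ rw) _.
  exact: (HN _ Nj).1.
have ccvg nu : (fun j => mcoeff (multinom_of nu) (P j)) @ \oo --> c nu.
  apply/cvgrPdist_le => e e0.
  have rn : 0 < rho ^+ mdeg (multinom_of nu) by rewrite exprn_gt0.
  have e1 : 0 < e * rho ^+ mdeg (multinom_of nu) by rewrite mulr_gt0.
  have [N HN] := PC _ e1; exists N => // j /= Nj; apply: (cP nu e N) => // i i' Ni Ni'.
  rewrite -(ler_pM2r rn) -mpoly.mcoeffB; apply: le_trans (pnorm_mcoeff _ _ rw) _.
  exact: (HN _ Ni').1.
have wlim (Q : mpoly n R) (B : R) M s : uniq s ->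
   (forall i, (M <= i)%N -> pnorm rho (P i - Q) <= B) ->
   weight rho (fun nu => c nu - mcoeff (multinom_of nu) Q) s <= B.
  move=> us HB.
  have l1 : (fun i => weight rho (fun nu => mcoeff (multinom_of nu) (P i) - mcoeff (multinom_of nu) Q) s)
     @ \oo --> weight rho (fun nu => c nu - mcoeff (multinom_of nu) Q) s.
    apply: (@cvg_sumr _ _ _ _ _ _ (fun i nu => `|mcoeff (multinom_of i) (P nu) - mcoeff (multinom_of i) Q| * rho ^+ mdeg (multinom_of i)) (fun nu => `|c nu - mcoeff (multinom_of nu) Q| * rho ^+ mdeg (multinom_of nu))) => nu.
    apply: cvgM; last exact: cvg_cst.
    by apply: cvg_norm; apply: cvgB => //; exact: cvg_cst.
  rewrite -(cvg_lim _ l1) //; apply: limr_le; first by apply/cvg_ex; eexists; exact: l1.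
  exists M => // i /= Mi; apply: le_trans (HB _ Mi).
  apply: le_trans (sum_mcoeff_le _ rw us); rewrite le_eqVlt; apply/orP; left; apply/eqP.
  by apply: eq_bigr => nu _; rewrite mpoly.mcoeffB.
have W0 s : uniq s -> weight rho c s <= K.
  move=> us; have := wlim 0 K 0%N s us; rewrite /weight.
  under eq_bigr do rewrite mpoly.mcoeff0 subr0.
  by apply => i _; rewrite subr0.
exists c, rho; split=> // x ax; have axw : inbox a rho x by move=> i; exact: ltW.
have mon nu : `|monomial nu (x - a)| <= rho ^+ mdeg (multinom_of nu).
  rewrite -peval_monomial -(pnormX rho); exact: peval_le.
split.
  apply/summable_bounded; exists K => s us; apply: le_trans (W0 _ us).
  by apply: ler_sum => nu _; rewrite normrM ler_wpM2l.
move=> _; apply/cvgrPdist_le => e e0.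
have e2 : 0 < e / 2 by rewrite divr_gt0.
have [M HM] := PC _ e2; have [H1 H2] := HM M (leqnn _).
(* Larger than every exponent of [P M], so that each later partial sum runs over all of its
   monomials. *)
pose N := (\max_(m <- msupp (P M)) \max_(i < n) m i).+1.
exists N => // N' /= NN'.
rewrite -(sum_box_indices N' (fun mu => c mu * monomial mu (x - a))).
have PE : peval (P M) (x - a) = \sum_(nu <- box_indices n N') mcoeff (multinom_of nu) (P M) * monomial nu (x - a).
  have -> : peval (P M) (x - a) = \sum_(m <- msupp (P M)) mcoeff m (P M) * monomial (ffun_of_multinom m) (x - a).
    rewrite /peval mpoly.mevalE; apply: eq_bigr => m _; congr (_ * _).
    by apply: eq_bigr => i _; rewrite ffunE.
  have uF : uniq [seq ffun_of_multinom m | m <- msupp (P M)].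
    by rewrite map_inj_uniq ?mpoly.msupp_uniq //; exact: can_inj (@ffun_of_multinomK n).
  have sF : {subset [seq ffun_of_multinom m | m <- msupp (P M)] <= box_indices n N'}.
    move=> _ /mapP[m mP ->]; rewrite mem_box_indices; apply/forallP => i; rewrite ffunE.
    apply: leq_trans NN'; rewrite ltnS.
    apply: (@leq_trans (\max_(i < n) m i)%N); first exact: (leq_bigmax i).
    exact: (@leq_bigmax_seq _ _ xpredT (fun m : multinom n => \max_(i < n) m i)%N).
  rewrite (perm_big _ (subseq_split uF (box_indices_uniq n N') sF)) /= big_cat big_map /=.
  rewrite [X in _ = _ + X]big_seq [X in _ = _ + X]big1 ?addr0.
    by apply: eq_bigr => m _; rewrite ffun_of_multinomK.
  move=> nu; rewrite mem_filter => /andP[nuP _].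
  rewrite mpoly.memN_msupp_eq0 ?mul0r //; apply: contra nuP => nuP.
  by apply/mapP; exists (multinom_of nu) => //; rewrite multinom_ofK.
have h1 := H2 x axw; rewrite PE in h1.
have := wlim _ _ _ _ (box_indices_uniq n N') H1.
have -> : g x - \sum_(nu <- box_indices n N') c nu * monomial nu (x - a) =
  (g x - \sum_(nu <- box_indices n N') mcoeff (multinom_of nu) (P M) * monomial nu (x - a))
  - \sum_(nu <- box_indices n N') (c nu - mcoeff (multinom_of nu) (P M)) * monomial nu (x - a).
  rewrite -addrA -opprD -big_split /=; congr (_ - _); apply: eq_bigr => nu _; lra.
move=> h2; apply: le_trans (ler_normB _ _) _.
suff : `|\sum_(nu <- box_indices n N') (c nu - mcoeff (multinom_of nu) (P M)) * monomial nu (x - a)|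
   <= e / 2 by lra.
apply: le_trans h2; apply: le_trans (ler_norm_sum _ _ _) _; apply: ler_sum => nu _.
by rewrite normrM ler_wpM2l.
Qed.

End PowerSeries.

(** * Composition, Lie derivatives and their growth *)

Section LieDerivative.
Variable (R : realType).

Lemma repr_shrink n (a : 'rV[R]_n) (rho sigma K : R) g : 0 <= sigma <= rho ->
  repr a rho K g -> repr a sigma K g.
Proof. by move=> sr; apply: repr_le. Qed.

Lemma anl_ext n (D : set 'rV[R]_n) g h : open D -> (forall x, D x -> g x = h x) ->
  anl D g -> anl D h.
Proof.
move=> oD gh Dg a Da; have [rho [K [r0 rg]]] := Dg a Da.
have [s s0 sD] := nbhs_inbox (open_nbhs_nbhs (conj oD Da)).
exists (Num.min rho s), K; split; first by rewrite lt_min r0.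
have m0 : 0 <= Num.min rho s <= rho by rewrite le_min (ltW r0) (ltW s0) ge_min lexx.
apply: repr_ext (repr_shrink m0 rg) => x ax; apply: gh; apply: sD => i.
by apply: le_trans (ax i) _; rewrite ge_min lexx orbT.
Qed.

Lemma anl_cst n (D : set 'rV[R]_n) c : anl D (fun=> c).
Proof. by move=> a _; exists 1, `|c|; split=> //; exact: repr_cst. Qed.

Lemma anl_coord n (D : set 'rV[R]_n) i : anl D (fun x => x ord0 i).
Proof. by move=> a _; exists 1, (`|a ord0 i| + 1); split=> //; exact: repr_coord. Qed.

Lemma repr_common n (a : 'rV[R]_n) k (g : 'I_k -> 'rV[R]_n -> R) :
  (forall i, exists rho K : R, 0 < rho /\ repr a rho K (g i)) ->
  exists rho K : R, 0 < rho /\ forall i, repr a rho K (g i).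
Proof.
move=> /choice[rho] /choice[K H].
pose r := \big[Num.min/1]_i rho i; pose L := \sum_i `|K i|.
have r0 : 0 < r by apply: lt_bigmin => // i _; exact: (H i).1.
exists r, L; split=> // i; apply: repr_le (H i).2.
  by rewrite (ltW r0) /=; apply: bigmin_le_cond.
rewrite /L (bigD1 i) //=; apply: le_trans (ler_norm _) _.
by rewrite lerDl; apply: sumr_ge0.
Qed.

Lemma anlM n (D : set 'rV[R]_n) g h : anl D g -> anl D h -> anl D (fun x => g x * h x).
Proof.
move=> Dg Dh a Da.
have [|rho [K [r0 H]]] := @repr_common n a 2 (fun i => if i == ord0 then g else h).
  by move=> i; case: ifP => _; [exact: Dg|exact: Dh].
by exists rho, (K * K); split=> //; exact: reprM (ltW r0) (H ord0) (H (lift ord0 ord0)).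
Qed.

Lemma anl_poly n (D : set 'rV[R]_n) P : anl D (fun x => peval P x).
Proof.
move=> a _; exists 1, (pnorm 1 (pcomp (fun i => mpolyC n (a ord0 i) + mpolyX R (mpoly.mnm1 i)) P)).
split=> //; apply: repr_ext (repr_poly _ _ _) => x _.
rewrite peval_pcomp; congr peval; apply/rowP => i.
rewrite mxE pevalD pevalC peval_var !mxE; lra.
Qed.

(** Every monomial left has degree at least 1 and so gains a factor sigma / rho. *)
Lemma pnorm_noconst n (rho sigma : R) (P : mpoly n R) : 0 <= sigma <= rho -> 0 < rho ->
  pnorm sigma (P - mpolyC n (mcoeff (@mpoly.mnm0 n) P)) <= sigma / rho * pnorm rho P.
Proof.
move=> /andP[s0 sr] r0; set Q := P - _.
have Qc m : mcoeff m Q = if m == @mpoly.mnm0 n then 0 else mcoeff m P.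
  rewrite /Q mpoly.mcoeffB mpoly.mcoeffC; case: eqP => [->|_].
    by rewrite mulr1 subrr.
  by rewrite mulr0 subr0.
rewrite (@pnorm_sub _ _ _ Q (msupp P)) ?mpoly.msupp_uniq //; last first.
  move=> m; rewrite !mpoly.mcoeff_msupp Qc; case: ifP => // _; by rewrite eqxx.
rewrite /pnorm mulr_sumr; apply: ler_sum => m _.
rewrite Qc; case: eqP => [_|/eqP m0]; first by rewrite normr0 mul0r !mulr_ge0 ?exprn_ge0 ?invr_ge0 ?(ltW r0).
rewrite [leRHS]mulrCA ler_wpM2l //.
have : mdeg m != 0%N by rewrite mpoly.mdeg_eq0.
case: (mdeg m) => // k _; rewrite !exprS mulrA -[sigma / rho * rho]mulrA mulVf ?lt0r_neq0 // mulr1.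
by apply: ler_wpM2l => //; rewrite lerXn2r // nnegrE ltW.
Qed.

(** Without constant terms, shrinking the radius by a factor s multiplies the norm by s. This makes
    an inner function small enough to be composed with an outer one of given radius. *)
Lemma repr_center n (a : 'rV[R]_n) (rho K : R) g (e : R) : 0 < rho -> 0 < e ->
  repr a rho K g -> exists sigma, 0 < sigma <= rho /\ repr a sigma e (fun x => g x - g a).
Proof.
move=> r0 e0 [P [PK PC]].
have K0 : 0 <= K by apply: le_trans (PK 0%N); apply: pnorm_ge0; exact: ltW.
pose s := Num.min 1 (e / (K + 1)).
have s0 : 0 < s by rewrite lt_min ltr01 divr_gt0 //; lra.
have s1 : s <= 1 by rewrite ge_min lexx.
have sK : s * K <= e.
  have : s <= e / (K + 1) by rewrite ge_min lexx orbT.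
  rewrite ler_pdivlMr; lra.
have sr0 : 0 < s * rho by rewrite mulr_gt0.
have srr : s * rho <= rho by rewrite ger_pMl.
have srw : 0 <= s * rho <= rho by rewrite ltW.
have sE : s * rho / rho = s by rewrite mulfK // lt0r_neq0.
exists (s * rho); split; first by rewrite sr0.
pose z (Q : mpoly n R) := mpolyC n (mcoeff (@mpoly.mnm0 n) Q).
have zE (Q : mpoly n R) : peval Q (a - a) = mcoeff (@mpoly.mnm0 n) Q.
  rewrite subrr /peval mpoly.mevalE.
  have -> : mcoeff (@mpoly.mnm0 n) Q = \sum_(m <- msupp Q) mcoeff m Q * (m == @mpoly.mnm0 n)%:R.
    have [Q0|Q0] := boolP (@mpoly.mnm0 n \in msupp Q).
      rewrite (bigD1_seq _ Q0) ?mpoly.msupp_uniq //= eqxx mulr1 big1 ?addr0 //.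
      by move=> m /negbTE ->; rewrite mulr0.
    rewrite mpoly.memN_msupp_eq0 // big1_seq // => m /= mQ.
    by case: eqP => [mz|]; rewrite ?mulr0 //; rewrite -mz mQ in Q0.
  apply: eq_bigr => m _; congr (_ * _); case: eqP => [->|/eqP m0].
    by apply: big1 => i _; rewrite mpoly.mnm0E expr0.
  have /existsP[i mi] : [exists i, m i != 0%N].
    apply: contraR m0; rewrite negb_exists => /forallP H; apply/eqP/mpoly.mnmP => i.
    by rewrite mpoly.mnm0E; have := H i; rewrite negbK => /eqP.
  by rewrite (bigD1 i) //= mxE expr0n (negbTE mi) mul0r.
have aa : inbox a rho a by move=> i; rewrite subrr normr0 ltW.
exists (fun j => P j - z (P j)); split=> [j|e1 e10].
  apply: le_trans (pnorm_noconst _ srw r0) _; rewrite sE.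
  apply: le_trans sK; apply: ler_wpM2l => //; exact: ltW.
have e2 : 0 < e1 / 2 by rewrite divr_gt0.
have [N HN] := PC _ e2; exists N => j /HN[H1 H2]; split=> [i Ni|x ax].
  have -> : P i - z (P i) - (P j - z (P j)) = (P i - P j) - z (P i - P j).
    by rewrite /z mpoly.mcoeffB mpoly.mpolyCB [in RHS]opprB opprB addrACA [in RHS]addrACA [X in _ + X]addrC.
  apply: le_trans (pnorm_noconst _ srw r0) _; rewrite sE.
  have := H1 i Ni => h; have p0 : 0 <= pnorm rho (P i - P j) by apply: pnorm_ge0; exact: ltW.
  have : s * pnorm rho (P i - P j) <= 1 * pnorm rho (P i - P j) by apply: ler_wpM2r.
  lra.
have ax' : inbox a rho x by move=> i; apply: le_trans (ax i) srr.
rewrite pevalB pevalC -zE; have h1 := H2 _ ax'; have h2 := H2 _ aa.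
have -> : g x - g a - (peval (P j) (x - a) - peval (P j) (a - a)) =
  (g x - peval (P j) (x - a)) - (g a - peval (P j) (a - a)) by lra.
apply: le_trans (ler_normB _ _) _; lra.
Qed.

Lemma anl_comp n k (D : set 'rV[R]_k) (E : set 'rV[R]_n) g (F : 'rV[R]_k -> 'rV[R]_n) :
  (forall x, D x -> E (F x)) -> anl E g -> (forall i, anl D (fun x => F x ord0 i)) ->
  anl D (fun x => g (F x)).
Proof.
move=> DE Eg DF b Db; have [rho [K [r0 rg]]] := Eg _ (DE _ Db).
have r2 : 0 < rho / 2 by rewrite divr_gt0.
have [s1 [s10 H1]] : exists rho' : R, 0 < rho' /\ forall i : 'I_n, repr b rho' (rho / 2) (fun x => F x ord0 i - F b ord0 i).
  have /choice[s] : forall i, exists s : R, 0 < s /\ repr b s (rho / 2) (fun x => F x ord0 i - F b ord0 i).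
    move=> i; have [s [L' [s0' rF]]] := DF i _ Db.
    have [s' [/andP[s'0 _] rF']] := repr_center s0' r2 rF.
    by exists s'.
  move=> sP; pose r := \big[Num.min/1]_i s i.
  have r0' : 0 < r by apply: lt_bigmin => // i _; exact: (sP i).1.
  exists r; split=> // i; apply: repr_shrink (sP i).2.
  by rewrite (ltW r0') /=; apply: bigmin_le_cond.
exists s1, K; split=> //.
have rlt : 0 <= rho / 2 < rho by rewrite (ltW r2) /=; lra.
have := @repr_comp R n k (F b) b (rho / 2) rho s1 K g (fun i x => F x ord0 i) (ltW s10) rlt rg H1.
apply: repr_ext.
by move=> x _; congr g; apply/rowP => i; rewrite mxE.
Qed.

Definition lie n (X : 'rV[R]_n -> 'rV[R]_n) (g : 'rV[R]_n -> R) : 'rV[R]_n -> R :=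
  fun x => 'D_(X x) g x.

Lemma repr_lie n (a : 'rV[R]_n) (rho sigma K L : R) (X : 'rV[R]_n -> 'rV[R]_n) g : 0 <= sigma -> sigma < rho ->
  repr a rho K g -> (forall i, repr a sigma L (fun x => X x ord0 i)) ->
  repr a sigma (n%:R * (K / (rho - sigma) * L)) (lie X g).
Proof.
move=> s0 sr rg rX; have [dg [rdg dgE]] := repr_deriv s0 sr rg.
have -> : n%:R * (K / (rho - sigma) * L) = \sum_(i < n) (K / (rho - sigma) * L).
  by rewrite sumr_const card_ord mulr_natl.
apply: repr_ext (repr_sum _ s0 (fun i => reprM s0 (rdg i) (rX i))) => x ax.
by rewrite /lie; have [d1 d2] := dgE _ ax; rewrite deriveE // d2.
Qed.

Lemma repr_differentiable n (a : 'rV[R]_n) (rho K : R) g x : 0 < rho ->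
  repr a rho K g -> inbox a (rho / 2) x -> differentiable g x.
Proof.
move=> r0 rg ax; have r2 : 0 <= rho / 2 by rewrite divr_ge0 // ltW.
have r2' : rho / 2 < rho by lra.
by have [dg [_ /(_ _ ax)[]]] := repr_deriv r2 r2' rg.
Qed.

Lemma anl_differentiable n (D : set 'rV[R]_n) g x : anl D g -> D x -> differentiable g x.
Proof.
move=> Dg /Dg[rho [K [r0 rg]]]; apply: (repr_differentiable r0 rg) => i.
by rewrite subrr normr0 divr_ge0 // (ltW r0).
Qed.

Lemma anl_lie n (D : set 'rV[R]_n) (X : 'rV[R]_n -> 'rV[R]_n) g :
  anl D g -> (forall i, anl D (fun x => X x ord0 i)) -> anl D (lie X g).
Proof.
move=> Dg DX a Da; have [rho [K [r0 rg]]] := Dg _ Da.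
have [sigma [L [s0 rX]]] := repr_common (fun i => DX i _ Da).
pose t := Num.min (rho / 2) sigma.
have t0 : 0 < t by rewrite lt_min s0 divr_gt0.
have tr : t <= rho / 2 by rewrite ge_min lexx.
have ts : t <= sigma by rewrite ge_min lexx orbT.
exists t, (n%:R * (K / (rho - t) * L)); split=> //; apply: repr_lie => //.
- exact: ltW.
- lra.
- by move=> i; apply: repr_shrink (rX i); rewrite ltW.
Qed.

Lemma anl_iter_lie n (D : set 'rV[R]_n) (X : 'rV[R]_n -> 'rV[R]_n) g k :
  anl D g -> (forall i, anl D (fun x => X x ord0 i)) -> anl D (iter k (lie X) g).
Proof. by move=> Dg DX; elim: k => //= k IH; exact: anl_lie. Qed.

(** Induction from (1 + 1/k)^k <= e. *)
Lemma exp_fact_le (k : nat) : k%:R ^+ k <= expR 1 ^+ k * k`!%:R :> R.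
Proof.
elim: k => [|k IH]; first by rewrite !expr0 mul1r.
have [->|k0] := eqVneq k 0%N.
  by rewrite !expr1 mulr1; apply: le_trans (expR_ge1Dx _); lra.
have kp : 0 < k%:R :> R by rewrite ltr0n lt0n.
have le1 : k.+1%:R ^+ k <= expR 1 * k%:R ^+ k :> R.
  have -> : k.+1%:R = (1 + k%:R^-1) * k%:R :> R.
    by rewrite mulrDl mul1r mulVf ?lt0r_neq0 // -natr1.
  rewrite exprMn ler_wpM2r ?exprn_ge0 //.
  have -> : expR 1 = expR (k%:R^-1) ^+ k :> R.
    by rewrite -expRM_natl mulfV // lt0r_neq0.
  rewrite lerXn2r ?nnegrE ?expR_ge0 ?expR_ge1Dx // addr_ge0 ?invr_ge0 //.
rewrite exprS factS natrM exprS.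
have le2 : expR 1 * k%:R ^+ k <= expR 1 * (expR 1 ^+ k * k`!%:R) :> R by rewrite ler_wpM2l ?expR_ge0.
have := ler_wpM2l (ler0n R k.+1) (le_trans le1 le2).
lra.
Qed.

(* Losing [rho / (2 k)] of the radius at each of the [k] differentiations costs
   a factor [(c k)^k], which is at most [(c e)^k k!]. *)
Lemma lie_bound n (a : 'rV[R]_n) (rho K L : R) (X : 'rV[R]_n -> 'rV[R]_n) g : 0 < rho ->
  repr a rho K g -> (forall i, repr a rho L (fun x => X x ord0 i)) ->
  exists C M : R, [/\ 0 <= C, 0 <= M & forall k x, inbox a (rho / 2) x ->
    `|iter k (lie X) g x| <= C * M ^+ k * k`!%:R].
Proof.
move=> r0 rg rX; have rw := ltW r0.
have aa : inbox a rho a by move=> i; rewrite subrr normr0.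
have K0 : 0 <= K by apply: le_trans (repr_bound rw rg aa).
have nL0 : 0 <= n%:R * L.
  (* In dimension 0 there is no component of [X] to force [L] to be nonnegative. *)
  case: n a X g rg rX aa => [|n] a X g rg rX aa; first by rewrite mul0r.
  by rewrite mulr_ge0 //; apply: le_trans (repr_bound rw (rX ord0) aa).
exists K, (2 * (n%:R * L) / rho * expR 1); split=> // [|k x ax].
  by rewrite mulr_ge0 ?expR_ge0 // divr_ge0 // mulr_ge0.
have [->|k0] := eqVneq k 0%N.
  rewrite /= expr0 !mulr1; apply: repr_bound rw rg _ => i; apply: le_trans (ax i) _; lra.
have kp : 0 < k%:R :> R by rewrite ltr0n lt0n.
pose d := rho / (2 * k%:R).
have d0 : 0 < d by rewrite divr_gt0 // mulr_gt0.
have kd : k%:R * d = rho / 2.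
  have -> : k%:R * d = (k%:R * k%:R^-1) * (rho / 2) by rewrite /d invfM; lra.
  by rewrite mulfV ?mul1r // lt0r_neq0.
have main j : (j <= k)%N -> repr a (rho - j%:R * d) (K * (n%:R * L / d) ^+ j) (iter j (lie X) g).
  elim: j => [_|j IH jk]; first by rewrite mul0r subr0 expr0 mulr1.
  have jd : j.+1%:R * d <= rho / 2 by rewrite -kd ler_pM2r // ler_nat.
  have jE : j.+1%:R * d = j%:R * d + d by rewrite -natr1 mulrDl mul1r.
  have := @repr_lie n a (rho - j%:R * d) (rho - j.+1%:R * d) (K * (n%:R * L / d) ^+ j) L X (iter j (lie X) g).
  have -> : n%:R * (K * (n%:R * L / d) ^+ j / (rho - j%:R * d - (rho - j.+1%:R * d)) * L) =
     K * (n%:R * L / d) ^+ j.+1.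
    have -> : rho - j%:R * d - (rho - j.+1%:R * d) = d by rewrite jE; lra.
    by rewrite exprS; lra.
  apply; [lra|lra|exact: IH (ltnW jk)|].
  move=> i; apply: repr_shrink (rX i).
  have jd0 : 0 <= j.+1%:R * d by rewrite mulr_ge0 // ltW.
  by apply/andP; split; lra.
have := main k (leqnn _); rewrite kd => rk.
have rho2 : rho - rho / 2 = rho / 2 by lra.
rewrite rho2 in rk.
have h := repr_bound (divr_ge0 rw (ler0n R 2)) rk ax; apply: le_trans h _.
have -> : n%:R * L / d = 2 * (n%:R * L) / rho * k%:R.
  rewrite /d invfM invrK; lra.
set A := 2 * (n%:R * L) / rho.
have A0 : 0 <= K * A ^+ k by rewrite mulr_ge0 ?exprn_ge0 // divr_ge0 // mulr_ge0.
have := ler_wpM2l A0 (exp_fact_le k); rewrite !exprMn; lra.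
Qed.

End LieDerivative.

(** * Curves and iterated Lie derivatives *)

Section Curves.
Variable (R : realType).

Lemma within_continuousP (V : normedModType R) (a b : R) (f : R -> V) :
  {within `[a, b], continuous f} <->
  forall t (e : R), a <= t <= b -> 0 < e -> exists2 d : R, 0 < d &
    forall s, a <= s <= b -> `|s - t| < d -> `|f s - f t| < e.
Proof.
split=> [/subspace_continuousP fc t e tab e0|H].
  have tab' : `[a, b]%classic t by rewrite /= in_itv.
  have /cvgrPdist_lt/(_ e e0) := fc t tab'.
  rewrite near_withinE => /nbhs_ballP[d /= d0 dP]; exists d => // s sab st.
  by rewrite distrC; apply: dP; rewrite -?ball_normE /= ?in_itv //= distrC.
apply/subspace_continuousP => t; rewrite /= in_itv /= => tab.
apply/cvgrPdist_lt => e e0; rewrite near_withinE; have [d d0 dP] := H t e tab e0.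
apply/nbhs_ballP; exists d => // s; rewrite -ball_normE /= in_itv /= => st sab.
by rewrite distrC; apply: dP => //; rewrite distrC.
Qed.

Lemma within_continuous_sub (V : normedModType R) (a b c d : R) (f : R -> V) :
  a <= c -> d <= b ->
  {within `[a, b], continuous f} -> {within `[c, d], continuous f}.
Proof.
move=> ac db /within_continuousP H; apply/within_continuousP => t e /andP[ct td] e0.
have [|r r0 rP] := H t e _ e0; first by rewrite (le_trans ac) // (le_trans td).
by exists r => // s /andP[cs sd]; apply: rP; rewrite (le_trans ac) // (le_trans sd).
Qed.

Lemma within_continuous_comp n (V : normedModType R) (g : 'rV[R]_n -> V) (a b : R) (x : R -> 'rV[R]_n) :
  {within `[a, b], continuous x} -> (forall t, a <= t <= b -> {for x t, continuous g}) ->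
  {within `[a, b], continuous (g \o x)}.
Proof.
move=> /subspace_continuousP xc gc; apply/subspace_continuousP => t tab.
by apply: (@cvg_comp _ _ _ x g _ _ _ (xc t tab)); apply: gc; move: tab; rewrite /= in_itv.
Qed.

Lemma within_continuous_const (a b c : R) (f : R -> R) : a < b ->
  {within `[a, b], continuous f} -> (forall t, a < t < b -> f t = c) ->
  forall t, a <= t <= b -> f t = c.
Proof.
move=> ab /within_continuousP fc fc0 t tab; apply/eqP; rewrite -subr_eq0 -normr_eq0.
apply/eqP/le_anti; rewrite normr_ge0 andbT leNgt; apply/negP => e0.
have [d d0 dP] := fc t _ tab e0.
have [s [sab st]] : exists s, a < s < b /\ `|s - t| < d.
  have [ta|at_] := leP t ((a + b) / 2).
    exists (t + Num.min d (b - a) / 4).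
    have m0 : 0 < Num.min d (b - a) by rewrite lt_min d0 subr_gt0.
    have m1 : Num.min d (b - a) <= d by rewrite ge_min lexx.
    have m2 : Num.min d (b - a) <= b - a by rewrite ge_min lexx orbT.
    rewrite addrAC subrr add0r ger0_norm; last lra.
    split; last lra.
    move: tab => /andP[? ?]; apply/andP; split; lra.
  exists (t - Num.min d (b - a) / 4).
  have m0 : 0 < Num.min d (b - a) by rewrite lt_min d0 subr_gt0.
  have m1 : Num.min d (b - a) <= d by rewrite ge_min lexx.
  have m2 : Num.min d (b - a) <= b - a by rewrite ge_min lexx orbT.
  rewrite addrAC subrr add0r normrN ger0_norm; last lra.
  split; last lra.
  move: tab => /andP[? ?]; apply/andP; split; lra.
have sab' : a <= s <= b by case/andP: sab => ? ?; rewrite !ltW.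
have := dP s sab' st; by rewrite fc0 // distrC ltxx.
Qed.

Lemma rolle_between (f df : R -> R) (a b s t : R) :
  {within `[a, b], continuous f} -> (forall t, a < t < b -> is_derive t (1 : R) f (df t)) ->
  a <= s <= b -> a <= t <= b -> s != t -> f s = f t ->
  exists c, [/\ a < c < b, c != s, `|c - s| <= `|t - s| & df c = 0].
Proof.
move=> fc fd sab tab st fst.
have main (u v : R) : a <= u <= b -> a <= v <= b -> u < v -> f u = f v ->
    exists c, [/\ u < c < v, a < c < b & df c = 0].
  move=> /andP[au ub] /andP[av vb] uv fuv.
  have [||c] := @MVT R f df u v uv.
  - move=> x; rewrite in_itv /= => /andP[ux xv]; apply: fd.
    by rewrite (le_lt_trans au) // (lt_le_trans xv).
  - exact: within_continuous_sub fc.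
  rewrite in_itv /= => /andP[uc cv]; rewrite fuv subrr => /esym/eqP.
  rewrite mulf_eq0 [v - u == 0]subr_eq0 (gt_eqF uv) orbF => /eqP dc.
  by exists c; rewrite uc cv (le_lt_trans au) // (lt_le_trans cv).
move: st; rewrite neq_lt => /orP[st|ts].
  have [c [/andP[sc ct] cab dc]] := main _ _ sab tab st fst.
  exists c; split => //; first by rewrite gt_eqF.
  by rewrite !ger0_norm ?subr_ge0; lra.
have [c [/andP[sc ct] cab dc]] := main _ _ tab sab ts (esym fst).
exists c; split => //; first by rewrite lt_eqF.
by rewrite !ler0_norm ?subr_le0; lra.
Qed.

(** A binomial coefficient is at most 2^(k+j); this is the origin of the factor 2 in the hypothesis
    2 M (b - a) < 1 below. *)
Lemma fact_addn_le (k j : nat) : ((k + j)`! <= 2 ^ (k + j) * (k`! * j`!))%N.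
Proof.
have binle n m : ('C(n, m) <= 2 ^ n)%N.
  elim: n m => [|n IH] [|m] //; first by rewrite bin0 expn_gt0.
  by rewrite binS expnS mul2n -addnn leq_add.
rewrite -(@bin_fact (k + j) k) ?leq_addr // addKn leq_mul2r binle orbT //.
Qed.

Lemma geometric_small (q C : R) : 0 <= q < 1 -> 0 <= C -> forall e : R, 0 < e ->
  exists j, C * q ^+ j <= e.
Proof.
move=> /andP[q0 q1] C0 e e0.
have e1 : 0 < e / (C + 1) by rewrite divr_gt0 //; lra.
have /cvgrPdist_le/(_ _ e1)[N _ HN] : (GRing.exp q : R^nat) @ \oo --> 0.
  by apply: cvg_expr; rewrite ger0_norm.
exists N; have := HN N (leqnn N); rewrite /= sub0r normrN ger0_norm ?exprn_ge0 // => h.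
have h2 := ler_wpM2l C0 h; apply: le_trans h2 _.
rewrite mulrCA -[leRHS]mulr1; apply: ler_wpM2l; first exact: ltW.
by rewrite ler_pdivrMr ?mul1r; lra.
Qed.

(** Taylor's formula at a zero of infinite order: |e_k(t)| j! <= C M^(k+j) (k+j)! |t - t0|^j for
    every j, and the right-hand side divided by j! tends to 0 as soon as 2 M (b - a) < 1. Only e_k'
    = e_(k+1) inside the interval and continuity up to its ends are used, so that curves need no
    derivative at their end points. *)
Lemma quasi_analytic (e : nat -> R -> R) (a b t0 C M : R) :
  (forall k, {within `[a, b], continuous (e k)}) ->
  (forall k t, a < t < b -> is_derive t (1 : R) (e k) (e k.+1 t)) ->
  0 <= C -> 0 <= M -> 2 * M * (b - a) < 1 ->
  (forall k t, a <= t <= b -> `|e k t| <= C * M ^+ k * k`!%:R) ->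
  a <= t0 <= b -> (forall k, e k t0 = 0) ->
  forall k t, a <= t <= b -> e k t = 0.
Proof.
move=> ec ed C0 M0 Mab eb t0ab e0.
pose B m : R := C * M ^+ m * m`!%:R.
have main j k t : a <= t <= b -> `|e k t| * j`!%:R <= B (k + j)%N * `|t - t0| ^+ j.
  elim: j k t => [|j IH] k t tab; first by rewrite expr0 !mulr1 addn0; exact: eb.
  have [->|tt0] := eqVneq t t0; first by rewrite e0 normr0 mul0r subrr normr0 expr0n mulr0.
  (* Rolle's theorem for this combination is Cauchy's mean value theorem for [e k] and (s -
     t0)^(j+1). *)
  pose h s := e k s * (t - t0) ^+ j.+1 - e k t * (s - t0) ^+ j.+1.
  pose dh s := e k.+1 s * (t - t0) ^+ j.+1 - e k t * (j.+1%:R * (s - t0) ^+ j).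
  have p1 s : is_derive s (1 : R) (fun s => (s - t0) ^+ j.+1) (j.+1%:R * (s - t0) ^+ j).
    have q : is_derive s (1 : R) (fun s : R => s - t0) 1.
      by apply: is_derive_eq; rewrite subr0.
    have := @is_deriveX R R (fun s => s - t0) j.+1 s 1 1 q.
    by rewrite exprfctE /GRing.scale /= mulr1.
  have hd s : a < s < b -> is_derive s (1 : R) h (dh s).
    move=> sab; have ek := ed k s sab.
    have p1s := p1 s.
    have d2 := @is_deriveB _ _ _ _ _ _ _ _ _ (is_deriveM ek (is_derive_cst ((t - t0) ^+ j.+1) s 1))
      (is_deriveM (is_derive_cst (e k t) s 1) p1s).
    apply: is_derive_eq d2 _; rewrite /dh /GRing.scale /= /cst !mulr0; lra.
  have hc : {within `[a, b], continuous h}.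
    apply/subspace_continuousP => s sab; apply: cvgB; apply: cvgM.
    - by move/subspace_continuousP: (ec k); apply.
    - exact: cvg_cst.
    - exact: cvg_cst.
    - apply: cvg_within_filter; apply: (@differentiable_continuous _ _ _ s (fun x => (x - t0) ^+ j.+1)).
      by apply/derivable1_diffP; case: (p1 s).
  have [||c [cab ct ctt dc]] := @rolle_between h dh a b t0 t hc hd t0ab tab; first by rewrite eq_sym.
    by rewrite /h e0 mul0r subrr expr0n /= mulr0 subrr mulrC subrr.
  have cab' : a <= c <= b by case/andP: cab => ? ?; rewrite !ltW.
  have IHc := IH k.+1 c cab'.
  have cp : 0 < `|c - t0| ^+ j by rewrite exprn_gt0 // normr_gt0 subr_eq0.
  have eq1 : `|e k t| * (j.+1%:R * `|c - t0| ^+ j) = `|e k.+1 c| * `|t - t0| ^+ j.+1.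
    have : e k.+1 c * (t - t0) ^+ j.+1 = e k t * (j.+1%:R * (c - t0) ^+ j).
      by move: dc; rewrite /dh => /eqP; rewrite subr_eq0 => /eqP.
    by move=> /(congr1 Num.norm); rewrite !normrM !normrX normr_nat => ->.
  rewrite -(ler_pM2r cp) factS natrM.
  have -> : `|e k t| * (j.+1%:R * j`!%:R) * `|c - t0| ^+ j =
     (`|e k.+1 c| * j`!%:R) * `|t - t0| ^+ j.+1 by rewrite [RHS]mulrAC -eq1; lra.
  apply: le_trans (ler_wpM2r _ IHc) _; first exact: exprn_ge0.
  by rewrite addSn addnS mulrAC.
move=> k t tab; apply/eqP; rewrite -normr_eq0; apply/eqP/le_anti; rewrite normr_ge0 andbT.
apply/ler_addgt0Pl => d d0; rewrite addr0.
pose q := 2 * M * (b - a).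
have ba : 0 <= b - a by case/andP: t0ab => ? ?; lra.
have q0 : 0 <= q by rewrite /q !mulr_ge0.
have tt : `|t - t0| <= b - a.
  by case/andP: t0ab => ? ?; case/andP: tab => ? ?; rewrite ler_norml; apply/andP; split; lra.
have K0 : 0 <= C * (2 * M) ^+ k * k`!%:R by rewrite !mulr_ge0 ?exprn_ge0 // mulr_ge0.
have [|j hj] := @geometric_small q _ _ K0 _ d0; first by rewrite q0.
apply: le_trans hj.
have j0 : 0 < j`!%:R :> R by rewrite ltr0n fact_gt0.
rewrite -(ler_pM2r j0); apply: le_trans (main j k t tab) _.
have f1 : (k + j)`!%:R <= 2 ^+ (k + j) * (k`!%:R * j`!%:R) :> R.
  by rewrite -natrX -!natrM ler_nat; exact: fact_addn_le.
have f2 : `|t - t0| ^+ j <= (b - a) ^+ j by rewrite lerXn2r // nnegrE.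
have f3 : C * M ^+ (k + j) * (k + j)`!%:R <= C * M ^+ (k + j) * (2 ^+ (k + j) * (k`!%:R * j`!%:R)).
  by apply: ler_wpM2l => //; rewrite mulr_ge0 // exprn_ge0.
apply: le_trans (ler_pM _ _ f3 f2) _; rewrite ?mulr_ge0 ?exprn_ge0 //.
rewrite /q !exprMn !exprD le_eqVlt; apply/orP; left; apply/eqP; lra.
Qed.

(** Connectedness as a transport principle: if [P] passes between any two points near each t, then
    both [P] and its negation are open in the segment. *)
Lemma segment_ind (a b : R) (P : R -> Prop) (t0 : R) : a <= t0 <= b -> P t0 ->
  (forall t, a <= t <= b -> exists2 e : R, 0 < e &
     forall s s', a <= s <= b -> a <= s' <= b -> `|s - t| < e -> `|s' - t| < e -> P s -> P s') ->
  forall t, a <= t <= b -> P t.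
Proof.
move=> t0ab P0 H.
have cs := @segment_connected R a b.
suff BE : `[a, b]%classic `&` [set t | P t] = `[a, b]%classic.
  move=> t tab; have : `[a, b]%classic t by rewrite /= in_itv.
  by rewrite -BE => -[].
pose O (Q : R -> Prop) := \bigcup_(p in [set p : R * R | [/\ 0 < p.2, a <= p.1 <= b &
   (forall s, a <= s <= b -> `|s - p.1| < p.2 -> Q s)]]) ball p.1 p.2.
have oO Q : open (O Q) by apply: bigcup_open => p [p0 _ _]; exact: ball_open.
have OQ Q : (forall t, a <= t <= b -> Q t -> exists2 e : R, 0 < e & forall s, a <= s <= b -> `|s - t| < e -> Q s) ->
    `[a, b]%classic `&` [set t | Q t] = `[a, b]%classic `&` O Q.
  move=> HQ; apply/seteqP; split=> t [/= tab Qt]; split => //=.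
    have tab' : a <= t <= b by move: tab; rewrite in_itv.
    have [e e0 eP] := HQ t tab' Qt; exists (t, e) => //; exact: ballxx.
  case: Qt => -[p r] /= [r0 _ pr]; rewrite -ball_normE /= => tp.
  by apply: pr; [move: tab; rewrite in_itv|rewrite distrC].
apply: cs.
- by exists t0; split=> //=; rewrite in_itv.
- exists (O P) => //; apply: OQ => t tab Pt; have [e e0 eP] := H t tab.
  by exists e => // s sab st; apply: eP Pt => //; rewrite subrr normr0.
- exists (~` O (fun t => ~ P t)); first by rewrite closedC.
  have OQ' : `[a, b]%classic `&` [set t | ~ P t] = `[a, b]%classic `&` O (fun t => ~ P t).
    apply: OQ => t tab nPt; have [e e0 eP] := H t tab.
    by exists e => // s sab st Ps; apply: nPt; apply: eP Ps => //; rewrite subrr normr0.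
  apply/seteqP; split=> t [tab Pt]; split=> //=.
    move=> Ot; have : (`[a, b]%classic `&` O (fun t => ~ P t)) t by [].
    by rewrite -OQ' => -[_]; apply.
  apply: contrapT => nPt; apply: Pt.
  have : (`[a, b]%classic `&` [set t | ~ P t]) t by [].
  by rewrite OQ' => -[].
Qed.

Definition curve n (X : 'rV[R]_n -> 'rV[R]_n) (D : set 'rV[R]_n) (a b : R) (x : R -> 'rV[R]_n) :=
  [/\ {within `[a, b], continuous x}, (forall t, a <= t <= b -> D (x t)) &
      forall t, a < t < b -> is_derive t (1 : R) x (X (x t))].

Lemma curve_sub n (X : 'rV[R]_n -> 'rV[R]_n) (D : set 'rV[R]_n) (a b c d : R) x : a <= c -> d <= b ->
  curve X D a b x -> curve X D c d x.
Proof.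
move=> ac db [xc xD xd]; split; first exact: within_continuous_sub xc.
  by move=> t /andP[ct td]; apply: xD; rewrite (le_trans ac) // (le_trans td).
by move=> t /andP[ct td]; apply: xd; rewrite (le_lt_trans ac) // (lt_le_trans td).
Qed.

Lemma is_derive_comp_diff n (W : normedModType R) (g : 'rV[R]_n -> W) (x : R -> 'rV[R]_n) t v :
  differentiable g (x t) -> is_derive t (1 : R) x v -> is_derive t (1 : R) (g \o x) ('D_v g (x t)).
Proof.
move=> dg [dx vx]; have dx' : differentiable x t by apply/derivable1_diffP.
have dc : differentiable (g \o x) t by exact: differentiable_comp.
split; first exact/derivable1_diffP.
by rewrite deriveE // diff_comp //= -[X in 'd g (x t) X]deriveE // vx -deriveE.
Qed.

Lemma curve_continuous n (X : 'rV[R]_n -> 'rV[R]_n) (D : set 'rV[R]_n) (a b : R) (x : R -> 'rV[R]_n) g :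
  curve X D a b x -> anl D g -> {within `[a, b], continuous (g \o x)}.
Proof.
move=> [xc xD _] Dg; apply: within_continuous_comp => // t /xD /(anl_differentiable Dg).
exact: differentiable_continuous.
Qed.

Lemma curve_derive n (X : 'rV[R]_n -> 'rV[R]_n) (D : set 'rV[R]_n) (a b : R) (x : R -> 'rV[R]_n) g t :
  curve X D a b x -> anl D g -> a < t < b -> is_derive t (1 : R) (g \o x) (lie X g (x t)).
Proof.
move=> [_ xD xd] Dg tab; apply: is_derive_comp_diff; last exact: xd.
by apply: anl_differentiable Dg _; apply: xD; case/andP: tab => ? ?; rewrite !ltW.
Qed.

Definition field_anl n (D : set 'rV[R]_n) (X : 'rV[R]_n -> 'rV[R]_n) :=
  forall i, anl D (fun x => X x ord0 i).

Lemma curve_bound n (X : 'rV[R]_n -> 'rV[R]_n) (D : set 'rV[R]_n) (a b : R) (x : R -> 'rV[R]_n) g t :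
  curve X D a b x -> field_anl D X -> anl D g -> a <= t <= b ->
  exists C M e : R, [/\ 0 <= C, 0 <= M, 0 < e & forall k s, a <= s <= b -> `|s - t| < e ->
    `|iter k (lie X) g (x s)| <= C * M ^+ k * k`!%:R].
Proof.
move=> [/within_continuousP xc xD _] DX Dg tab.
have Dt := xD t tab.
have [r1 [K [r10 rg]]] := Dg _ Dt.
have [r2 [L [r20 rX]]] := repr_common (fun i => DX i _ Dt).
pose r := Num.min r1 r2; have r0 : 0 < r by rewrite lt_min r10.
have rr1 : 0 <= r <= r1 by rewrite (ltW r0) ge_min lexx.
have rr2 : 0 <= r <= r2 by rewrite (ltW r0) ge_min lexx orbT.
have [C [M [C0 M0 H]]] := lie_bound r0 (repr_shrink rr1 rg) (fun i => repr_shrink rr2 (rX i)).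
have rh : 0 < r / 2 by rewrite divr_gt0.
have [e e0 eP] := xc t _ tab rh.
exists C, M, e; split=> // k s sab st; apply: H; apply/inboxP; first exact: ltW.
by apply: ltW; exact: eP.
Qed.

(** The differences of the k-th Lie derivatives along the two curves form a sequence in which each
    term is the derivative of the preceding one, with locally uniform factorial bounds. So
    [quasi_analytic] applies on short intervals and [segment_ind] covers the whole one. The two
    curves may live in different spaces, as is needed to compare systems. *)
Lemma curves_agree n1 n2 (D : set 'rV[R]_n1) (E : set 'rV[R]_n2)
    (X : 'rV[R]_n1 -> 'rV[R]_n1) (Y : 'rV[R]_n2 -> 'rV[R]_n2) g h (a b t0 : R) x y :
  field_anl D X -> field_anl E Y -> anl D g -> anl E h ->
  curve X D a b x -> curve Y E a b y -> a <= t0 <= b ->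
  (forall k, iter k (lie X) g (x t0) = iter k (lie Y) h (y t0)) ->
  forall k t, a <= t <= b -> iter k (lie X) g (x t) = iter k (lie Y) h (y t).
Proof.
move=> DX EY Dg Eh cx cy t0ab E0 k t tab.
suff : forall k, iter k (lie X) g (x t) = iter k (lie Y) h (y t) by [].
move: t tab; apply: (segment_ind t0ab E0) => t tab.
have [C1 [M1 [e1 [C10 M10 e10 H1]]]] := curve_bound cx DX Dg tab.
have [C2 [M2 [e2 [C20 M20 e20 H2]]]] := curve_bound cy EY Eh tab.
pose M := M1 + M2; pose C := C1 + C2.
(* The working interval has length at most [e], and 2 M e < 1 is required; [M + 1] avoids the
   inverse of 0. *)
pose e := Num.min (Num.min e1 e2) (8 * (M + 1))^-1.
have e0 : 0 < e by rewrite !lt_min e10 e20 invr_gt0 mulr_gt0 //; rewrite /M; lra.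
have ee1 : e <= e1 by rewrite !ge_min lexx.
have ee2 : e <= e2 by rewrite !ge_min lexx orbT.
have ee3 : 8 * M * e < 1.
  have h1 : e <= (8 * (M + 1))^-1 by rewrite !ge_min lexx orbT.
  have M0 : 0 <= M by rewrite addr_ge0.
  have h2 : 8 * M * e <= 8 * M * (8 * (M + 1))^-1 by apply: ler_wpM2l => //; rewrite mulr_ge0.
  apply: le_lt_trans h2 _; rewrite ltr_pdivrMr ?mul1r; lra.
exists (e / 2); first by rewrite divr_gt0.
move=> s s' sab s'ab st s't Es j.
pose a' := Num.max a (t - e / 2); pose b' := Num.min b (t + e / 2).
have aa' : a <= a' by rewrite le_max lexx.
have bb' : b' <= b by rewrite ge_min lexx.
have ta' : t - e / 2 <= a' by rewrite le_max lexx orbT.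
have tb' : b' <= t + e / 2 by rewrite ge_min lexx orbT.
have in' u : a <= u <= b -> `|u - t| < e / 2 -> a' <= u <= b'.
  move=> /andP[au ub]; rewrite ltr_norml => /andP[h1 h2].
  by rewrite /a' /b' ge_max le_min au ub /=; apply/andP; split; lra.
have cx' := curve_sub aa' bb' cx; have cy' := curve_sub aa' bb' cy.
have Dk i : anl D (iter i (lie X) g) by exact: anl_iter_lie.
have Ek i : anl E (iter i (lie Y) h) by exact: anl_iter_lie.
apply/eqP; rewrite -subr_eq0; apply/eqP.
apply: (@quasi_analytic (fun i u => iter i (lie X) g (x u) - iter i (lie Y) h (y u)) a' b' s C M).
- move=> i; apply/subspace_continuousP => u uab; apply: cvgB.
    by have /subspace_continuousP := curve_continuous cx' (Dk i); apply.
  by have /subspace_continuousP := curve_continuous cy' (Ek i); apply.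
- move=> i u uab; have := curve_derive cx' (Dk i) uab; have := curve_derive cy' (Ek i) uab.
  by move=> d1 d2; exact: is_deriveB.
- by rewrite addr_ge0.
- by rewrite addr_ge0.
- apply: le_lt_trans ee3; rewrite -mulrA -[8 * M]mulrC -mulrA.
  have M0 : 0 <= M by rewrite addr_ge0.
  have : M * (b' - a') <= M * e by apply: ler_wpM2l => //; lra.
  have : 0 <= M * e by rewrite mulr_ge0 // ltW.
  lra.
- move=> i u /andP[au ub].
  have uab : a <= u <= b by rewrite (le_trans aa') // (le_trans ub).
  have ut : `|u - t| < e by rewrite ltr_norml; apply/andP; split; lra.
  apply: le_trans (ler_normB _ _) _.
  apply: le_trans (lerD (H1 i u uab (lt_le_trans ut ee1)) (H2 i u uab (lt_le_trans ut ee2))) _.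
  rewrite -mulrDl ler_wpM2r // /C mulrDl; apply: lerD; apply: ler_wpM2l => //.
    by rewrite lerXn2r // ?nnegrE ?addr_ge0 // lerDl.
  by rewrite lerXn2r // ?nnegrE ?addr_ge0 // lerDr.
- exact: in'.
- by move=> i; rewrite Es subrr.
- exact: in'.
Qed.

(** Differentiating an equality of functions of t inside the interval gives the next Lie derivative;
    continuity adds the two ends, and the end t = 0 is the one used later. *)
Lemma curves_agree_lie n1 n2 (D : set 'rV[R]_n1) (E : set 'rV[R]_n2)
    (X : 'rV[R]_n1 -> 'rV[R]_n1) (Y : 'rV[R]_n2 -> 'rV[R]_n2) g h (a b : R) x y :
  field_anl D X -> field_anl E Y -> anl D g -> anl E h ->
  curve X D a b x -> curve Y E a b y -> a < b ->
  (forall t, a <= t <= b -> g (x t) = h (y t)) ->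
  forall k t, a <= t <= b -> iter k (lie X) g (x t) = iter k (lie Y) h (y t).
Proof.
move=> DX EY Dg Eh cx cy ab gh; elim=> [|k IH] //.
have Dk i : anl D (iter i (lie X) g) by exact: anl_iter_lie.
have Ek i : anl E (iter i (lie Y) h) by exact: anl_iter_lie.
pose f t := iter k.+1 (lie X) g (x t) - iter k.+1 (lie Y) h (y t).
suff H t : a <= t <= b -> f t = 0 by move=> t /H/eqP; rewrite subr_eq0 => /eqP.
move: t; apply: within_continuous_const => //.
  apply/subspace_continuousP => u uab; apply: cvgB.
    by have /subspace_continuousP := curve_continuous cx (Dk k.+1); apply.
  by have /subspace_continuousP := curve_continuous cy (Ek k.+1); apply.
move=> t tab.
have d1 := curve_derive cx (Dk k) tab; have d2 := curve_derive cy (Ek k) tab.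
have [_ dE] := is_deriveB d1 d2; rewrite -[f t]dE.
rewrite -[RHS](derive_cst (0 : R) t (1 : R)); apply: near_eq_derive.
have tab' : t \in `]a, b[ by rewrite in_itv.
near=> s; have : s \in `]a, b[ by near: s; exact: near_in_itvoo.
rewrite in_itv /= => /andP[sa sb]; rewrite fctE /= IH ?subrr // (ltW sa) ltW //.
Unshelve. all: by end_near. Qed.

End Curves.

(** * Semialgebraic sets and Nash functions *)

Section Definability.
Variable (R : realType).
Local Notation formula := (ordered_qelim.ord.formula R).
Local Notation holds := (@ordered_qelim.ord.holds R).
Local Notation env := (nat -> R).

Definition sat n (c : seq (mpoly n R) * seq (mpoly n R)) (x : 'rV[R]_n) : bool :=
  all (fun P => peval P x == 0) c.1 && all (fun P => 0 < peval P x) c.2.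

Lemma semialgebraicP n (S : set 'rV[R]_n) :
  semialgebraic S <-> exists F, forall x, S x <-> has (fun c => sat c x) F.
Proof.
split=> [[F ->]|[F HF]]; first by exists F.
by exists F; apply/seteqP; split=> x; [move=> /HF|move=> /HF].
Qed.

Lemma semialgebraicU n (S T : set 'rV[R]_n) :
  semialgebraic S -> semialgebraic T -> semialgebraic (S `|` T).
Proof.
move=> /semialgebraicP[F HF] /semialgebraicP[G HG]; apply/semialgebraicP.
exists (F ++ G) => x; rewrite has_cat; split.
  by move=> [/HF ->|/HG ->]; rewrite ?orbT.
by move=> /orP[/HF|/HG]; [left|right].
Qed.

Lemma semialgebraicI n (S T : set 'rV[R]_n) :
  semialgebraic S -> semialgebraic T -> semialgebraic (S `&` T).
Proof.
move=> /semialgebraicP[F HF] /semialgebraicP[G HG]; apply/semialgebraicP.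
exists [seq (c.1 ++ d.1, c.2 ++ d.2) | c <- F, d <- G] => x; split.
  move=> [/HF/hasP[c cF sc] /HG/hasP[d dG sd]]; apply/hasP.
  exists (c.1 ++ d.1, c.2 ++ d.2); first by apply/allpairsP; exists (c, d).
  by move: sc sd; rewrite /sat /= !all_cat => /andP[-> ->] /andP[-> ->].
move=> /hasP[_ /allpairsP[[c d] [/= cF dG ->]]].
rewrite /sat /= !all_cat => /andP[/andP[a1 a2] /andP[a3 a4]].
by split; [apply/HF|apply/HG]; apply/hasP; [exists c|exists d] => //; apply/andP.
Qed.

Lemma semialgebraic_set0 n : semialgebraic (set0 : set 'rV[R]_n).
Proof. by apply/semialgebraicP; exists [::]. Qed.

Lemma semialgebraic_setT n : semialgebraic (setT : set 'rV[R]_n).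
Proof. by apply/semialgebraicP; exists [:: ([::], [::])]. Qed.

Lemma semialgebraic_eq n (P : mpoly n R) : semialgebraic [set x | peval P x = 0].
Proof.
apply/semialgebraicP; exists [:: ([:: P], [::])] => x; rewrite /sat /= !andbT orbF.
by split=> [->|/eqP].
Qed.

Lemma semialgebraic_gt n (P : mpoly n R) : semialgebraic [set x | 0 < peval P x].
Proof.
by apply/semialgebraicP; exists [:: ([::], [:: P])] => x; rewrite /sat /= !andbT orbF.
Qed.

Lemma pevalN n (P : mpoly n R) x : peval (- P) x = - peval P x.
Proof. exact: mpoly.mevalN. Qed.

Lemma semialgebraic_iff n (S T : set 'rV[R]_n) : (forall x, S x <-> T x) ->
  semialgebraic S -> semialgebraic T.
Proof. by move=> ST; have -> : S = T by apply/seteqP; split=> x /ST. Qed.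

Lemma semialgebraicC n (S : set 'rV[R]_n) : semialgebraic S -> semialgebraic (~` S).
Proof.
have Ceq (P : mpoly n R) : semialgebraic (~` [set x | peval P x = 0]).
  apply: semialgebraic_iff (semialgebraicU (semialgebraic_gt P) (semialgebraic_gt (- P))) => x /=.
  rewrite /setU /= pevalN oppr_gt0; split.
    by move=> [h|h] e; move: h; rewrite e ltxx.
  by move=> /eqP; rewrite neq_lt => /orP[|]; [right|left].
have Cgt (P : mpoly n R) : semialgebraic (~` [set x | 0 < peval P x]).
  apply: semialgebraic_iff (semialgebraicU (semialgebraic_eq P) (semialgebraic_gt (- P))) => x /=.
  rewrite /setU /= pevalN oppr_gt0; split=> [[->|h]|]; rewrite ?ltxx //.
    by rewrite ltNge ltW.
  by move=> /negP; rewrite -leNgt le_eqVlt => /orP[/eqP|]; [left|right].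
move=> /semialgebraicP[F HF]; apply: (@semialgebraic_iff _ (~` [set x | has (fun c => sat c x) F])).
  by move=> x; split=> h /HF.
elim: F {S HF} => [|[A B] F IH].
  by apply: semialgebraic_iff (@semialgebraic_setT n) => x; split.
have CA : semialgebraic (~` [set x | all (fun P => peval P x == 0) A]).
  elim: A => [|P A IHA]; first by apply: semialgebraic_iff (@semialgebraic_set0 n) => x; split=> //; apply.
  apply: semialgebraic_iff (semialgebraicU (Ceq P) IHA) => x /=; rewrite /setU /=; split.
    by move=> [h|h] /andP[/eqP].
  by move=> /negP; rewrite negb_and => /orP[/eqP|/negP]; [left|right].
have CB : semialgebraic (~` [set x | all (fun P => 0 < peval P x) B]).
  elim: B => [|P B IHB]; first by apply: semialgebraic_iff (@semialgebraic_set0 n) => x; split=> //; apply.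
  apply: semialgebraic_iff (semialgebraicU (Cgt P) IHB) => x /=; rewrite /setU /=; split.
    by move=> [h|h] /andP[].
  by move=> /negP; rewrite negb_and => /orP[/negP|/negP]; [left|right].
apply: semialgebraic_iff (semialgebraicI (semialgebraicU CA CB) IH) => x.
rewrite /setU /setI /sat /=; split.
  by move=> [h1 h2] /orP[/andP[a b]|//]; case: h1; apply.
move=> /negP; rewrite negb_or negb_and => /andP[/orP h1 /negP h2]; split=> //.
by case: h1 => /negP; [left|right].
Qed.

Definition vget n (v : 'rV[R]_n) (j : nat) : R := if insub j is Some i then v ord0 i else 0.

Lemma vget_ord n (v : 'rV[R]_n) (i : 'I_n) : vget v i = v ord0 i.
Proof. by rewrite /vget; case: insubP => [j _ /val_inj ->|]; rewrite ?ltn_ord. Qed.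

Definition vseq n (v : 'rV[R]_n) : seq R := [seq v ord0 i | i <- enum 'I_n].

Lemma nth_vseq n (v : 'rV[R]_n) : nth 0 (vseq v) = vget v.
Proof.
apply/funext => j; rewrite /vget; case: insubP => [i _ <- /=|].
  by rewrite (nth_map i) ?size_enum_ord // nth_ord_enum.
by rewrite -leqNgt => nj; rewrite nth_default // size_map size_enum_ord.
Qed.

(** Variables beyond [n] read the default 0 of [nth]; the value at an inverse is arbitrary, since
    only ring terms are translated. *)
Fixpoint term_poly n (t : GRing.term R) : mpoly n R :=
  match t with
  | GRing.Var j => if insub j is Some i then mpolyX R (mpoly.mnm1 i) else 0
  | GRing.Const c => mpolyC n c
  | GRing.NatConst k => mpolyC n k%:R
  | GRing.Add t1 t2 => term_poly n t1 + term_poly n t2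
  | GRing.Opp t1 => - term_poly n t1
  | GRing.NatMul t1 k => term_poly n t1 *+ k
  | GRing.Mul t1 t2 => term_poly n t1 * term_poly n t2
  | GRing.Inv _ => 0
  | GRing.Exp t1 k => term_poly n t1 ^+ k
  end.

Lemma term_polyE n t (x : 'rV[R]_n) : GRing.rterm t ->
  GRing.eval (vseq x) t = peval (term_poly n t) x.
Proof.
rewrite /peval; elim: t => //=.
- move=> j _; rewrite nth_vseq /vget; case: insubP => [i _ _|_]; last by rewrite mpoly.meval0.
  by rewrite mpoly.mevalXU.
- by move=> c _; rewrite mpoly.mevalC.
- by move=> k _; rewrite mpoly.mevalC.
- by move=> t1 IH1 t2 IH2 /andP[/IH1 -> /IH2 ->]; rewrite mpoly.mevalD.
- by move=> t1 IH1 /IH1 ->; rewrite mpoly.mevalN.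
- by move=> t1 IH1 k /IH1 ->; rewrite mpoly.mevalMn.
- by move=> t1 IH1 t2 IH2 /andP[/IH1 -> /IH2 ->]; rewrite mpoly.mevalM.
- by move=> t1 IH1 k /IH1 ->; rewrite rmorphXn.
Qed.

Lemma semialgebraic_qf n (f : formula) :
  ordered_qelim.ord.qf_form f -> ordered_qelim.ord.rformula f ->
  semialgebraic [set x : 'rV[R]_n | ordered_qelim.ord.qf_eval (vseq x) f].
Proof.
elim: f => //=.
- move=> [] _ _; first by apply: semialgebraic_iff (@semialgebraic_setT n) => x; split.
  by apply: semialgebraic_iff (@semialgebraic_set0 n) => x; split.
- move=> t1 t2 _ /andP[r1 r2].
  apply: semialgebraic_iff (semialgebraic_eq (term_poly n t1 - term_poly n t2)) => x /=.
  rewrite pevalB !term_polyE //; split; first by move/eqP; rewrite subr_eq0.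
  by move/eqP ->; rewrite subrr.
- move=> t1 t2 _ /andP[r1 r2].
  apply: semialgebraic_iff (semialgebraic_gt (term_poly n t2 - term_poly n t1)) => x /=.
  by rewrite pevalB subr_gt0 !term_polyE.
- move=> t1 t2 _ /andP[r1 r2].
  apply: semialgebraic_iff (semialgebraicC (semialgebraic_gt (term_poly n t1 - term_poly n t2))) => x /=.
  by rewrite pevalB subr_gt0 !term_polyE // leNgt; split=> /negP.
- move=> f1 IH1 f2 IH2 /andP[q1 q2] /andP[r1 r2].
  apply: semialgebraic_iff (semialgebraicI (IH1 q1 r1) (IH2 q2 r2)) => x.
  by split=> [[/= -> ->]|/andP].
- move=> f1 IH1 f2 IH2 /andP[q1 q2] /andP[r1 r2].
  apply: semialgebraic_iff (semialgebraicU (IH1 q1 r1) (IH2 q2 r2)) => x.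
  by split=> [[/= ->|/= ->]|/orP]; rewrite ?orbT.
- move=> f1 IH1 f2 IH2 /andP[q1 q2] /andP[r1 r2].
  apply: semialgebraic_iff (semialgebraicU (semialgebraicC (IH1 q1 r1)) (IH2 q2 r2)) => x.
  split=> [[/= /negP/negbTE -> //|/= ->]|/=]; first by rewrite implybT.
  by rewrite implybE => /orP[/negP|]; [left|right].
- move=> f1 IH1 q1 r1; apply: semialgebraic_iff (semialgebraicC (IH1 q1 r1)) => x.
  by split=> [/= /negP|/negP].
Qed.

(* Sets and functions of environments definable in the language of ordered rings. *)
Definition dfn (S : env -> Prop) : Prop :=
  exists f : formula, forall e : seq R, holds e f <-> S (nth 0 e).

Definition tfn (t : env -> R) : Prop :=
  exists u : GRing.term R, forall e : seq R, GRing.eval e u = t (nth 0 e).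

(** Inverses are removed first by [to_rform], then quantifiers are eliminated over the real closed
    field [R]; what remains is a Boolean combination of polynomial conditions. *)
Lemma semialgebraic_dfn n (S : env -> Prop) : dfn S ->
  semialgebraic [set x : 'rV[R]_n | S (vget x)].
Proof.
move=> [f fS].
have wf := @qe_rcf.wf_QE_wproj R; have va := @qe_rcf.valid_QE_wproj R.
have rf := ordered_qelim.ord.to_rform_rformula f.
have /andP[q r] := ordered_qelim.ord.quantifier_elim_wf wf rf.
apply: semialgebraic_iff (semialgebraic_qf n q r) => x /=.
rewrite -nth_vseq -fS -(ordered_qelim.ord.to_rformP (vseq x) f).
apply: iff_sym; exact: (rwP (ordered_qelim.ord.quantifier_elim_rformP wf va (vseq x) rf)).
Qed.

Lemma dfn_iff (S T : env -> Prop) : (forall e, S e <-> T e) -> dfn S -> dfn T.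
Proof. by move=> ST [f fS]; exists f => e; rewrite fS. Qed.

Lemma dfnI (S T : env -> Prop) : dfn S -> dfn T -> dfn (fun e => S e /\ T e).
Proof.
by move=> [f fS] [g gT]; exists (ordered_qelim.ord.And f g) => e /=; rewrite fS gT.
Qed.

Lemma dfnU (S T : env -> Prop) : dfn S -> dfn T -> dfn (fun e => S e \/ T e).
Proof.
by move=> [f fS] [g gT]; exists (ordered_qelim.ord.Or f g) => e /=; rewrite fS gT.
Qed.

Lemma dfn_imp (S T : env -> Prop) : dfn S -> dfn T -> dfn (fun e => S e -> T e).
Proof.
by move=> [f fS] [g gT]; exists (ordered_qelim.ord.Implies f g) => e /=; rewrite fS gT.
Qed.

Lemma dfnC (S : env -> Prop) : dfn S -> dfn (fun e => ~ S e).
Proof. by move=> [f fS]; exists (ordered_qelim.ord.Not f) => e /=; rewrite fS. Qed.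

Lemma dfn_bool (b : bool) : dfn (fun=> b).
Proof. by exists (@ordered_qelim.ord.Bool R b). Qed.

Definition upd (e : env) i (x : R) : env := fun j => if j == i then x else e j.

Lemma nth_upd (e : seq R) i x : nth 0 (set_nth 0 e i x) = upd (nth 0 e) i x.
Proof. by apply/funext => j; rewrite nth_set_nth. Qed.

Lemma dfn_ex i (S : env -> Prop) : dfn S -> dfn (fun e => exists x, S (upd e i x)).
Proof.
move=> [f fS]; exists (ordered_qelim.ord.Exists i f) => e /=.
by split=> -[x]; [rewrite fS nth_upd|rewrite -nth_upd -fS]; exists x.
Qed.

Lemma dfn_all i (S : env -> Prop) : dfn S -> dfn (fun e => forall x, S (upd e i x)).
Proof.
move=> [f fS]; exists (ordered_qelim.ord.Forall i f) => e /=.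
by split=> H x; have := H x; rewrite ?fS nth_upd // -nth_upd -fS.
Qed.

Lemma dfn_forall_ord k (S : 'I_k -> env -> Prop) : (forall i, dfn (S i)) ->
  dfn (fun e => forall i, S i e).
Proof.
move=> dS; suff H (s : seq 'I_k) : dfn (fun e => forall i, i \in s -> S i e).
  apply: dfn_iff (H (enum 'I_k)) => e; split=> h i; last by move=> _.
  by apply: h; rewrite mem_enum.
elim: s => [|i s IH]; first by apply: dfn_iff (dfn_bool true) => e; split.
apply: dfn_iff (dfnI (dS i) IH) => e; split.
  by move=> [h1 h2] j; rewrite inE => /orP[/eqP ->|/h2].
by move=> h; split=> [|j js]; apply: h; rewrite inE ?eqxx // js orbT.
Qed.

Lemma tfn_var i : tfn (fun e => e i). Proof. by exists (GRing.Var R i). Qed.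
Lemma tfn_cst c : tfn (fun=> c). Proof. by exists (GRing.Const c). Qed.
Lemma tfnD s t : tfn s -> tfn t -> tfn (fun e => s e + t e).
Proof. by move=> [u us] [v vt]; exists (GRing.Add u v) => e /=; rewrite us vt. Qed.
Lemma tfnM s t : tfn s -> tfn t -> tfn (fun e => s e * t e).
Proof. by move=> [u us] [v vt]; exists (GRing.Mul u v) => e /=; rewrite us vt. Qed.
Lemma tfnN s : tfn s -> tfn (fun e => - s e).
Proof. by move=> [u us]; exists (GRing.Opp u) => e /=; rewrite us. Qed.
Lemma tfnB s t : tfn s -> tfn t -> tfn (fun e => s e - t e).
Proof. by move=> ts tt; apply: tfnD => //; exact: tfnN. Qed.
Lemma tfnX s k : tfn s -> tfn (fun e => s e ^+ k).
Proof. by move=> [u us]; exists (GRing.Exp u k) => e /=; rewrite us. Qed.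
Lemma tfn_ext s t : (forall e, s e = t e) -> tfn s -> tfn t.
Proof. by move=> st [u us]; exists u => e; rewrite us. Qed.

Lemma tfn_peval n (P : mpoly n R) (t : 'I_n -> env -> R) : (forall i, tfn (t i)) ->
  tfn (fun e => peval P (\row_i t i e)).
Proof.
move=> tt; suff H (s : seq (multinom n)) : tfn (fun e => \sum_(m <- s) mcoeff m P * \prod_(i < n) (t i e) ^+ m i).
  apply: tfn_ext (H (msupp P)) => e; rewrite /peval mpoly.mevalE; apply: eq_bigr => m _.
  by congr (_ * _); apply: eq_bigr => i _; rewrite mxE.
elim: s => [|m s IH]; first by apply: tfn_ext (tfn_cst 0) => e; rewrite big_nil.
have pr : tfn (fun e => \prod_(i < n) (t i e) ^+ m i).
  elim: (index_enum _) => [|i r IHr]; first by apply: tfn_ext (tfn_cst 1) => e; rewrite big_nil.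
  by apply: tfn_ext (tfnM (tfnX (m i) (tt i)) IHr) => e; rewrite big_cons.
by apply: tfn_ext (tfnD (tfnM (tfn_cst (mcoeff m P)) pr) IH) => e; rewrite big_cons.
Qed.

Lemma dfn_eq s t : tfn s -> tfn t -> dfn (fun e => s e = t e).
Proof. by move=> [u us] [v vt]; exists (ordered_qelim.ord.Equal u v) => e /=; rewrite us vt. Qed.
Lemma dfn_lt s t : tfn s -> tfn t -> dfn (fun e => s e < t e).
Proof. by move=> [u us] [v vt]; exists (ordered_qelim.ord.Lt u v) => e /=; rewrite us vt. Qed.
Lemma dfn_le s t : tfn s -> tfn t -> dfn (fun e => s e <= t e).
Proof. by move=> [u us] [v vt]; exists (ordered_qelim.ord.Le u v) => e /=; rewrite us vt. Qed.

Lemma dfn_semialgebraic n (Z : set 'rV[R]_n) (t : 'I_n -> env -> R) : semialgebraic Z ->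
  (forall i, tfn (t i)) -> dfn (fun e => Z (\row_i t i e)).
Proof.
move=> /semialgebraicP[F HF] tt.
apply: (@dfn_iff (fun e => has (fun c => sat c (\row_i t i e)) F)).
  by move=> e; split=> /HF.
elim: F {HF} => [|[A B] F IH]; first exact: (dfn_bool false).
have dA : dfn (fun e => all (fun P => peval P (\row_i t i e) == 0) A).
  elim: A => [|P A IHA]; first exact: (dfn_bool true).
  apply: dfn_iff (dfnI (dfn_eq (tfn_peval P tt) (tfn_cst 0)) IHA) => e /=.
  by split=> [[/eqP -> ->]|/andP[/eqP -> ->]].
have dB : dfn (fun e => all (fun P => 0 < peval P (\row_i t i e)) B).
  elim: B => [|P B IHB]; first exact: (dfn_bool true).
  apply: dfn_iff (dfnI (dfn_lt (tfn_cst 0) (tfn_peval P tt)) IHB) => e /=.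
  by split=> [[-> ->]|/andP[-> ->]].
apply: dfn_iff (dfnU (dfnI dA dB) IH) => e /=; rewrite /sat /=; split.
  by move=> [[-> ->]|->]; rewrite ?orbT.
by move=> /orP[/andP|]; [left|right].
Qed.

Definition updv (e : env) N k (w : 'rV[R]_k) : env :=
  fun j => if (N <= j < N + k)%N then vget w (j - N) else e j.

Lemma updv_low e N k (w : 'rV[R]_k) j : (j < N)%N -> updv e N w j = e j.
Proof. by move=> jN; rewrite /updv leqNgt jN. Qed.

Lemma updv_in e N k (w : 'rV[R]_k) (i : 'I_k) : updv e N w (N + i)%N = w ord0 i.
Proof. by rewrite /updv leq_addr ltn_add2l ltn_ord addKn vget_ord. Qed.

Lemma dfn_exv N k (S : env -> Prop) : dfn S -> dfn (fun e => exists w : 'rV[R]_k, S (updv e N w)).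
Proof.
(* The induction runs over functions on [nat], whose last relevant value can be changed without
   splitting a row vector. *)
have H (T : env -> Prop) : dfn T ->
    dfn (fun e => exists w : nat -> R, T (fun j => if (N <= j < N + k)%N then w (j - N)%N else e j)).
  elim: k T => [|k IH] T dT.
    apply: dfn_iff dT => e; have E w : (fun j : nat => if (N <= j < N + 0)%N then w (j - N)%N else e j) = e :> env.
      by apply/funext => j; rewrite addn0; case: (leqP N j).
    split=> [Te|[w]]; last by rewrite E.
    by exists (fun=> 0); congr T: Te; exact/esym/(E (fun=> 0)).
  apply: dfn_iff (dfn_ex (N + k) (IH _ dT)) => e; split.
    move=> [x [w Tw]]; exists (fun j => if j == k then x else w j).
    congr T: Tw; apply/funext => j; rewrite /upd addnS ltnS.
    have [->|jk] := eqVneq j (N + k)%N.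
      by rewrite leq_addr leqnn ltnn addKn eqxx.
    rewrite [(j <= N + k)%N]leq_eqVlt (negbTE jk) /=.
    case: ifP => // /andP[Nj _]; case: eqP => // jNk; move: jk.
    by rewrite -jNk subnKC // eqxx.
  move=> [w Tw]; exists (w k), w; congr T: Tw; apply/funext => j; rewrite /upd addnS ltnS.
  have [->|jk] := eqVneq j (N + k)%N.
    by rewrite leq_addr leqnn ltnn addKn.
  by rewrite [(j <= N + k)%N]leq_eqVlt (negbTE jk) /=.
move=> /H; apply: dfn_iff => e; split.
  move=> [w Tw]; exists (\row_(i < k) w i); congr S: Tw; apply/funext => j; rewrite /updv.
  case: ifP => // /andP[Nj jk]; have jNk : (j - N < k)%N by rewrite ltn_subLR.
  by rewrite -[(j - N)%N]/(val (Ordinal jNk)) vget_ord mxE.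
by move=> [w Sw]; exists (vget w).
Qed.

End Definability.

(** * Closure properties of Nash functions, and the size of semialgebraic sets *)

Section NashFunctions.
Variable (R : realType).
Local Notation env := (nat -> R).

(* An environment stores a vector of R^k at the positions [N], ..., [N + k - 1]. *)
Definition erow k N (e : env) : 'rV[R]_k := \row_(i < k) e (N + i)%N.

Lemma erow_updv k N (e : env) (w : 'rV[R]_k) : erow k N (updv e N w) = w.
Proof. by apply/rowP => i; rewrite mxE updv_in. Qed.

Lemma erow_updv_low k M N l (e : env) (w : 'rV[R]_l) : (M + k <= N)%N ->
  erow k M (updv e N w) = erow k M e.
Proof.
move=> MN; apply/rowP => i; rewrite !mxE updv_low //.
by rewrite (leq_trans _ MN) // ltn_add2l.
Qed.

Lemma erow_upd k M i (e : env) x : (M + k <= i)%N -> erow k M (upd e i x) = erow k M e.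
Proof.
move=> Mi; apply/rowP => j; rewrite !mxE /upd; case: eqP => // E.
by move: Mi; rewrite -E leq_add2l leqNgt ltn_ord.
Qed.

Lemma updE (e : env) i x : upd e i x i = x. Proof. by rewrite /upd eqxx. Qed.
Lemma upd_neq (e : env) i j x : (j != i)%N -> upd e i x j = e j.
Proof. by rewrite /upd => /negbTE ->. Qed.

Lemma erow_vget k (v : 'rV[R]_k) : erow k 0 (vget v) = v.
Proof. by apply/rowP => i; rewrite mxE add0n vget_ord. Qed.

Lemma graph_onP n (D : set 'rV[R]_n) (g : 'rV[R]_n -> R) (x : 'rV[R]_n) (y : R) :
  graph_on D g (row_mx x (y%:M : 'rV[R]_1)) <-> D x /\ y = g x.
Proof.
split=> [[x' Dx' /eq_row_mx[E1 E2]]|[Dx ->]]; last by exists x.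
subst x'; split=> //; move/matrixP: E2 => /(_ 0 0); rewrite !mxE eqxx !mulr1n.
by move=> ->.
Qed.

Lemma graph_on_split n (D : set 'rV[R]_n) g (z : 'rV[R]_(n + 1)) :
  graph_on D g z <-> D (lsubmx z) /\ z ord0 (rshift n ord0) = g (lsubmx z).
Proof.
rewrite -{1}(hsubmxK z).
have -> : rsubmx z = ((z ord0 (rshift n ord0))%:M : 'rV[R]_1).
  by apply/matrixP => i j; rewrite (ord1 i) (ord1 j) !mxE eqxx mulr1n.
exact: graph_onP.
Qed.

(** A formula has access to [g] only through its graph over [D]; hence the conjunct on [D], and
    later an extra quantified variable for each value of [g]. *)
Lemma dfn_graph n (D : set 'rV[R]_n) g (t : 'I_n -> env -> R) u :
  semialgebraic (graph_on D g) -> (forall i, tfn (t i)) -> tfn u ->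
  dfn (fun e => D (\row_i t i e) /\ u e = g (\row_i t i e)).
Proof.
move=> sg tt tu.
pose s (i : 'I_(n + 1)) : env -> R := match fintype.split i with inl j => t j | inr _ => u end.
have ts i : tfn (s i) by rewrite /s; case: (fintype.split i).
apply: dfn_iff (dfn_semialgebraic sg ts) => e.
rewrite graph_on_split.
have -> : lsubmx (\row_i s i e) = \row_i t i e.
  apply/rowP => i; rewrite !mxE /s -[lshift 1 i]/(unsplit (inl i)) unsplitK //.
by rewrite mxE /s -[rshift n ord0]/(unsplit (inr ord0)) unsplitK.
Qed.

Lemma dfn_graph_erow n (D : set 'rV[R]_n) g N u :
  semialgebraic (graph_on D g) -> tfn u ->
  dfn (fun e => D (erow n N e) /\ u e = g (erow n N e)).
Proof. by move=> sg tu; apply: dfn_graph => // i; exact: tfn_var. Qed.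

Lemma semialgebraic_graph n (D : set 'rV[R]_n) g :
  dfn (fun e : env => D (erow n 0 e) /\ e n = g (erow n 0 e)) ->
  semialgebraic (graph_on D g).
Proof.
move=> /(semialgebraic_dfn (n + 1)); apply: semialgebraic_iff => z /=.
rewrite graph_on_split.
have -> : erow n 0 (vget z) = lsubmx z.
  by apply/rowP => i; rewrite !mxE add0n -(vget_ord z (lshift 1 i)).
by rewrite -(vget_ord z) /= addn0.
Qed.

Lemma semialgebraic_erow n (Z : set 'rV[R]_n) (S : env -> Prop) : dfn S ->
  (forall z, Z z <-> S (vget z)) -> semialgebraic Z.
Proof. by move=> dS ZS; apply: semialgebraic_iff (semialgebraic_dfn n dS) => x /=; rewrite ZS. Qed.

Lemma dfn_erow k N (Z : set 'rV[R]_k) : semialgebraic Z -> dfn (fun e => Z (erow k N e)).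
Proof. by move=> sZ; apply: dfn_semialgebraic => // i; exact: tfn_var. Qed.

Lemma semialgebraic_graph_poly n (P : mpoly n R) : semialgebraic (graph_on setT (fun x => peval P x)).
Proof.
apply: semialgebraic_graph.
have tP := @tfn_peval R n P (fun i e => e (0 + i)%N) (fun i => tfn_var R (0 + i)%N).
by apply: dfn_iff (dfn_eq (tfn_var R n) tP) => e; split=> [->|[]].
Qed.

Lemma semialgebraic_graph_sub n (D E : set 'rV[R]_n) g : semialgebraic D ->
  (forall x, D x -> E x) -> semialgebraic (graph_on E g) -> semialgebraic (graph_on D g).
Proof.
move=> sD DE sg; apply: semialgebraic_graph.
apply: dfn_iff (dfnI (dfn_erow 0 sD) (dfn_graph_erow 0 sg (tfn_var R n))) => e.
by split=> [[? []]|[]] // d ->; split=> //; split=> //; exact: DE.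
Qed.

Lemma semialgebraic_graph_eq n (D : set 'rV[R]_n) g h : (forall x, D x -> g x = h x) ->
  semialgebraic (graph_on D g) -> semialgebraic (graph_on D h).
Proof.
move=> gh; apply: semialgebraic_iff => z; rewrite !graph_on_split.
by split=> -[Dz]; rewrite gh.
Qed.

Lemma semialgebraic_dom n (D : set 'rV[R]_n) g : semialgebraic (graph_on D g) -> semialgebraic D.
Proof.
move=> sg; apply: (semialgebraic_erow (dfn_ex n (dfn_graph_erow 0 sg (tfn_var R n)))) => z.
split=> [Dz|[x []]].
  by exists (g z); rewrite erow_upd ?add0n // erow_vget /upd eqxx.
by rewrite erow_upd ?add0n // erow_vget.
Qed.

Lemma semialgebraic_graph_comp n k (D : set 'rV[R]_k) (E : set 'rV[R]_n) g (F : 'rV[R]_k -> 'rV[R]_n) :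
  semialgebraic D ->
  (forall x, D x -> E (F x)) -> semialgebraic (graph_on E g) ->
  (forall i, semialgebraic (graph_on D (fun x => F x ord0 i))) ->
  semialgebraic (graph_on D (fun x => g (F x))).
Proof.
move=> sD DE sg sF; apply: semialgebraic_graph.
have d1 : dfn (fun e : env => forall i : 'I_n, D (erow k 0 e) /\ e (k.+1 + i)%N = F (erow k 0 e) ord0 i).
  by apply: dfn_forall_ord => i; apply: dfn_graph_erow (sF i) (tfn_var R _).
have d2 := dfn_graph_erow k.+1 sg (tfn_var R k).
have d3 := dfnI (dfn_erow 0 sD) (dfn_exv k.+1 n (dfnI d1 d2)).
apply: dfn_iff d3 => e.
have E1 w : erow k 0 (updv e k.+1 w) = erow k 0 e :> 'rV[R]_k by rewrite erow_updv_low.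
split=> [[De [w [H]]]|[De ee]].
  rewrite erow_updv updv_low // => -[Ew ew]; split=> //; rewrite ew; congr g.
  by apply/rowP => i; have [_] := H i; rewrite E1 updv_in.
split=> //; exists (F (erow k 0 e)); rewrite erow_updv updv_low //; split; last by split=> //; exact: DE.
by move=> i; rewrite E1 updv_in.
Qed.

Lemma semialgebraic_image n k (D : set 'rV[R]_k) (F : 'rV[R]_k -> 'rV[R]_n) :
  semialgebraic D -> (forall i, semialgebraic (graph_on D (fun x => F x ord0 i))) ->
  semialgebraic [set F x | x in D].
Proof.
move=> sD sF.
have d1 : dfn (fun e : env => forall i : 'I_n, D (erow k n e) /\ e i = F (erow k n e) ord0 i).
  by apply: dfn_forall_ord => i; apply: dfn_graph_erow (sF i) (tfn_var R _).
apply: (semialgebraic_erow (dfn_exv n k (dfnI (dfn_erow n sD) d1))) => z; split.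
  move=> [x Dx <-]; exists x; rewrite erow_updv; split=> // i; split=> //.
  by rewrite updv_low // vget_ord.
move=> [w]; rewrite erow_updv => -[Dw H]; exists w => //; apply/rowP => i.
by have [_] := H i; rewrite updv_low // vget_ord => ->.
Qed.

Lemma semialgebraic_preimage n k (D : set 'rV[R]_k) (V : set 'rV[R]_n) (F : 'rV[R]_k -> 'rV[R]_n) :
  semialgebraic D -> semialgebraic V -> (forall i, semialgebraic (graph_on D (fun x => F x ord0 i))) ->
  semialgebraic [set x | D x /\ V (F x)].
Proof.
move=> sD sV sF.
have d1 : dfn (fun e : env => forall i : 'I_n, D (erow k 0 e) /\ e (k + i)%N = F (erow k 0 e) ord0 i).
  by apply: dfn_forall_ord => i; apply: dfn_graph_erow (sF i) (tfn_var R _).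
have d2 := dfn_erow k sV.
apply: (semialgebraic_erow (dfnI (dfn_erow 0 sD) (dfn_exv k n (dfnI d1 d2)))) => z /=.
have E1 w : erow k 0 (updv (vget z) k w) = z :> 'rV[R]_k by rewrite erow_updv_low // erow_vget.
rewrite erow_vget; split=> [[Dz Vz]|[Dz [w]]].
  by split=> //; exists (F z); rewrite erow_updv; split=> // i; rewrite E1 updv_in.
rewrite erow_updv => -[H Vw]; split=> //; suff -> : F z = w by [].
by apply/rowP => i; have [_] := H i; rewrite E1 updv_in.
Qed.

Lemma semialgebraic_zeros n (D : set 'rV[R]_n) g : semialgebraic (graph_on D g) ->
  semialgebraic [set x | D x /\ g x = 0].
Proof.
move=> sg; apply: (semialgebraic_erow (dfn_graph_erow 0 sg (tfn_cst 0))) => z /=.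
by rewrite erow_vget; split=> -[].
Qed.

(** The partial derivative is defined by the epsilon-delta formula for the difference quotient;
    multiplying by h and squaring removes the quotient and the absolute values. *)
Lemma semialgebraic_graph_derive n (D : set 'rV[R]_n) g (i : 'I_n) : open D ->
  (forall x, D x -> differentiable g x) -> semialgebraic (graph_on D g) ->
  semialgebraic (graph_on D (fun x => 'D_(delta_mx ord0 i) g x)).
Proof.
move=> oD dg sg; have sD := semialgebraic_dom sg; apply: semialgebraic_graph.
pose v : 'rV[R]_n := delta_mx ord0 i.
pose Q1 (x : 'rV[R]_n) (u eps h : R) := [/\ D x, D (x + h *: v) &
  (g (x + h *: v) - g x - u * h) ^+ 2 <= (eps * h) ^+ 2].
pose Q2 x u eps del := forall h : R, h != 0 /\ h ^+ 2 < del -> Q1 x u eps h.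
pose Q3 x u := forall eps : R, 0 < eps -> exists del : R, 0 < del /\ Q2 x u eps del.
have tsh (j : 'I_n) : tfn (fun e : env => e (0 + j)%N + (j == i)%:R * e n.+3).
  by apply: tfnD (tfn_var R _) (tfnM (tfn_cst _) (tfn_var R _)).
have shE (e : env) : \row_j (e (0 + j)%N + (j == i)%:R * e n.+3) = erow n 0 e + e n.+3 *: v.
  by apply/rowP => j; rewrite !mxE eqxx /= mulrC.
have d1 : dfn (fun e : env => Q1 (erow n 0 e) (e n) (e n.+1) (e n.+3)).
  have q1 := dfn_graph_erow 0 sg (tfn_var R n.+4).
  have q2 := dfn_graph sg tsh (tfn_var R n.+4.+1).
  have q3 := dfn_le (tfnX 2 (tfnB (tfnB (tfn_var R n.+4.+1) (tfn_var R n.+4)) (tfnM (tfn_var R n) (tfn_var R n.+3))))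
     (tfnX 2 (tfnM (tfn_var R n.+1) (tfn_var R n.+3))).
  apply: dfn_iff (dfn_ex n.+4 (dfn_ex n.+4.+1 (dfnI q1 (dfnI q2 q3)))) => e; split.
    move=> [a [b]]; rewrite !shE !erow_upd ?add0n; try lia.
    rewrite !(updE, upd_neq); try lia.
    by move=> [[D1 ->] [[D2 ->] H]].
  move=> [D1 D2 H]; exists (g (erow n 0 e)), (g (erow n 0 e + e n.+3 *: v)).
  rewrite !shE !erow_upd ?add0n; try lia.
  by rewrite !(updE, upd_neq); try lia.
have d2 : dfn (fun e : env => Q2 (erow n 0 e) (e n) (e n.+1) (e n.+2)).
  have q1 := dfnI (dfnC (dfn_eq (tfn_var R n.+3) (tfn_cst 0))) (dfn_lt (tfnX 2 (tfn_var R n.+3)) (tfn_var R n.+2)).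
  apply: dfn_iff (dfn_all n.+3 (dfn_imp q1 d1)) => e; split=> H h.
    move=> [h0 hd]; have := H h; rewrite !erow_upd ?add0n; try lia.
    by rewrite !(updE, upd_neq); try lia; apply; split=> //; exact/eqP.
  rewrite !erow_upd ?add0n; try lia.
  by rewrite !(updE, upd_neq); try lia; move=> [/eqP h0 hd]; exact: H.
have d3 : dfn (fun e : env => Q3 (erow n 0 e) (e n)).
  have q1 := dfn_ex n.+2 (dfnI (dfn_lt (tfn_cst 0) (tfn_var R n.+2)) d2).
  apply: dfn_iff (dfn_all n.+1 (dfn_imp (dfn_lt (tfn_cst 0) (tfn_var R n.+1)) q1)) => e; split=> H h.
    move=> h0; have := H h; rewrite updE => /(_ h0)[del]; rewrite !erow_upd ?add0n; try lia.
    by rewrite !(updE, upd_neq); try lia; exists del.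
  rewrite updE => /H[del delP]; exists del; rewrite !erow_upd ?add0n; try lia.
  by rewrite !(updE, upd_neq); try lia.
apply: dfn_iff (dfnI (dfn_erow 0 sD) d3) => e.
set x := erow n 0 e; set u := e n.
suff main : D x -> (Q3 x u <-> u = 'D_v g x).
  by split=> -[Dx] /(main Dx).
move=> Dx; have dv := @diff_derivable _ _ _ g x v (dg _ Dx).
have quot (l eps h : R) : 0 <= eps -> h != 0 ->
   (`|l - h^-1 * (g (h *: v + x) - g x)| <= eps <-> (g (x + h *: v) - g x - l * h) ^+ 2 <= (eps * h) ^+ 2).
  move=> eps0 h0; rewrite [h *: v + x]addrC; set A := g _ - g x.
  have -> : A - l * h = - ((l - h^-1 * A) * h).
    by rewrite mulrBl [h^-1 * A]mulrC mulfVK // opprB.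
  have hp : 0 < h ^+ 2 by rewrite exprn_even_gt0.
  rewrite sqrrN !exprMn ler_pM2r // -[(_ - _) ^+ 2]real_normK ?num_real //.
  by rewrite ler_pXn2r // nnegrE.
move: dv; rewrite /derivable => /cvg_ex[l lP].
have lE : 'D_v g x = l by apply: cvg_lim lP.
rewrite lE; move/cvgrPdist_le: lP => lP; split=> [HQ|->].
  apply/eqP; rewrite -subr_eq0 -normr_eq0; apply/eqP/le_anti; rewrite normr_ge0 andbT.
  apply/ler_addgt0Pl => d d0; rewrite addr0.
  have d2p : 0 < d / 2 by rewrite divr_gt0.
  have [del [del0 Hd]] := HQ _ d2p.
  have := lP _ d2p; rewrite near_withinE => /nbhs_ballP[r /= r0 rP].
  pose s := Num.min (r / 2) (Num.min 1 (del / 2)).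
  have s0 : 0 < s by rewrite !lt_min ltr01 !divr_gt0.
  have sr2 : s <= r / 2 by rewrite ge_min lexx.
  have sr : s < r by lra.
  have s1 : s <= 1 by rewrite !ge_min lexx orbT.
  have sd : s <= del / 2 by rewrite !ge_min lexx !orbT.
  have snz : s != 0 by rewrite gt_eqF.
  have := rP s; rewrite -ball_normE /= sub0r normrN (gtr0_norm s0) => /(_ sr snz) h1.
  have [|_ _] := Hd s.
    split=> //; apply: le_lt_trans (_ : s * 1 < _); last lra.
    by rewrite expr2 ler_pM2l.
  rewrite -quot //; last exact: ltW.
  move=> h2; have -> : u - l = (u - s^-1 * (g (s *: v + x) - g x)) - (l - s^-1 * (g (s *: v + x) - g x)) by lra.
  apply: le_trans (ler_normB _ _) _; rewrite [leRHS]splitr; exact: lerD.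
move=> eps eps0; have := lP _ eps0; rewrite near_withinE => /nbhs_ballP[r /= r0 rP].
have [r' r'0 r'D] := nbhs_inbox (open_nbhs_nbhs (conj oD Dx)).
pose s := Num.min r r'; have s0 : 0 < s by rewrite lt_min r0.
exists (s ^+ 2); split; first by rewrite exprn_gt0.
move=> h [h0 hs].
have hs' : `|h| < s.
  rewrite -(ltr_pXn2r (n := 2)) ?nnegrE // ?(ltW s0) //.
  by rewrite -normrX ger0_norm // sqr_ge0.
split=> //.
  have dE (y : 'rV[R]_n) j : (y + h *: v) ord0 j - y ord0 j = h * (j == i)%:R.
      by rewrite !mxE eqxx /= [y ord0 j + _]addrC addrK.
    apply: r'D => j; rewrite dE normrM.
  apply: le_trans (_ : `|h| * 1 <= _).
    by rewrite ler_wpM2l //; case: (_ == _); rewrite ?normr1 ?normr0.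
  by rewrite mulr1 ltW // (lt_le_trans hs') // ge_min lexx orbT.
rewrite -quot //; last exact: ltW.
apply: (rP h) => //; rewrite -ball_normE /= sub0r normrN (lt_le_trans hs') //.
by rewrite ge_min lexx.
Qed.

Lemma nash_anl n (D : set 'rV[R]_n) g : open D -> nash D g -> anl D g.
Proof. by move=> oD [ag _]; exact: analytic_on_anl. Qed.

Lemma nash_comp n k (D : set 'rV[R]_k) (E : set 'rV[R]_n) g (F : 'rV[R]_k -> 'rV[R]_n) :
  open D -> open E -> semialgebraic D -> (forall x, D x -> E (F x)) ->
  nash E g -> nash_map D F -> nash D (fun x => g (F x)).
Proof.
move=> oD oE sD DE ng nF; split.
  apply: anl_analytic_on; apply: anl_comp DE (nash_anl oE ng) _ => i; exact: nash_anl (nF i).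
by apply: semialgebraic_graph_comp sD DE ng.2 _ => i; exact: (nF i).2.
Qed.

Lemma nash_poly n P : nash (setT : set 'rV[R]_n) (fun x => peval P x).
Proof. by split; [apply: anl_analytic_on; exact: anl_poly|exact: semialgebraic_graph_poly]. Qed.

Lemma nash_sub n (D E : set 'rV[R]_n) g : open E -> semialgebraic D ->
  (forall x, D x -> E x) -> nash E g -> nash D g.
Proof.
move=> oE sD DE ng; split; last exact: semialgebraic_graph_sub DE ng.2.
by apply: anl_analytic_on => a /DE; apply: nash_anl.
Qed.

Lemma nash_eq n (D : set 'rV[R]_n) g h : open D -> (forall x, D x -> g x = h x) ->
  nash D g -> nash D h.
Proof.
move=> oD gh ng; split; last exact: semialgebraic_graph_eq ng.2.
by apply: anl_analytic_on; apply: anl_ext gh (nash_anl oD ng).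
Qed.

Lemma nash_pcomp n k (D : set 'rV[R]_k) P (F : 'rV[R]_k -> 'rV[R]_n) :
  open D -> semialgebraic D -> nash_map D F -> nash D (fun x => peval P (F x)).
Proof. by move=> oD sD nF; apply: (nash_comp oD openT) => //; exact: nash_poly. Qed.

Lemma nash_polyD n (D : set 'rV[R]_n) P : semialgebraic D -> nash D (fun x => peval P x).
Proof. by move=> sD; apply: (nash_sub openT) => //; exact: nash_poly. Qed.

Lemma nash_coord n (D : set 'rV[R]_n) i : semialgebraic D -> nash D (fun x => x ord0 i).
Proof.
move=> sD; have := nash_polyD (mpolyX R (mpoly.mnm1 i)) sD.
by under [X in nash _ X -> _]eq_fun do rewrite peval_var.
Qed.

Lemma nash_cst n (D : set 'rV[R]_n) c : semialgebraic D -> nash D (fun=> c).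
Proof.
move=> sD; have := nash_polyD (mpolyC n c) sD.
by under [X in nash _ X -> _]eq_fun do rewrite pevalC.
Qed.

Lemma nash_map_row n k (D : set 'rV[R]_n) (f : 'I_k -> 'rV[R]_n -> R) :
  (forall i, nash D (f i)) -> nash_map D (fun x => \row_i f i x).
Proof.
move=> nf i; suff -> : (fun x => (\row_i f i x) ord0 i) = f i by exact: nf.
by apply/funext => x; rewrite mxE.
Qed.

Lemma nashM n (D : set 'rV[R]_n) g h : open D -> semialgebraic D -> nash D g -> nash D h ->
  nash D (fun x => g x * h x).
Proof.
move=> oD sD ng nh; pose f (i : 'I_2) := if i == ord0 then g else h.
have nf i : nash D (f i) by rewrite /f; case: ifP.
have := nash_pcomp (mpolyX R (mpoly.mnm1 ord0) * mpolyX R (mpoly.mnm1 (lift ord0 ord0))) oD sD (nash_map_row nf).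
by under [X in nash _ X -> _]eq_fun do rewrite pevalM !peval_var !mxE /=.
Qed.

Lemma nashD n (D : set 'rV[R]_n) g h : open D -> semialgebraic D -> nash D g -> nash D h ->
  nash D (fun x => g x + h x).
Proof.
move=> oD sD ng nh; pose f (i : 'I_2) := if i == ord0 then g else h.
have nf i : nash D (f i) by rewrite /f; case: ifP.
have := nash_pcomp (mpolyX R (mpoly.mnm1 ord0) + mpolyX R (mpoly.mnm1 (lift ord0 ord0))) oD sD (nash_map_row nf).
by under [X in nash _ X -> _]eq_fun do rewrite pevalD !peval_var !mxE /=.
Qed.

Lemma nashB n (D : set 'rV[R]_n) g h : open D -> semialgebraic D -> nash D g -> nash D h ->
  nash D (fun x => g x - h x).
Proof.
move=> oD sD ng nh; have := nashD oD sD ng (nashM oD sD (nash_cst (-1) sD) nh).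
by under [X in nash _ X -> _]eq_fun do rewrite mulN1r.
Qed.

Lemma nash_sum n (D : set 'rV[R]_n) (I : Type) (s : seq I) (g : I -> 'rV[R]_n -> R) :
  open D -> semialgebraic D -> (forall i, nash D (g i)) ->
  nash D (fun x => \sum_(i <- s) g i x).
Proof.
move=> oD sD ng; elim: s => [|i s IH].
  by under [X in nash _ X]eq_fun do rewrite big_nil; exact: nash_cst.
by under [X in nash _ X]eq_fun do rewrite big_cons; exact: nashD.
Qed.

Lemma nash_partial n (D : set 'rV[R]_n) g (i : 'I_n) : open D -> nash D g ->
  nash D (fun x => 'D_(delta_mx ord0 i) g x).
Proof.
move=> oD ng; have ag := nash_anl oD ng; split.
  apply: anl_analytic_on; apply: (anl_lie (X := fun=> delta_mx ord0 i)) => // j.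
  exact: anl_cst.
apply: semialgebraic_graph_derive => //; last exact: ng.2.
by move=> x Dx; exact: anl_differentiable ag Dx.
Qed.

Lemma msize_mderiv n (P : mpoly n R) i : P != 0 ->
  (mpoly.msize (mderiv i P) < mpoly.msize P)%N.
Proof.
move=> P0; have sP : (0 < mpoly.msize P)%N by rewrite lt0n mpoly.msize_poly_eq0.
rewrite mpoly.msizeE -(prednK sP) ltnS; apply/bigmax_leqP_seq => m mP _.
have := mP; rewrite mpoly.mcoeff_msupp mpoly.mcoeff_mderiv mulrn_eq0 /= => mU.
have : mpoly.mnm_add m (mpoly.mnm1 i) \in msupp P by rewrite mpoly.mcoeff_msupp.
move=> /mpoly.msize_mdeg_lt; rewrite mpoly.mdegD mpoly.mdeg1 addn1 => h.
by rewrite -ltnS prednK.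
Qed.

Lemma mderiv_eq0_const n (P : mpoly n R) : (forall i, mderiv i P = 0) ->
  P = mpolyC n (mcoeff (@mpoly.mnm0 n) P).
Proof.
move=> dP; apply/mpoly.mpolyP => m; rewrite mpoly.mcoeffC.
case: eqP => [->|/eqP m0]; first by rewrite mulr1.
rewrite mulr0.
have /existsP[i mi] : [exists i, m i != 0%N].
  apply: contraR m0; rewrite negb_exists => /forallP H; apply/eqP/mpoly.mnmP => i.
  by rewrite mpoly.mnm0E; have := H i; rewrite negbK => /eqP.
have lem : mpoly.lem (mpoly.mnm1 i) m by rewrite mpoly.lep1mP.
have := congr1 (mcoeff (mpoly.mnm_sub m (mpoly.mnm1 i))) (dP i).
rewrite mpoly.mcoeff_mderiv mpoly.submK // mpoly.mcoeff0 => /eqP.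
by rewrite mulrn_eq0 /= => /eqP.
Qed.

(** Induction on the degree: the partial derivatives vanish on the polydisc of half the radius,
    hence are zero, and [P] is a constant that vanishes at [a]. *)
Lemma polydisc_zero_poly n (P : mpoly n R) (a : 'rV[R]_n) (rho : R) : 0 < rho ->
  (forall x, inbox a rho x -> peval P x = 0) -> P = 0.
Proof.
have [k] := ubnP (mpoly.msize P); elim: k P rho => // k IH P rho; rewrite ltnS => Pk r0 H.
have [//|P0] := eqVneq P 0.
have r2 : 0 < rho / 2 by rewrite divr_gt0.
have dP0 i : mderiv i P = 0.
  apply: (IH _ (rho / 2)) => //; first exact: leq_trans (msize_mderiv i P0) Pk.
  move=> y ay; apply/eqP; rewrite -normr_eq0; apply/eqP/le_anti; rewrite normr_ge0 andbT.
  pose s := `|y|; pose K := pnorm (s + rho) P.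
  have s0 : 0 <= s by exact: normr_ge0.
  have K0 : 0 <= K by apply: pnorm_ge0; rewrite addr_ge0 // ltW.
  have rr : 0 < rho ^+ 2 by rewrite exprn_gt0.
  apply/ler_addgt0Pl => e e0; rewrite addr0.
  (* The step [d] keeps y + h where [P] vanishes and makes the Taylor remainder, at most d^2 K /
     rho^2, no larger than e d. *)
  pose d := Num.min (rho / 2) (e * rho ^+ 2 / (K + 1)).
  have d0 : 0 < d by rewrite lt_min r2 /= divr_gt0 ?mulr_gt0 //; lra.
  have dr : d <= rho / 2 by rewrite ge_min lexx.
  have de : d * K <= e * rho ^+ 2.
    have : d <= e * rho ^+ 2 / (K + 1) by rewrite ge_min lexx orbT.
    rewrite ler_pdivlMr; last lra.
    have := mulr_ge0 (ltW d0) K0; lra.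
  pose h : 'rV[R]_n := d *: delta_mx ord0 i.
  have hi j : h ord0 j = d * (j == i)%:R by rewrite !mxE eqxx.
  have := @pnorm_taylor R n (s + rho) s P y h d s0 (ltW d0).
  rewrite [s + rho - s]addrAC subrr add0r.
  have hsum : \sum_i0 peval (mderiv i0 P) y * h ord0 i0 = d * peval (mderiv i P) y.
    rewrite (bigD1 i) //= big1 ?addr0 => [|j /negbTE ji]; first by rewrite hi eqxx mulr1 mulrC.
    by rewrite hi ji !mulr0.
  rewrite hsum H; last first.
    move=> j; rewrite mxE hi addrAC; apply: le_trans (ler_normD _ _) _.
    have := ay j; have : `|d * (j == i)%:R| <= d.
      by rewrite normrM (gtr0_norm d0) ger_pMr //; case: (_ == _); rewrite ?normr1 ?normr0.
    lra.
  rewrite H; last by move=> j; apply: le_trans (ay j) _; lra.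
  rewrite subrr sub0r normrN normrM (gtr0_norm d0) => /(_ _ _ _ _) h1.
  have : d * `|peval (mderiv i P) y| * rho ^+ 2 <= d ^+ 2 * K.
    apply: h1; [lra|lra| |].
      by move=> j; exact: rV_entry_le_norm.
    move=> j; rewrite hi normrM (gtr0_norm d0) ger_pMr //.
    by case: (_ == _); rewrite ?normr1 ?normr0.
  rewrite expr2 -!mulrA ler_pM2l // => h2.
  by rewrite -(ler_pM2r rr); apply: le_trans h2 de.
have PC := mderiv_eq0_const dP0.
have aa : inbox a rho a by move=> i; rewrite subrr normr0 ltW.
by have := H a aa; rewrite PC pevalC => ->; rewrite mpoly.mpolyC0.
Qed.

Lemma peval_continuous n (P : mpoly n R) : continuous (fun x : 'rV[R]_n => peval P x).
Proof.
move=> x; apply: differentiable_continuous; apply: (@anl_differentiable R n setT) => //.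
exact: anl_poly.
Qed.

(** A basic piece with a nonzero equation lies in that hypersurface; a piece without one is open,
    hence empty or large enough to contain a polydisc. Multiplying the equations unites the
    hypersurfaces of the pieces. *)
Lemma semialgebraic_dichotomy n (Z : set 'rV[R]_n) : semialgebraic Z ->
  (exists (a : 'rV[R]_n) (rho : R), 0 < rho /\ forall x, inbox a rho x -> Z x) \/
  exists P : mpoly n R, P <> 0 /\ forall x, Z x -> peval P x = 0.
Proof.
move=> /semialgebraicP[F]; elim: F Z => [|[A B] F IH] Z HF.
  right; exists 1; split; first by apply/eqP; exact: oner_neq0.
  by move=> x /HF.
have [[a [rho [r0 H]]]|[P [P0 HP]]] := IH [set x | has (fun c => sat c x) F] (fun x => iff_refl _).
  by left; exists a, rho; split=> // x /H /= Fx; apply/HF; rewrite /= Fx orbT.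
have [/hasP[Q QA Q0]|allA] := boolP (has (fun Q => Q != 0) A).
  right; exists (Q * P); split; first by apply/eqP/mulf_neq0 => //; exact/eqP.
  move=> x /HF /= /orP[/andP[/allP/(_ _ QA)/eqP Qx _]|/HP Px]; rewrite pevalM ?Qx ?mul0r //.
  by rewrite Px mulr0.
have [[a aB]|nB] := pselect (exists a, all (fun Q => 0 < peval Q a) B); last first.
  right; exists P; split=> // x /HF /= /orP[/andP[_ xB]|/HP //].
  by case: nB; exists x.
left; have nB : nbhs a [set x | all (fun Q => 0 < peval Q x) B].
  elim: B aB {HF} => [|Q B IHB] /=; first by move=> _; apply: filterS filterT.
  move=> /andP[Qa /IHB h]; have : nbhs a [set x | 0 < peval Q x].
    by have := @peval_continuous n Q a; move/(_ [set y | 0 < y]); apply; exact: lt_nbhsr.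
  by move=> h'; apply: filterS (filterI h' h) => x [/= -> ->].
have [rho r0 rB] := nbhs_inbox nB.
exists a, rho; split=> // x /rB /= xB; apply/HF => /=; apply/orP; left; apply/andP; split=> //=.
apply/allP => Q QA; move: allA => /hasPn/(_ _ QA); rewrite negbK => /eqP ->.
by rewrite /peval mpoly.meval0.
Qed.

End NashFunctions.

(** * The identity theorem and the dimension of images *)

Section IdentityTheorem.
Variable (R : realType).

Lemma connected_open_ind n (V : set 'rV[R]_n) (P : 'rV[R]_n -> Prop) x0 :
  open V -> connected V -> V x0 -> P x0 ->
  (forall x, V x -> exists2 r : R, 0 < r & forall y y', inbox x r y -> inbox x r y' ->
     V y -> V y' -> P y -> P y') ->
  forall x, V x -> P x.
Proof.
move=> oV cV Vx0 Px0 H.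
pose O (Q : 'rV[R]_n -> Prop) : set 'rV[R]_n := [set x : 'rV[R]_n | \forall y \near x, V y /\ Q y].
have oO Q : open (O Q).
  by rewrite openE => x; rewrite /O /= => /nbhs_interior; apply: filterS => y; exact.
have OQ Q : (forall x, V x -> Q x -> \forall y \near x, V y -> Q y) -> [set x | V x /\ Q x] = O Q.
  move=> HQ; apply/seteqP; split=> [x [Vx Qx]|x /nbhs_singleton //].
  have VX : nbhs x V by apply: open_nbhs_nbhs.
  have : nbhs x (V `&` [set y | V y -> Q y]) by apply: filterI => //; exact: HQ.
  by apply: filterS => y [Vy VQ]; split=> //; exact: VQ.
have near_of (Q : 'rV[R]_n -> Prop) : (forall x, V x -> exists2 r : R, 0 < r & forall y y', inbox x r y -> inbox x r y' ->
    V y -> V y' -> Q y -> Q y') -> forall x, V x -> Q x -> \forall y \near x, V y -> Q y.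
  move=> HQ x Vx Qx; have [r r0 rP] := HQ x Vx.
  have := inbox_nbhs x r0; apply: filterS => y xy Vy; apply: (rP x y) => //.
  by move=> i; rewrite subrr normr0 ltW.
have HC : forall x, V x -> exists2 r : R, 0 < r & forall y y', inbox x r y -> inbox x r y' ->
    V y -> V y' -> ~ P y -> ~ P y'.
  move=> x Vx; have [r r0 rP] := H x Vx; exists r => // y y' xy xy' Vy Vy' nP Py'.
  by apply: nP; apply: rP Py'.
have VE : [set x | V x /\ P x] = V.
  apply: cV.
  - by exists x0.
  - exists (O P) => //; rewrite OQ; last exact: near_of.
    by apply/seteqP; split=> [x Ox|x [_ //]]; split=> //; have [] := nbhs_singleton Ox.
  - exists (~` O (fun x => ~ P x)); first by rewrite closedC.
    rewrite -OQ; last exact: near_of.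
    apply/seteqP; split=> x [Vx Px]; split=> //; first by move=> [].
    by apply: contrapT => nPx; apply: Px.
by move=> x; rewrite -[X in X x]VE => -[].
Qed.

Lemma lie_near0 n (X : 'rV[R]_n -> 'rV[R]_n) (g : 'rV[R]_n -> R) (x : 'rV[R]_n) :
  (\forall y \near x, g y = 0) -> \forall y \near x, lie X g y = 0.
Proof.
move=> /nbhs_interior; apply: filterS => y gy0.
rewrite /lie (@near_eq_derive _ _ _ g (cst 0)) ?derive_cst //.
Qed.

Lemma iter_lie0 n (X : 'rV[R]_n -> 'rV[R]_n) k x : iter k (lie X) (fun=> 0) x = 0 :> R.
Proof.
elim: k x => //= k IH x; have -> : iter k (lie X) (fun=> 0) = cst 0 :> (_ -> R) by apply/funext.
by rewrite /lie derive_cst.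
Qed.

Lemma anl_polydisc n (x : 'rV[R]_n) (rho K : R) g : 0 < rho -> repr x rho K g ->
  anl (inbox x (rho / 2)) g.
Proof.
move=> r0 rg y xy; exists (rho / 2), K; split; first lra.
apply: repr_recenter rg; first lra.
by move=> i; apply: le_trans (xy i) _; lra.
Qed.

Lemma inbox_convex n (a : 'rV[R]_n) (rho : R) y z (t : R) : 0 <= t <= 1 ->
  inbox a rho y -> inbox a rho z -> inbox a rho (y + t *: (z - y)).
Proof.
move=> /andP[t0 t1] ay az i; rewrite !mxE.
have -> : y ord0 i + t * (z ord0 i - y ord0 i) - a ord0 i =
  (1 - t) * (y ord0 i - a ord0 i) + t * (z ord0 i - a ord0 i) by lra.
apply: le_trans (ler_normD _ _) _; rewrite !normrM (ger0_norm t0) ger0_norm; last lra.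
have h1 := ler_wpM2l t0 (az i).
have t1' : 0 <= 1 - t by lra.
have h2 := ler_wpM2l t1' (ay i); lra.
Qed.

Lemma line_curve n (y v : 'rV[R]_n) (D : set 'rV[R]_n) :
  (forall t : R, 0 <= t <= 1 -> D (y + t *: v)) -> curve (fun=> v) D 0 1 (fun t => y + t *: v).
Proof.
move=> Dl; have ld (t : R) : is_derive t (1 : R) (fun t => y + t *: v) v.
  have h : is_derive t (1 : R) ( *:%R^~ v : R -> 'rV[R]_n) v.
    have [dv dE] := is_diff_scalel t v.
    apply: DeriveDef; first exact/diff_derivable.
    by rewrite deriveE // dE scale1r.
  by have := is_deriveD (is_derive_cst y t (1 : R)) h; rewrite add0r.
split=> //.
apply: continuous_subspaceT => t; apply: differentiable_continuous; apply/derivable1_diffP.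
by have [] := ld t.
Qed.

(** Two points of a polydisc are joined by a segment, which is an integral curve of a constant
    field. If [g] vanishes near one end, all its Lie derivatives vanish there, and [curves_agree]
    with the zero function carries this to the other end. *)
Lemma anl_identity n (V : set 'rV[R]_n) g a : open V -> connected V -> anl V g -> V a ->
  (\forall x \near a, g x = 0) -> forall x, V x -> g x = 0.
Proof.
move=> oV cV Vg Va ga x Vx; apply: (@nbhs_singleton _ x [set x | g x = 0]).
move: x Vx; apply: (connected_open_ind (x0 := a)) => // x Vx.
have [rho [K [r0 rg]]] := Vg x Vx.
exists (rho / 4); first lra.
have Dg := anl_polydisc r0 rg.
move=> y y' xy xy' Vy Vy' gy.
have near_box : \forall z \near y', inbox x (rho / 2) z.
  have r4 : 0 < rho / 4 by lra.
  have := inbox_nbhs y' r4; apply: filterS => z y'z i.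
  have := y'z i; have := xy' i => h1 h2.
  rewrite -[z ord0 i](subrK (y' ord0 i)) -addrA; apply: le_trans (ler_normD _ _) _; lra.
apply: filterS near_box => z xz.
have xy2 : inbox x (rho / 2) y by move=> i; apply: le_trans (xy i) _; lra.
have lc : curve (fun=> z - y) (inbox x (rho / 2)) 0 1 (fun t => y + t *: (z - y)).
  by apply: line_curve => t t01; exact: inbox_convex.
have fa : field_anl (inbox x (rho / 2)) (fun=> z - y) by move=> i; exact: anl_cst.
have h0 : 0 <= (0 : R) <= 1 by rewrite lexx ler01.
have h1 : 0 <= (1 : R) <= 1 by rewrite lexx ler01.
have := curves_agree fa fa Dg (@anl_cst R n _ 0) lc lc h0.
move=> H; have := H _ 0%N 1 h1; rewrite /= scale1r.
have -> : y + (z - y) = z by rewrite addrC subrK.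
apply=> k.
rewrite scale0r addr0 iter_lie0.
apply: (@nbhs_singleton _ y [set w | iter k (lie (fun=> z - y)) g w = 0]).
by elim: k => // k IH; rewrite iterS; exact: lie_near0.
Qed.

Lemma repr_lipschitz n (a : 'rV[R]_n) (rho sigma K delta : R) g x y :
  0 <= sigma <= rho -> 0 <= delta ->
  repr a rho K g -> inbox a sigma x -> inbox a sigma y ->
  (forall i, `|x ord0 i - y ord0 i| <= delta) -> `|g x - g y| * (rho - sigma) <= delta * K.
Proof.
move=> /andP[s0 sr] d0 [P [PK PC]] ax ay xy.
have main j : `|peval (P j) (x - a) - peval (P j) (y - a)| * (rho - sigma) <= delta * K.
  have := @pnorm_pcompB R n n (fun i => mpolyC n (x ord0 i - a ord0 i)) (fun i => mpolyC n (y ord0 i - a ord0 i))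
    sigma rho sigma delta (P j) s0 s0 sr d0.
  move=> /(_ _ _ _) h; apply: le_trans (_ : delta * pnorm rho (P j) <= _); last exact: ler_wpM2l.
  apply: le_trans (h _ _ _) => [|i|i|i].
  - apply: ler_wpM2r; first by rewrite subr_ge0.
    have := @pnorm_meval R n sigma (pcomp (fun i => mpolyC n (x ord0 i - a ord0 i)) (P j) -
      pcomp (fun i => mpolyC n (y ord0 i - a ord0 i)) (P j)) (fun=> 0) s0.
    rewrite mpoly.mevalB !meval_pcomp => /(_ _); rewrite /peval.
    have E (z : 'rV[R]_n) : meval ((z - a) ord0) (P j) =
        meval (fun i => meval (fun=> 0) (mpolyC n (z ord0 i - a ord0 i))) (P j).
      by apply: mpoly.meval_eq => i; rewrite mpoly.mevalC !mxE.
    by rewrite !E; apply => i; rewrite normr0.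
  - by rewrite pnormC; exact: ax.
  - by rewrite pnormC; exact: ay.
  - by rewrite -mpoly.mpolyCB pnormC opprB addrA subrK; exact: xy.
have cx := aprx_cvg (conj PK PC) (_ : inbox a rho x).
have cy := aprx_cvg (conj PK PC) (_ : inbox a rho y).
have c : (fun j => `|peval (P j) (x - a) - peval (P j) (y - a)| * (rho - sigma)) @ \oo -->
    `|g x - g y| * (rho - sigma).
  apply: cvgMl; apply: cvg_norm; apply: cvgB; [apply: cx|apply: cy] => i.
    exact: le_trans (ax i) sr.
  exact: le_trans (ay i) sr.
rewrite -(cvg_lim (@Rhausdorff R) c); apply: limr_le; first by apply/cvg_ex; eexists; exact: c.
by apply: nearW.
Qed.

Lemma repr_lipschitz_map n d (a : 'rV[R]_n) (rho sigma K delta : R) (F : 'rV[R]_n -> 'rV[R]_d) x y :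
  0 <= sigma < rho -> 0 <= delta ->
  (forall j, repr a rho K (fun x => F x ord0 j)) -> inbox a sigma x -> inbox a sigma y ->
  (forall i, `|x ord0 i - y ord0 i| <= delta) ->
  forall j, `|F x ord0 j - F y ord0 j| <= delta * (K / (rho - sigma)).
Proof.
move=> /andP[s0 sr] d0 rF ax ay xy j; rewrite mulrA ler_pdivlMr ?subr_gt0 //.
by apply: repr_lipschitz (rF j) ax ay xy => //; rewrite s0 ltW.
Qed.

(* A Lipschitz map cannot be onto a polydisc of larger dimension: a grid of [M ^ d] points has
   preimages in the [N ^ n] cells of a cubical subdivision. *)
Lemma lipschitz_no_polydisc n d (a : 'rV[R]_n) (sigma L : R) (F : 'rV[R]_n -> 'rV[R]_d)
    (b : 'rV[R]_d) (s : R) : (n < d)%N -> 0 < sigma -> 0 <= L -> 0 < s ->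
  (forall x y delta, 0 <= delta -> inbox a sigma x -> inbox a sigma y ->
     (forall i, `|x ord0 i - y ord0 i| <= delta) ->
     forall j, `|F x ord0 j - F y ord0 j| <= delta * L) ->
  (forall z, inbox b s z -> exists2 x, inbox a sigma x & F x = z) -> False.
Proof.
move=> nd s0 L0 t0 FL Fsurj.
(* With N = T M cells per side, [F] varies within a cell by at most 2 sigma L / (T M) < s / M, the
   mesh of the grid, so grid points have preimages in distinct cells. The choice M > (T+1)^n
   contradicts this: there are (T M + 1)^n <= (T+1)^n M^n < M^(n+1) <= M^d cells, index N serving
   the upper faces. *)
pose T := (Num.truncn (2 * sigma * L / s)).+1.
have LT : 2 * sigma * L < T%:R * s.
  have : 2 * sigma * L / s < T%:R.
    by have /Num.Theory.truncn_itv/andP[] : 0 <= 2 * sigma * L / s by rewrite divr_ge0 ?mulr_ge0 // ltW.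
  by rewrite ltr_pdivrMr.
pose M := (T.+1 ^ n).+1; pose N := (T * M)%N.
have M0 : 0 < M%:R :> R by rewrite ltr0n.
have N0 : 0 < N%:R :> R by rewrite ltr0n muln_gt0.
pose z (k : {ffun 'I_d -> 'I_M}) : 'rV[R]_d := \row_j (b ord0 j + s * ((k j)%:R / M%:R)).
have zb k : inbox b s (z k).
  move=> j; rewrite mxE addrC addKr normrM (gtr0_norm t0) ger_pMr // ger0_norm.
    by rewrite ler_pdivrMr // mul1r ler_nat ltnW.
  by rewrite divr_ge0.
have /choice[f fP] : forall k, exists x, inbox a sigma x /\ F x = z k.
  by move=> k; have [x] := Fsurj _ (zb k); exists x.
pose c k i := (f k ord0 i - a ord0 i + sigma) / (2 * sigma) * N%:R.
have c0 k i : 0 <= c k i <= N%:R.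
  have [/(_ i)] := fP k; rewrite ler_norml => /andP[h1 h2] _.
  have h3 : 0 < 2 * sigma by lra.
  apply/andP; split; first by rewrite mulr_ge0 // divr_ge0 //; lra.
  by rewrite ger_pMl // ler_pdivrMr // mul1r; lra.
pose cell k : {ffun 'I_n -> 'I_N.+1} := [ffun i => inord (Num.truncn (c k i))].
have cellE k i : cell k i = Num.truncn (c k i) :> nat.
  rewrite ffunE inordK // ltnS; have /andP[h1 h2] := c0 k i.
  rewrite -(ler_nat R); apply: le_trans h2.
  by have /Num.Theory.truncn_itv/andP[] := h1.
have ninj : ~ injective cell.
  move=> /leq_card; rewrite !card_ffun !card_ord.
  apply/negP; rewrite -ltnNge.
  apply: (@leq_ltn_trans ((T.+1 * M) ^ n)).
    by case: (n) => // n'; rewrite leq_exp2r // mulSn addnC -addn1 leq_add2l.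
  rewrite expnMn; apply: (@leq_trans (M * M ^ n)); last by rewrite -expnS leq_pexp2l.
  by rewrite ltn_pmul2r ?expn_gt0.
apply: ninj => k l kl; apply/ffunP => j; apply/val_inj => /=; apply/eqP.
have fkl i : `|f k ord0 i - f l ord0 i| <= 2 * sigma / N%:R.
  have := congr1 (fun g : {ffun _} => nat_of_ord (g i)) kl; rewrite !cellE => e.
  have /andP[/Num.Theory.truncn_itv/andP[h1 h2] _] := c0 k i.
  have /andP[/Num.Theory.truncn_itv/andP[h3 h4] _] := c0 l i.
  rewrite e in h1 h2.
  have : `|c k i - c l i| <= 1.
    by rewrite ler_norml; apply/andP; split; move: h1 h2 h3 h4; rewrite -!natr1; lra.
  have -> : c k i - c l i = (f k ord0 i - f l ord0 i) * (N%:R / (2 * sigma)).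
    by rewrite /c; set w := (2 * sigma)^-1; lra.
  rewrite normrM [`|_ / _|]ger0_norm; last by rewrite divr_ge0 // ltW //; lra.
  rewrite -ler_pdivlMr; last by rewrite divr_gt0 //; lra.
  by rewrite div1r invf_div.
have := FL _ _ _ _ (proj1 (fP k)) (proj1 (fP l)) fkl j.
rewrite (proj2 (fP k)) (proj2 (fP l)) !mxE => /(_ _) h.
have {}h : s * `|(k j)%:R - (l j)%:R| / M%:R <= 2 * sigma / N%:R * L.
  have := h _; rewrite opprD addrACA subrr add0r -mulrBr -mulrBl normrM (gtr0_norm t0) normrM.
  rewrite [`|M%:R^-1|]gtr0_norm ?invr_gt0 // mulrA; apply.
  by rewrite divr_ge0 ?mulr_ge0 // ltW.
have {}h : s * `|(k j)%:R - (l j)%:R| * T%:R <= 2 * sigma * L.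
  move: h; rewrite -(ler_pM2r N0).
  have -> : 2 * sigma / N%:R * L * N%:R = 2 * sigma * L.
    by rewrite -!mulrA mulrCA [N%:R^-1 * _]mulrCA mulVf ?mulr1 ?gt_eqF // mulrCA.
  by rewrite /N natrM -!mulrA [M%:R^-1 * _]mulrCA mulVf ?mulr1 // gt_eqF.
have {}h : `|(k j)%:R - (l j)%:R| < (1 : R).
  rewrite ltNge; apply/negP => h1.
  have : s * T%:R <= s * `|(k j)%:R - (l j)%:R| * T%:R.
    by rewrite ler_wpM2r // ler_peMr // ltW.
  lra.
move: h; rewrite ltr_norml => /andP[h1 h2]; rewrite eqn_leq.
have h3 : (k j)%:R < (l j).+1%:R :> R by rewrite -natr1; lra.
have h4 : (l j)%:R < (k j).+1%:R :> R by rewrite -natr1; lra.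
by move: h3 h4; rewrite !ltr_nat !ltnS => -> ->.
Qed.

Lemma semialgebraic_inbox n (a : 'rV[R]_n) (rho : R) : semialgebraic [set x | inbox a rho x].
Proof.
apply: (@semialgebraic_erow _ _ _ (fun e => forall i : 'I_n, - rho <= e i - a ord0 i /\ e i - a ord0 i <= rho)).
  apply: dfn_forall_ord => i.
  have ti : tfn (fun e : nat -> R => e i - a ord0 i) by apply: tfnB; [exact: tfn_var|exact: tfn_cst].
  by apply: dfnI; apply: dfn_le => //; exact: tfn_cst.
move=> x; split=> H i; have := H i; rewrite vget_ord ler_norml; first by move=> /andP[].
by move=> [-> ->].
Qed.

(** The semialgebraic image of a small cube contains no polydisc, hence lies in a hypersurface; the
    identity theorem extends this relation from the cube to [X]. *)
Lemma nash_map_dependent n d (X : set 'rV[R]_n) (F : 'rV[R]_n -> 'rV[R]_d) x0 : (n < d)%N ->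
  open X -> connected X -> X x0 -> nash_map X F ->
  exists P : mpoly d R, P <> 0 /\ forall x, X x -> peval P (F x) = 0.
Proof.
move=> nd oX cX Xx0 nF.
have aF j : anl X (fun x => F x ord0 j) by exact: nash_anl.
have [rho [K [r0 rF]]] := repr_common (fun j => aF j x0 Xx0).
have [r' r'0 r'X] := nbhs_inbox (open_nbhs_nbhs (conj oX Xx0)).
pose s := Num.min (rho / 2) r'.
have s0 : 0 < s by rewrite lt_min r'0 andbT divr_gt0.
have sr : s <= rho / 2 by rewrite ge_min lexx.
have sr' : s <= r' by rewrite ge_min lexx orbT.
pose X0 : set 'rV[R]_n := [set x | inbox x0 s x].
have X0X x : X0 x -> X x by move=> xx; apply: r'X => i; apply: le_trans (xx i) _.
have sX0 := semialgebraic_inbox x0 s.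
have sF j : semialgebraic (graph_on X0 (fun x => F x ord0 j)).
  by apply: semialgebraic_graph_sub X0X _ => //; have [] := nF j.
have K0 : 0 <= K.
  have d0 : (0 < d)%N by apply: leq_ltn_trans nd.
  apply: le_trans (normr_ge0 _) (@repr_bound R n x0 rho K _ x0 (ltW r0) (rF (Ordinal d0)) _).
  by move=> i; rewrite subrr normr0 ltW.
case: (semialgebraic_dichotomy (semialgebraic_image sX0 sF)) => [[b [t [t0 bX]]]|[P [P0 PX]]].
  exfalso; apply: (@lipschitz_no_polydisc n d x0 s (K / (rho - s)) F b t) => //.
  - by rewrite divr_ge0 //; lra.
  - move=> x y delta d0 xx xy xyd; apply: repr_lipschitz_map rF xx xy xyd => //.
    by rewrite ltW //=; lra.
exists P; split=> //; apply: (anl_identity (a := x0)) => //.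
  apply: (@anl_comp R d n X setT) => //; exact: anl_poly.
by have := inbox_nbhs x0 s0; apply: filterS => x xx; apply: PX; exists x.
Qed.

End IdentityTheorem.

(** * Local flows *)

Section LocalFlow.
Variable (R : realType).

(** A contraction principle for an iteration whose map changes at each step: the distance of two
    iterates is halved only up to an error that becomes arbitrarily small along the sequence. *)
Lemma contraction_cauchy (I : Type) (e : I -> nat -> nat -> R) (B : R) :
  (forall i j k, e i j k <= B) ->
  (forall eta : R, 0 < eta -> exists N, forall j k, (N <= j)%N -> (N <= k)%N -> forall delta : R,
     0 <= delta -> (forall i, e i j k <= delta) -> forall i, e i j.+1 k.+1 <= delta / 2 + eta) ->
  forall eta : R, 0 < eta -> exists N, forall i j k, (N <= j)%N -> (N <= k)%N -> e i j k <= eta.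
Proof.
move=> eB H eta eta0.
(* The recursion x -> x / 2 + eta / 4 settles at eta / 2. *)
have [N HN] := H (eta / 4) ltac:(by rewrite divr_gt0).
pose B' := Num.max B 0.
have B0 : 0 <= B' by rewrite le_max lexx orbT.
have main m i j k : (N + m <= j)%N -> (N + m <= k)%N -> e i j k <= B' * 2^-1 ^+ m + eta / 2.
  elim: m i j k => [|m IH] i j k.
    move=> _ _; apply: le_trans (eB i j k) _; rewrite expr0 mulr1.
    have : B <= B' by rewrite le_max lexx.
    lra.
  case: j => [|j]; first by rewrite addnS.
  case: k => [|k]; first by rewrite addnS.
  rewrite !addnS !ltnS => mj mk.
  apply: le_trans (HN j k _ _ (B' * 2^-1 ^+ m + eta / 2) _ _ i) _.
  - exact: leq_trans (leq_addr _ _) mj.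
  - exact: leq_trans (leq_addr _ _) mk.
  - have : 0 <= B' * 2^-1 ^+ m by rewrite mulr_ge0 ?exprn_ge0 ?invr_ge0.
    by clear -eta0; lra.
  - by move=> i'; exact: IH.
  rewrite exprS; lra.
have [m Hm] := @geometric_small R 2^-1 B' ltac:(by apply/andP; split; lra) B0 (eta / 2) ltac:(by rewrite divr_gt0).
by exists (N + m)%N => i j k mj mk; apply: le_trans (main m i j k mj mk) _; lra.
Qed.

(** The primitive vanishing at 0; it replaces the integral in Picard's iteration and keeps the
    iterates polynomial. *)
Definition mint (P : mpoly 1 R) : mpoly 1 R :=
  \sum_(m <- msupp P) (mcoeff m P / (m ord0).+1%:R) *:
    mpolyX R (mpoly.mnm_add m (mpoly.mnm1 ord0)).

Lemma mint_sub (P : mpoly 1 R) (s : seq (multinom 1)) : uniq s -> {subset msupp P <= s} ->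
  mint P = \sum_(m <- s) (mcoeff m P / (m ord0).+1%:R) *:
    mpolyX R (mpoly.mnm_add m (mpoly.mnm1 ord0)).
Proof.
move=> us sub; rewrite /mint.
rewrite [RHS](bigID (mem (msupp P))) /= [X in _ + X]big1 ?addr0; last first.
  by move=> m mP; rewrite mpoly.memN_msupp_eq0 // mul0r scale0r.
rewrite -[RHS]big_filter; apply: perm_big; apply: uniq_perm.
- exact: mpoly.msupp_uniq.
- exact: filter_uniq.
by move=> m; rewrite mem_filter; case: (boolP (m \in msupp P)) => //= /sub.
Qed.

Lemma mintB P Q : mint (P - Q) = mint P - mint Q.
Proof.
pose s := undup (msupp P ++ msupp Q ++ msupp (P - Q)).
rewrite !(@mint_sub _ s) ?undup_uniq //; try by
  move=> m mP; rewrite mem_undup !mem_cat mP ?orbT.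
by rewrite -sumrB; apply: eq_bigr => m _; rewrite -scalerBl -mulrBl mpoly.mcoeffB.
Qed.

Lemma pnorm_mint (sigma : R) P : 0 <= sigma -> pnorm sigma (mint P) <= sigma * pnorm sigma P.
Proof.
move=> s0; apply: le_trans (pnorm_sum _ _ _ s0) _; rewrite /pnorm mulr_sumr; apply: ler_sum => m _.
rewrite [leLHS]pnormZ pnormX mpoly.mdegD mpoly.mdeg1 addn1 exprS mulrCA ler_wpM2l //.
rewrite ler_wpM2r ?exprn_ge0 // normrM ler_piMr // ger0_norm ?invr_ge0 // invf_le1 ?ltr0n //.
by rewrite ler1n.
Qed.

Lemma mderiv_mint P : mderiv ord0 (mint P) = P.
Proof.
rewrite /mint raddf_sum /= [RHS]mpoly.mpolyE; apply: eq_bigr => m _.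
rewrite mpoly.mderivZ mpoly.mderivX mpoly.mnmDE mpoly.mnm1E eqxx addn1 scalerA.
by rewrite mulfVK ?pnatr_eq0 // mpoly.addmK.
Qed.

Lemma peval_mint0 P : peval (mint P) 0 = 0.
Proof.
rewrite /peval /mint raddf_sum /=; apply: big1 => m _.
rewrite mpoly.mevalZ mpoly.mevalX big_ord1 mxE mpoly.mnmDE mpoly.mnm1E eqxx addn1.
by rewrite expr0n mulr0.
Qed.

Lemma is_derive_scale (V : normedModType R) (v : V) (t : R) : is_derive t (1 : R) ( *:%R^~ v : R -> V) v.
Proof.
have [dv dE] := is_diff_scalel t v.
by apply: DeriveDef; [exact/diff_derivable|rewrite deriveE // dE scale1r].
Qed.

(** Picard's iteration for the weighted norm. The j-th step uses the j-th polynomial approximant of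
    [X] instead of [X], so that all iterates are polynomials in the time; the time [tau] is the same
    for all initial points near [a]. *)
Lemma flow_local n (X : 'rV[R]_n -> 'rV[R]_n) (a : 'rV[R]_n) (rho K : R) : 0 < rho ->
  (forall i, repr a rho K (fun x => X x ord0 i)) ->
  exists2 tau : R, 0 < tau & forall y, inbox a (rho / 4) y -> exists x : R -> 'rV[R]_n,
    x 0 = y /\ forall t : R, `|t| <= tau -> inbox a (rho / 2) (x t) /\
      is_derive t (1 : R) x (X (x t)).
Proof.
move=> r0 /choice[F FX].
pose L := Num.max K 0.
have L0 : 0 <= L by rewrite le_max lexx orbT.
have FL i j : pnorm rho (F i j) <= L.
  by have [h _] := FX i; apply: le_trans (h j) _; rewrite le_max lexx.
(* From sigma L <= rho / 4 the iterates stay within rho / 4 + rho / 4 of [a], and the Lipschitz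
   constant L / (rho / 2) gives the contraction ratio 1 / 2. *)
pose sigma := rho / (4 * (L + 1)).
have L4 : 0 < 4 * (L + 1) by lra.
have s0 : 0 < sigma by rewrite divr_gt0.
have sL : sigma * L <= rho / 4.
  have -> : rho / 4 = sigma * (L + 1).
    have e : rho = sigma * (4 * (L + 1)) by rewrite /sigma mulfVK // gt_eqF.
    by rewrite [in LHS]e; lra.
  by rewrite ler_wpM2l //; lra.
exists (sigma / 2) => [|y ay]; first lra.
pose phi := fix phi (j : nat) : 'I_n -> mpoly 1 R :=
  if j is j'.+1 then fun i => mpolyC 1 (y ord0 i - a ord0 i) + mint (pcomp (phi j') (F i j'))
  else fun i => mpolyC 1 (y ord0 i - a ord0 i).
have yr i : `|y ord0 i - a ord0 i| <= rho / 2 by apply: le_trans (ay i) _; lra.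
have phib j i : pnorm sigma (phi j i) <= rho / 2.
  elim: j i => [|j IH] i /=; first by rewrite pnormC.
  apply: le_trans (pnormD _ _ (ltW s0)) _; rewrite pnormC.
  have h1 := pnorm_mint (pcomp (phi j) (F i j)) (ltW s0).
  have h2 : pnorm sigma (pcomp (phi j) (F i j)) <= L.
    apply: le_trans (pnorm_pcomp _ (ltW s0) (IH)) _.
    by apply: le_trans (pnorm_le_radius _ _) (FL i j); apply/andP; split; lra.
  have h3 := ler_wpM2l (ltW s0) h2; have := ay i; lra.
have phic (eta : R) : 0 < eta -> exists N, forall i j k, (N <= j)%N -> (N <= k)%N ->
    pnorm sigma (phi j i - phi k i) <= eta.
  apply: (contraction_cauchy (B := rho)) => [i j k|{}eta eta0].
    by apply: le_trans (pnormB _ _ (ltW s0)) _; have := phib j i; have := phib k i; lra.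
  have eta1 : 0 < eta / sigma by rewrite divr_gt0.
  have /choice[N HN] : forall i, exists N, forall j k, (N <= j)%N -> (N <= k)%N ->
      pnorm rho (F i j - F i k) <= eta / sigma.
    move=> i; have [_ h] := FX i; have [N HN] := h _ eta1.
    by exists N => j k Nj Nk; have [h' _] := HN _ Nk; exact: h'.
  exists (\max_i N i)%N => j k Nj Nk delta d0 Hd i /=.
  rewrite opprD addrACA subrr add0r -mintB.
  apply: le_trans (pnorm_mint _ (ltW s0)) _.
  have Ni : (N i <= \max_i N i)%N by exact: leq_bigmax.
  have h1 : pnorm sigma (pcomp (phi j) (F i j) - pcomp (phi j) (F i k)) <= eta / sigma.
    rewrite -pcompB; apply: le_trans (pnorm_pcomp _ (ltW s0) (phib j)) _.
    apply: le_trans (HN i j k (leq_trans Ni Nj) (leq_trans Ni Nk)).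
    by apply: pnorm_le_radius; apply/andP; split; lra.
  have h2 : pnorm sigma (pcomp (phi j) (F i k) - pcomp (phi k) (F i k)) * (rho / 2) <= delta * L.
    have := @pnorm_pcompB R n 1 (phi j) (phi k) (rho / 2) rho sigma delta (F i k) (ltW s0)
      ltac:(lra) ltac:(lra) d0 (phib j) (phib k) Hd.
    have -> : rho - rho / 2 = rho / 2 by lra.
    by move=> h; apply: le_trans h _; exact: ler_wpM2l.
  have h3 : sigma * pnorm sigma (pcomp (phi j) (F i k) - pcomp (phi k) (F i k)) <= delta / 2.
    have r2 : 0 < rho / 2 by rewrite divr_gt0.
    rewrite -(ler_pM2r r2) -mulrA; apply: le_trans (ler_wpM2l (ltW s0) h2) _.
    have := ler_wpM2l d0 sL; clear; lra.
  have -> : pcomp (phi j) (F i j) - pcomp (phi k) (F i k) =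
      (pcomp (phi j) (F i j) - pcomp (phi j) (F i k)) + (pcomp (phi j) (F i k) - pcomp (phi k) (F i k)).
    by rewrite addrA subrK.
  have h4 := ler_wpM2l (ltW s0) (pnormD (pcomp (phi j) (F i j) - pcomp (phi j) (F i k))
    (pcomp (phi j) (F i k) - pcomp (phi k) (F i k)) (ltW s0)).
  have h5 := ler_wpM2l (ltW s0) h1.
  have h6 : sigma * (eta / sigma) = eta by rewrite mulrCA mulfV ?mulr1 // gt_eqF.
  by apply: le_trans h4 _; rewrite mulrDr addrC; apply: lerD h3 _; rewrite -[leRHS]h6.
have /choice[g gP] : forall i, exists g : 'rV[R]_1 -> R, aprx 0 sigma (rho / 2) (fun j => phi j i) g.
  move=> i; apply: aprx_cauchy => [|j|e e0]; [exact: ltW|exact: phib|].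
  by have [N HN] := phic e e0; exists N => j k; exact: HN.
pose z (w : 'rV[R]_1) : 'rV[R]_n := \row_i (a ord0 i + g i w).
have zE w i : z w ord0 i - a ord0 i = g i w by rewrite mxE addrC addKr.
have gb w i : inbox 0 sigma w -> `|g i w| <= rho / 2.
  move=> ws; have rg : repr 0 sigma (rho / 2) (g i) by exists (fun j => phi j i).
  exact: repr_bound (ltW s0) rg ws.
have aX i : aprx 0 sigma L (fun j => pcomp (phi j) (F i j)) (fun w => X (z w) ord0 i).
  have h := @aprx_comp R n 1 a 0 (rho / 2) rho sigma L (F i) (fun i j => phi j i) (fun x => X x ord0 i)
     (fun i w => a ord0 i + g i w) (ltW s0) ltac:(apply/andP; split; lra) _ _.
  apply: h; first by have [_ h] := FX i; split=> // j; exact: FL.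
  move=> i'; have [h1 h2] := gP i'; split=> // e /h2[N HN]; exists N => j /HN[h3 h4].
  by split=> // w /h4; rewrite [a ord0 i' + _]addrC addrK.
(* The derivative of [phi j.+1] is the integrand built from [phi j], which converges to [X (z w)];
   the quadratic Taylor remainder passes to the limit. *)
have dz i (w : 'rV[R]_1) : inbox 0 (sigma / 2) w ->
    differentiable (g i) w /\ 'd (g i) w = lform (fun=> X (z w) ord0 i) :> (_ -> _).
  move=> ws; have s2 : 0 < sigma / 2 by lra.
  have ss : 0 < (sigma / 2) ^+ 2 by rewrite exprn_gt0.
  apply: (@diff_quadratic _ _ _ _ _ (sigma / 2) (rho / 2 / (sigma / 2) ^+ 2)) => //.
    by rewrite divr_ge0 ?exprn_ge0 //; lra.
  move=> h e /andP[e0 es] he.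
  have w1 : inbox 0 sigma w by move=> j; apply: le_trans (ws j) _; lra.
  have w2 : inbox 0 sigma (w + h).
    move=> j; rewrite mxE addrAC; apply: le_trans (ler_normD _ _) _.
    have := ws j; have := he j; lra.
  have sh (u : nat -> R) (l : R) : u @ \oo --> l -> (fun j => u j.+1) @ \oo --> l.
    by move=> ul; rewrite (@cvg_shiftS R).
  have l1 := sh _ _ (aprx_cvg (gP i) w2); have l2 := sh _ _ (aprx_cvg (gP i) w1).
  have l3 : (fun j => peval (mderiv ord0 (phi j.+1 i)) w * h ord0 ord0) @ \oo -->
      lform (fun=> X (z w) ord0 i) h.
    rewrite /lform big_ord1; apply: cvgM; last exact: cvg_cst.
    have := aprx_cvg (aX i) w1; rewrite subr0; apply: cvg_trans; apply: near_eq_cvg.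
    by apply: nearW => j /=; rewrite mpoly.mderivD mpoly.mderivC add0r mderiv_mint.
  have l4 := cvgB (cvgB l1 l2) l3.
  rewrite -[X in `|X|]subr0; apply: (@cvg_dist_le _ _ _ _ _ 0%N (l4 _ _)) => j _.
  rewrite subr0 !subr0 mulrAC ler_pdivlMr // [leRHS]mulrC.
  have := @pnorm_taylor R 1 sigma (sigma / 2) (phi j.+1 i) w h e (ltW s2) e0 ltac:(lra) ltac:(lra) _ he.
  have -> : sigma - sigma / 2 = sigma / 2 by lra.
  rewrite big_ord1 => H; apply: le_trans (H _) _ => [k|].
    by have := ws k; rewrite mxE subr0.
  by rewrite ler_wpM2l ?exprn_ge0.
have Mb (t : R) : `|t| <= sigma -> inbox 0 sigma (t%:M : 'rV[R]_1).
  by move=> ts i; rewrite !mxE (ord1 i) eqxx mulr1n subr0.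
exists (fun t => z t%:M); split.
  apply/rowP => i; rewrite mxE; have s00 : inbox 0 sigma ((0 : R)%:M : 'rV[R]_1).
    by apply: Mb; rewrite normr0 ltW.
  have l1 := aprx_cvg (gP i) s00.
  suff -> : g i 0%:M = y ord0 i - a ord0 i by rewrite addrC subrK.
  apply/esym; apply: (cvg_unique _ _ l1) => //.
  have E j : peval (phi j i) (0%:M - 0) = y ord0 i - a ord0 i.
    have -> : (0 : R)%:M - 0 = 0 :> 'rV[R]_1 by rewrite scalemx0 subr0 || rewrite subr0 raddf0.
    by case: j => [|j] /=; rewrite ?pevalD pevalC ?peval_mint0 ?addr0.
  by rewrite (_ : (fun j => _) = cst (y ord0 i - a ord0 i)); [exact: cvg_cst|apply/funext].
move=> t ts; have ts' : `|t| <= sigma by lra.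
split=> [i|]; first by rewrite zE; exact/gb/Mb.
have dt : is_derive t (1 : R) (fun t : R => t%:M : 'rV[R]_1) (const_mx 1).
  have := is_derive_scale (1%:M : 'rV[R]_1) t.
  rewrite (_ : *:%R^~ 1%:M = (fun t : R => t%:M : 'rV[R]_1)); last by apply/funext => u; exact: scalemx1.
  by rewrite (_ : 1%:M = const_mx 1) //; apply/rowP => i; rewrite !mxE (ord1 i).
have dz' i : is_derive t (1 : R) (fun t => z t%:M ord0 i) (X (z t%:M) ord0 i).
  have ts2 : inbox 0 (sigma / 2) (t%:M : 'rV[R]_1).
    by move=> k; rewrite !mxE (ord1 k) eqxx mulr1n subr0.
  have [dg dE] := dz i _ ts2.
  have h := is_deriveD (is_derive_cst (a ord0 i) t (1 : R)) (is_derive_comp_diff dg dt).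
  rewrite deriveE // dE /lform big_ord1 mxE mulr1 add0r in h.
  by rewrite (_ : (fun t => _) = cst (a ord0 i) + (g i \o (fun t : R => t%:M))) //; apply/funext => u; rewrite mxE.
have D1 : derivable (fun t => z t%:M) t 1.
  by apply/derivable_mxP => i j; rewrite (ord1 i); have [] := dz' j.
split=> //; rewrite derive_mx //; apply/matrixP => i j; rewrite mxE (ord1 i).
by have [_ ->] := dz' j.
Qed.

End LocalFlow.

(** * Inputs and trajectories *)

Section Words.
Variables (R : realType) (m : nat) (U : set 'rV[R]_m).
Implicit Types (u v w : word R m) (B : set (word R m)).

Lemma duration_nil : duration ([::] : word R m) = 0.
Proof. by rewrite /duration big_nil. Qed.

Lemma duration_cons b u : duration (b :: u) = b.2 + duration u.
Proof. by rewrite /duration big_cons. Qed.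

Lemma duration_cat u v : duration (u ++ v) = duration u + duration v.
Proof. by rewrite /duration big_cat. Qed.

Lemma duration_rcons u al (s : R) : duration (u ++ [:: (al, s)]) = duration u + s.
Proof. by rewrite duration_cat duration_cons duration_nil addr0. Qed.

Lemma pc_nil : pc_inputs U [::].
Proof. by []. Qed.

Lemma pc_cat u v : pc_inputs U (u ++ v) <-> pc_inputs U u /\ pc_inputs U v.
Proof.
split=> [H|[Hu Hv] b]; last by rewrite mem_cat => /orP[/Hu|/Hv].
by split=> b bu; apply: H; rewrite mem_cat bu ?orbT.
Qed.

Lemma pc_cons al (s : R) u : pc_inputs U ((al, s) :: u) <-> [/\ U al, 0 <= s & pc_inputs U u].
Proof.
split=> [H|[Ua s0 Hu] b]; last by rewrite inE => /predU1P[->|/Hu].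
have [Ua s0] := H (al, s) (mem_head _ _).
by split=> // b bu; apply: H; rewrite inE bu orbT.
Qed.

Lemma pc_seq1 al (s : R) : U al -> 0 <= s -> pc_inputs U [:: (al, s)].
Proof. by move=> Ua s0; apply/pc_cons. Qed.

Lemma duration_ge0 u : pc_inputs U u -> 0 <= duration u.
Proof.
elim: u => [|[al s] u IH]; first by rewrite duration_nil.
by move=> /pc_cons[_ s0 /IH]; rewrite duration_cons; exact: addr_ge0.
Qed.

Lemma pc_zip (be : seq 'rV[R]_m) (s : seq R) : (forall a, a \in be -> U a) ->
  (forall x, x \in s -> 0 <= x) -> pc_inputs U (zip be s).
Proof.
elim: be s => [|a be IH] [|x s] //= Ha Hs; apply/pc_cons; split.
- by apply: Ha; rewrite mem_head.
- by apply: Hs; rewrite mem_head.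
by apply: IH => y h; [apply: Ha|apply: Hs]; rewrite inE h orbT.
Qed.

Lemma word_zip u : zip [seq b.1 | b <- u] [seq b.2 | b <- u] = u.
Proof. exact: zip_unzip. Qed.

Lemma pc_unzip u : pc_inputs U u -> (forall a, a \in [seq b.1 | b <- u] -> U a) /\
  (forall x, x \in [seq b.2 | b <- u] -> 0 <= x).
Proof. by move=> Hu; split=> ? /mapP[b /Hu[? ?] ->]. Qed.

Lemma duration_zip (be : seq 'rV[R]_m) (s : seq R) : size be = size s ->
  duration (zip be s) = \sum_(x <- s) x.
Proof.
elim: be s => [|a be IH] [|x s] //= => [_|[/IH h]]; first by rewrite duration_nil big_nil.
by rewrite duration_cons h big_cons.
Qed.

Lemma mk_wordE k (al : seq 'rV[R]_m) (s : seq R) : size al = k -> size s = k ->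
  mk_word (fun i : 'I_k => nth 0 al i) (\row_i nth 0 s i) = zip al s.
Proof.
move=> alk sk; apply: (@eq_from_nth _ (0, 0)).
  by rewrite size_map size_enum_ord size_zip alk sk minnn.
move=> i; rewrite size_map size_enum_ord => ik.
rewrite nth_zip ?alk ?sk // (nth_map (Ordinal ik)) ?size_enum_ord // mxE.
by rewrite nth_enum_ord.
Qed.

Lemma mk_word_zip k (al : 'I_k -> 'rV[R]_m) (s : 'rV[R]_k) :
  mk_word al s = zip [seq al i | i <- enum 'I_k] [seq s ord0 i | i <- enum 'I_k].
Proof. by rewrite /mk_word zip_map. Qed.

Lemma pc_eq_zeros u v : pc_inputs U u -> (forall b, b \in v -> b.2 = 0) -> pc_eq (u ++ v) u.
Proof.
move=> Hu Hv; have v0 : duration v = 0.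
  elim: v Hv => [|b v IH] Hv; first by rewrite duration_nil.
  rewrite duration_cons Hv ?mem_head // add0r IH // => c cv; apply: Hv.
  by rewrite inE cv orbT.
rewrite /pc_eq duration_cat v0 addr0; split=> // t; elim: u Hu t => [_ t|[al s] u IH] /=.
  by rewrite duration_nil => /andP[h1 h2]; have := le_lt_trans h1 h2; rewrite ltxx.
move=> /pc_cons[_ s0 Hu] t; rewrite duration_cons /= => /andP[t0 tu].
by case: ltP => // st; apply: IH => //; rewrite subr_ge0 st ltrBlDl.
Qed.

Lemma pc_eq_sym u v : pc_eq u v -> pc_eq v u.
Proof. by move=> [d H]; split=> // t; rewrite -d => /H. Qed.

Lemma adm_pc B u : admissible U B -> B u -> pc_inputs U u.
Proof. by case=> h _; exact: h. Qed.

Lemma adm_zeros B u v : admissible U B -> pc_inputs U v -> (forall b, b \in v -> b.2 = 0) ->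
  B (u ++ v) <-> B u.
Proof.
move=> HB Hv v0; have [_ [eqB _]] := HB; split=> Bu.
  have /pc_cat[Hu _] := adm_pc HB Bu.
  exact: eqB Bu Hu (pc_eq_zeros Hu v0).
have Hu := adm_pc HB Bu; apply: eqB Bu _ (pc_eq_sym (pc_eq_zeros Hu v0)).
exact/pc_cat.
Qed.

Lemma adm_perturb B (al : seq 'rV[R]_m) (t : seq R) : admissible U B -> size al = size t ->
  B (zip al t) -> exists2 delta : R, 0 < delta & forall s : seq R, size s = size t ->
    (forall i, (i < size t)%N -> 0 <= nth 0 s i <= nth 0 t i + delta) -> B (zip al s).
Proof.
move=> [_ [_ [_ [_ [_ H]]]]] st; rewrite -(mk_wordE st erefl) => /H[delta [d0 Hd]].
exists delta => // s ss Hs; rewrite -(mk_wordE st ss); apply: Hd => i.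
by rewrite !mxE; exact: Hs.
Qed.

Lemma adm_shrink B (al : seq 'rV[R]_m) (t s : seq R) : admissible U B -> size al = size t ->
  B (zip al t) -> size s = size t ->
  (forall i, (i < size t)%N -> 0 <= nth 0 s i <= nth 0 t i) -> B (zip al s).
Proof.
move=> HB st Bt ss Hs; have [d d0 H] := adm_perturb HB st Bt.
by apply: H => // i /Hs /andP[h1 h2]; rewrite h1 /=; lra.
Qed.

Lemma adm_shrink_last B u al (t s : R) : admissible U B -> 0 <= s <= t ->
  B (u ++ [:: (al, t)]) -> B (u ++ [:: (al, s)]).
Proof.
move=> HB st Bu; have /pc_cat[/pc_unzip[_ u0] _] := adm_pc HB Bu.
have E (x : R) : u ++ [:: (al, x)] = zip ([seq b.1 | b <- u] ++ [:: al]) ([seq b.2 | b <- u] ++ [:: x]).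
  by rewrite zip_cat ?size_map // word_zip.
rewrite E; rewrite E in Bu; apply: adm_shrink Bu _ _ => //; rewrite !size_cat !size_map //.
move=> i; rewrite addn1 ltnS leq_eqVlt => /predU1P[->|iu].
  by rewrite !nth_cat size_map ltnn subnn.
by rewrite !nth_cat size_map iu lexx andbT u0 // mem_nth // size_map.
Qed.

(** The last letter is shortened to duration 0 and then deleted, which does not change the input. *)
Lemma adm_prefix B u v : admissible U B -> B (u ++ v) -> B u.
Proof.
move=> HB; elim/last_ind: v => [|v [al s] IH]; first by rewrite cats0.
rewrite -cats1 catA => Bu; apply: IH.
have /pc_cat[_ /pc_cons[Ua s0 _]] := adm_pc HB Bu.
have := adm_shrink_last HB (_ : 0 <= 0 <= s) Bu; rewrite lexx s0 => /(_ isT).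
apply: (iffLR (adm_zeros _ HB _ _)); first exact: pc_seq1.
by move=> b; rewrite inE => /eqP ->.
Qed.

Lemma adm_nil B : admissible U B -> B [::].
Proof.
move=> HB; have [_ [_ [[u Bu] _]]] := HB.
exact: (@adm_prefix _ [::] u HB).
Qed.

(** Durations can be perturbed only for letters already present, so the letters of [be] are first
    appended with duration 0. *)
Lemma adm_small B u (be : seq 'rV[R]_m) : admissible U B -> B u -> (forall a, a \in be -> U a) ->
  exists2 eta : R, 0 < eta & forall s : seq R, size s = size be ->
    (forall x, x \in s -> 0 <= x <= eta) -> B (u ++ zip be s).
Proof.
move=> HB Bu Hbe; pose z := nseq (size be) (0 : R).
have /pc_unzip[_ u0] := adm_pc HB Bu.
have E s : u ++ zip be s = zip ([seq b.1 | b <- u] ++ be) ([seq b.2 | b <- u] ++ s).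
  by rewrite zip_cat ?size_map // word_zip.
have Bz : B (u ++ zip be z).
  apply/(adm_zeros _ HB) => //.
    by apply: pc_zip => // x; rewrite mem_nseq => /andP[_ /eqP ->].
  move=> b; rewrite /z; elim: (be) => //= a l IH; rewrite inE => /predU1P[->//|]; exact: IH.
rewrite E in Bz; have [|d d0 H] := adm_perturb HB _ Bz.
  by rewrite !size_cat !size_map size_nseq.
exists d => // s ss Hs; rewrite E; apply: H; rewrite !size_cat !size_map size_nseq ?ss //.
move=> i iu; rewrite !nth_cat size_map; case: ltnP => iu'.
  have h : 0 <= nth 0 [seq b.2 | b <- u] i by apply: u0; rewrite mem_nth // size_map.
  by rewrite h /=; lra.
rewrite nth_nseq if_same add0r; apply: Hs; rewrite mem_nth // ss.
by rewrite -(ltn_add2l (size u)) subnKC.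
Qed.

Lemma adm_extend_last B u al (t : R) : admissible U B -> 0 <= t -> B (u ++ [:: (al, t)]) ->
  exists2 eta : R, 0 < eta & forall s : R, 0 <= s <= t + eta -> B (u ++ [:: (al, s)]).
Proof.
move=> HB t0 Bu; have /pc_cat[/pc_unzip[_ u0] _] := adm_pc HB Bu.
have E (x : R) : u ++ [:: (al, x)] = zip ([seq b.1 | b <- u] ++ [:: al]) ([seq b.2 | b <- u] ++ [:: x]).
  by rewrite zip_cat ?size_map // word_zip.
rewrite E in Bu; have [|d d0 H] := adm_perturb HB _ Bu; first by rewrite !size_cat !size_map.
exists d => // s st; rewrite E; apply: H; rewrite !size_cat !size_map //.
move=> i; rewrite addn1 ltnS leq_eqVlt => /predU1P[->|iu].
  by rewrite !nth_cat size_map ltnn subnn.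
rewrite !nth_cat size_map iu; have h : 0 <= nth 0 [seq b.2 | b <- u] i.
  by apply: u0; rewrite mem_nth // size_map.
by rewrite h /=; lra.
Qed.

Definition short_inputs (tau : R) : set (word R m) := [set w | pc_inputs U w /\ duration w < tau].

Lemma restrict_pc u (t : R) : pc_inputs U u -> 0 <= t ->
  pc_inputs U (restrict_input u t) /\ duration (restrict_input u t) <= duration u.
Proof.
elim: u t => [|[al s] u IH] t //=.
move=> Hu; have /pc_cons[Ua s0 Hu'] := Hu => t0.
have d0 := duration_ge0 Hu'.
case: ifPn => [ts|]; first by split; [exact: pc_seq1|rewrite !duration_cons duration_nil /=; lra].
rewrite -ltNge => st; have [|h1 h2] := IH (t - s) Hu'; first lra.
by split; [apply/pc_cons|rewrite !duration_cons lerD2l].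
Qed.

(** Together with [short_inputs_runnable], this provides at least one member for the union defining
    [sys_inputs]. *)
Lemma short_inputs_admissible (tau : R) : 0 < tau -> admissible U (short_inputs tau).
Proof.
move=> t0; split; last split; last split; last split; last split.
- by move=> u [].
- by move=> u v [Hu du] Hv [dE _]; split=> //; rewrite -dE.
- by exists [::]; split=> //; rewrite duration_nil.
- move=> u t [Hu du] /andP[t00 tu]; have [h1 h2] := restrict_pc Hu t00.
  by split=> //; exact: le_lt_trans du.
- move=> u al [Hu du] Ua; exists ((tau - duration u) / 2); split; first lra.
  split; first by apply/pc_cat; split=> //; apply: pc_seq1 => //; lra.
  by rewrite duration_rcons; lra.
move=> k al t [Ht dt].
have E (s : 'rV[R]_k) : duration (mk_word al s) = \sum_i s ord0 i.
  by rewrite mk_word_zip duration_zip ?size_map // big_map big_enum.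
(* Half of the remaining time is shared among the letters; [k.+1] also covers the empty word. *)
pose d := (tau - duration (mk_word al t)) / 2 / k.+1%:R.
have d0 : 0 < d by rewrite divr_gt0 ?divr_gt0 ?subr_gt0.
exists d; split=> // s Hs; split.
  move=> b /mapP[i ik ->] /=; split; last by have /andP[] := Hs i.
  by have /= [] := Ht (al i, t ord0 i) (map_f (fun i => (al i, t ord0 i)) ik).
rewrite E; apply: le_lt_trans (_ : \sum_i (t ord0 i + d) < _).
  by apply: ler_sum => i _; have /andP[] := Hs i.
rewrite big_split /= -E sumr_const card_ord.
have : d *+ k <= (tau - duration (mk_word al t)) / 2.
  apply: le_trans (_ : d *+ k.+1 <= _); first by rewrite ler_pMn2l.
  by rewrite -mulr_natr /d mulfVK ?pnatr_eq0.
by move: dt; clear; lra.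
Qed.

End Words.

(** * Shifts, uniqueness and confinement of integral curves *)

Section CurveOperations.
Variable (R : realType).

Lemma is_derive_shift (V : normedModType R) (x : R -> V) (c t : R) (v : V) :
  is_derive (t + c) (1 : R) x v -> is_derive t (1 : R) (fun s => x (s + c)) v.
Proof.
move=> [dx <-].
have E : (fun h => h^-1 *: (((fun s => x (s + c)) \o shift t) (h *: 1) - x (t + c))) =
         (fun h => h^-1 *: ((x \o shift (t + c)) (h *: 1) - x (t + c))).
  by apply/funext => h /=; rewrite addrA.
by split; rewrite /derivable /derive E.
Qed.

Lemma curve_eq n (X : 'rV[R]_n -> 'rV[R]_n) D (a b : R) (x y : R -> 'rV[R]_n) :
  (forall t, a <= t <= b -> x t = y t) -> curve X D a b x -> curve X D a b y.
Proof.
move=> xy [/within_continuousP xc xD xd]; split.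
- apply/within_continuousP => t e tab e0; have [d d0 H] := xc t e tab e0.
  by exists d => // s sab st; rewrite -!xy //; exact: H.
- by move=> t tab; rewrite -xy //; exact: xD.
move=> t tab; have tab' : a <= t <= b by case/andP: tab => h1 h2; rewrite !ltW.
rewrite -xy //; apply: near_eq_is_derive (xd t tab).
have : nbhs t `]a, b[%classic by apply: near_in_itvoo; rewrite in_itv.
by apply: filterS => s /=; rewrite in_itv => /= /andP[h1 h2]; apply: xy; rewrite !ltW.
Qed.

Lemma curve_shift n (X : 'rV[R]_n -> 'rV[R]_n) D (a b c : R) (x : R -> 'rV[R]_n) :
  curve X D (a + c) (b + c) x -> curve X D a b (fun t => x (t + c)).
Proof.
move=> [/within_continuousP xc xD xd]; split.
- apply/within_continuousP => t e tab e0; have [|d d0 H] := xc (t + c) e _ e0; first by rewrite !lerD2r.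
  by exists d => // s sab st; apply: H; rewrite ?lerD2r // opprD addrACA subrr addr0.
- by move=> t tab; apply: xD; rewrite !lerD2r.
by move=> t tab; apply: is_derive_shift; apply: xd; rewrite !ltrD2r.
Qed.

(** At a common point all iterated Lie derivatives of the coordinate functions agree, so
    [curves_agree] applies to each coordinate. *)
Lemma curve_unique n (X : 'rV[R]_n -> 'rV[R]_n) D (a b t0 : R) (x y : R -> 'rV[R]_n) :
  field_anl D X -> curve X D a b x -> curve X D a b y -> a <= t0 <= b -> x t0 = y t0 ->
  forall t, a <= t <= b -> x t = y t.
Proof.
move=> DX cx cy t0ab xy t tab; apply/rowP => i.
have Di := @anl_coord R n D i.
by have := curves_agree DX DX Di Di cx cy t0ab _ 0%N tab; apply=> k; rewrite xy.
Qed.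

Lemma curve_speed n (X : 'rV[R]_n -> 'rV[R]_n) D (a b K : R) (x : R -> 'rV[R]_n) :
  curve X D a b x -> (forall z i, D z -> `|X z ord0 i| <= K) ->
  forall s t i, a <= s -> s <= t -> t <= b -> `|x t ord0 i - x s ord0 i| <= K * (t - s).
Proof.
move=> cx XK s t i as_ st tb.
have [->|snt] := eqVneq s t; first by rewrite !subrr normr0 mulr0.
have {snt}st' : s < t by rewrite lt_neqAle snt.
have cx' := curve_sub as_ tb cx.
have Di := @anl_coord R n D i.
have [||c] := @MVT R (fun t => x t ord0 i) (fun t => lie X (fun x => x ord0 i) (x t)) s t st'.
- by move=> c; rewrite in_itv => /= cst; exact: (curve_derive cx' Di cst).
- exact: (curve_continuous cx' Di).
rewrite in_itv => /= /andP[sc ct] ->; rewrite normrM [`|t - s|]ger0_norm ?subr_ge0 //.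
rewrite ler_wpM2r ?subr_ge0 //.
have Dc : D (x c) by case: cx' => _ h _; apply: h; rewrite !ltW.
suff -> : lie X (fun x => x ord0 i) (x c) = X (x c) ord0 i by exact: XK.
have cst : s < c < t by rewrite sc.
have [_ _ xd] := cx'; have [dx dE] := xd c cst; have [_ hE] := curve_derive cx' Di cst.
by rewrite -hE -dE derive_mx // mxE.
Qed.

(** Any curve starting near [a] is, by uniqueness, the one built by [flow_local], which stays in a
    prescribed polydisc for a time independent of the starting point. *)
Lemma curve_stay n (X : 'rV[R]_n -> 'rV[R]_n) (D W : set 'rV[R]_n) a :
  open D -> field_anl D X -> D a -> nbhs a W ->
  exists2 r : R, 0 < r & exists2 tau : R, 0 < tau & forall (x : R -> 'rV[R]_n) (b : R),
    b <= tau -> curve X D 0 b x -> inbox a r (x 0) -> forall t, 0 <= t <= b -> W (x t).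
Proof.
move=> oD DX Da Wa; have Dn : nbhs a D by exact: open_nbhs_nbhs.
have [rho0 r0 rW] := nbhs_inbox (filterI Wa Dn).
have [rho1 [K [r1 rX]]] := repr_common (fun i => DX i a Da).
pose rho := Num.min rho0 rho1.
have rp : 0 < rho by rewrite lt_min r0.
have rl0 : rho <= rho0 by rewrite ge_min lexx.
have rl1 : rho <= rho1 by rewrite ge_min lexx orbT.
have bW x : inbox a (rho / 2) x -> W x /\ D x.
  by move=> ax; apply: rW => i; apply: le_trans (ax i) _; lra.
have [|tau t0 H] := @flow_local R n X a rho K rp.
  by move=> i; apply: repr_shrink (rX i); rewrite (ltW rp).
exists (rho / 4); first lra.
exists tau => // x b bt cx x0 t /andP[tt0 tb].
have [z [z0 zP]] := H _ x0.
have zn s : 0 <= s <= b -> `|s| <= tau by move=> /andP[s0 sb]; rewrite ger0_norm //; lra.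
have cz : curve X D 0 b z.
  split=> [|s /zn/zP[/bW[]]|s /andP[s0 sb]] //.
    apply: derivable_within_continuous => s; rewrite in_itv /= => /zn/zP[_ [dz _]]; exact: dz.
  by have [_] := zP s (zn s ltac:(by rewrite !ltW)).
have t0b : 0 <= (0 : R) <= b by rewrite lexx (le_trans tt0).
rewrite (curve_unique DX cx cz t0b) ?z0 //; last by rewrite tt0.
by have [/bW[]] := zP t (zn t ltac:(by rewrite tt0)).
Qed.

End CurveOperations.

Lemma seq_min_pos (R : realType) (T : eqType) (s : seq T) (P : T -> R -> Prop) :
  (forall a, a \in s -> exists2 e : R, 0 < e & P a e) ->
  (forall a e e', 0 < e' -> e' <= e -> P a e -> P a e') ->
  exists2 e : R, 0 < e & forall a, a \in s -> P a e.
Proof.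
move=> H mono; elim: s H => [|a s IH] H; first by exists 1.
have [e1 e10 P1] := H a (mem_head _ _).
have [|e2 e20 P2] := IH; first by move=> b bs; apply: H; rewrite inE bs orbT.
have m0 : 0 < Num.min e1 e2 by rewrite lt_min e10.
exists (Num.min e1 e2) => // b; rewrite inE => /predU1P[->|/P2].
  by apply: mono P1; rewrite // ge_min lexx.
by apply: mono; rewrite // ge_min lexx orbT.
Qed.

(** * Trajectories of a Nash system *)

Section Trajectories.
Variables (R : realType) (m n r : nat) (U : set 'rV[R]_m) (S : system R m n r).
Variable (NS : nash_system U S).
Local Notation D := (state_space S).
Local Notation f := (dynamics S).
Local Notation fs := (final_state S).

Lemma nash_system_open : open D. Proof. by case: NS. Qed.

Lemma nash_system_field al : U al -> field_anl D (f al).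
Proof. by move=> Ua i; case: NS => oD [_ [_ [/(_ al Ua i) h _]]]; exact: nash_anl. Qed.

Lemma split_last (T : Type) (u v w : seq T) a b : u ++ [:: a] = v ++ b :: w ->
  (u = v /\ a = b) \/ exists w', u = v ++ b :: w' /\ w = w' ++ [:: a].
Proof.
case/lastP: w => [|w' c].
  by rewrite !cats1 => /rcons_inj[-> ->]; left.
by rewrite -rcons_cons -rcons_cat cats1 => /rcons_inj[-> ->]; right; exists w'; rewrite cats1.
Qed.

Lemma traj_prefix u v x : 0 <= duration v -> is_trajectory S (u ++ v) x -> is_trajectory S u x.
Proof.
move=> v0 [x0 [xc [xD xd]]]; split=> //; split; last split.
- by apply: within_continuous_sub xc; rewrite // duration_cat lerDl.
- move=> t /andP[t0 tu]; apply: xD; rewrite t0 duration_cat; lra.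
by move=> v' al s w uE; apply: (xd v' al s (w ++ v)); rewrite uE -catA.
Qed.

Lemma traj_last u al (s : R) x : 0 <= duration u -> is_trajectory S (u ++ [:: (al, s)]) x ->
  curve (f al) D (duration u) (duration u + s) x.
Proof.
move=> u0 [x0 [xc [xD xd]]]; rewrite duration_rcons in xc xD; split.
- exact: within_continuous_sub xc.
- by move=> t /andP[t0 tu]; apply: xD; rewrite tu (le_trans u0).
by move=> t tu; apply: (xd u al s [::]).
Qed.

Lemma traj_rcons u al (s : R) x : 0 <= duration u -> 0 <= s -> is_trajectory S u x ->
  curve (f al) D (duration u) (duration u + s) x -> is_trajectory S (u ++ [:: (al, s)]) x.
Proof.
move=> u0 s0 [x0 [xc [xD xd]]] [cc cD cd]; split=> //; rewrite duration_rcons; split; last split.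
- have := withinU_continuous (@itv_closed _ _ _ _) (@itv_closed _ _ _ _) xc cc.
  rewrite (_ : _ `|` _ = `[0, duration u + s]%classic) //.
  apply/seteqP; split=> t /=; rewrite !in_itv /=; first by case=> /andP[? ?]; apply/andP; split; lra.
  by move=> /andP[t0 ts]; have [tu|tu] := leP t (duration u); [left|right]; rewrite ?t0 // ts ltW.
- move=> t /andP[t0 ts]; have [tu|tu] := leP t (duration u); first by apply: xD; rewrite t0.
  by apply: cD; rewrite ts ltW.
move=> v be q w E; case: (split_last E) => [[<- [<- <-]]|[w' [uE _]]]; first exact: cd.
exact: xd uE.
Qed.

Lemma traj_eq u (x y : R -> 'rV[R]_n) : pc_inputs U u -> (forall t, 0 <= t <= duration u -> x t = y t) ->
  is_trajectory S u x -> is_trajectory S u y.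
Proof.
elim/last_ind: u => [|u [al s] IH].
  rewrite duration_nil => _ xy [x0 [xc [xD xd]]]; split; first by rewrite -xy // lexx.
  split; last split.
  - apply/within_continuousP => t e; rewrite duration_nil => /andP[t0 t0'] e0.
    exists 1 => // s' /andP[s0 s0'] _.
    have -> : s' = t by apply/le_anti; rewrite (le_trans s0') // (le_trans t0').
    by rewrite subrr normr0.
  - by rewrite duration_nil => t t0; rewrite -xy //; apply: xD; rewrite duration_nil.
  - by case.
rewrite -cats1 duration_rcons => /pc_cat[Hu /pc_cons[Ua s0 _]] xy tx.
have u0 := duration_ge0 Hu.
have us : 0 <= duration [:: (al, s)] by rewrite duration_cons duration_nil addr0.
apply: traj_rcons => //.
  apply: IH (traj_prefix us tx) => // t /andP[t0 tu]; apply: xy; rewrite t0; lra.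
apply: curve_eq (traj_last u0 tx) => t /andP[ut ts]; apply: xy; rewrite ts; lra.
Qed.

Lemma traj_unique u x y : pc_inputs U u -> is_trajectory S u x -> is_trajectory S u y ->
  forall t, 0 <= t <= duration u -> x t = y t.
Proof.
elim/last_ind: u => [|u [al s] IH].
  rewrite duration_nil => _ [x0 _] [y0 _] t t0.
  by have -> : t = 0; [apply/le_anti; rewrite andbC|rewrite x0 y0].
rewrite -cats1 duration_rcons => /pc_cat[Hu /pc_cons[Ua s0 _]] tx ty.
have u0 := duration_ge0 Hu.
have us : 0 <= duration [:: (al, s)] by rewrite duration_cons duration_nil addr0.
have E := IH Hu (traj_prefix us tx) (traj_prefix us ty).
move=> t /andP[t0 ts]; have [tu|tu] := leP t (duration u); first by apply: E; rewrite t0.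
have uu : duration u <= duration u <= duration u + s by rewrite lexx lerDl.
apply: (curve_unique (nash_system_field Ua) (traj_last u0 tx) (traj_last u0 ty) uu).
  by apply: E; rewrite u0 lexx.
by rewrite ts ltW.
Qed.

(** Uniqueness is automatic for Nash dynamics, so existence of a trajectory is all that has to be
    followed. *)
Definition runnable (u : word R m) : Prop := pc_inputs U u /\ exists x, is_trajectory S u x.

Lemma runnable_unique u : runnable u -> has_unique_trajectory S u.
Proof.
move=> [Hu [x tx]]; exists x; split=> // y ty t tu; exact: (traj_unique Hu ty tx).
Qed.

Lemma runnableP u : runnable u -> is_trajectory S u (trajectory S u).
Proof. by move=> [_ h]; exact: (@xgetPex _ (fun=> 0) [set x | is_trajectory S u x] h). Qed.

Lemma final_stateE u x : pc_inputs U u -> is_trajectory S u x -> fs u = x (duration u).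
Proof.
move=> Hu tx; apply: (traj_unique Hu _ tx); first by apply: runnableP; split=> //; exists x.
by rewrite (duration_ge0 Hu) /=.
Qed.

Lemma runnable_state u : runnable u -> D (fs u).
Proof.
move=> Ru; have [Hu _] := Ru; have [_ [_ [+ _]]] := runnableP Ru.
by apply; rewrite (duration_ge0 Hu) /=.
Qed.

Lemma runnable_nil : runnable [::].
Proof.
split; first exact: pc_nil.
exists (fun=> initial_state S); split=> //; split; last split.
- by apply: continuous_subspaceT => t; exact: cvg_cst.
- by move=> t _; case: NS => _ [_ [_ [_ [_]]]].
by case.
Qed.

Lemma final_state_nil : fs [::] = initial_state S.
Proof.
have [x0 _] := runnableP runnable_nil; by rewrite /final_state duration_nil x0.
Qed.

Lemma runnable_prefix u v : runnable (u ++ v) -> runnable u.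
Proof.
move=> [/pc_cat[Hu Hv] [x tx]]; split=> //; exists x; apply: traj_prefix tx; exact: duration_ge0 Hv.
Qed.

(** Trajectories are followed through the final states of words with a varying last duration, which
    spares comparing functions on different time intervals. *)
Lemma runnable_curve u al (s : R) : runnable (u ++ [:: (al, s)]) ->
  [/\ U al, 0 <= s, curve (f al) D 0 s (fun t => fs (u ++ [:: (al, t)])) & fs (u ++ [:: (al, 0)]) = fs u].
Proof.
move=> Ru; have [/pc_cat[Hu /pc_cons[Ua s0 _]] [x tx]] := Ru.
have u0 := duration_ge0 Hu.
have us : 0 <= duration [:: (al, s)] by rewrite duration_cons duration_nil addr0.
have tu := traj_prefix us tx.
have cx := traj_last u0 tx.
have fE t : 0 <= t <= s -> fs (u ++ [:: (al, t)]) = x (t + duration u).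
  move=> /andP[t0 ts]; rewrite (@final_stateE _ x) ?duration_rcons 1?addrC //.
    by apply/pc_cat; split=> //; exact: pc_seq1.
  by apply: traj_rcons => //; apply: curve_sub cx => //; rewrite lerD2l.
split=> //; last by rewrite fE ?lexx ?s0 // add0r (final_stateE Hu tu).
apply: (@curve_eq _ _ _ _ _ _ (fun t => x (t + duration u))) => [t /fE //|].
by apply: curve_shift; rewrite add0r addrC.
Qed.

Lemma runnable_rcons u al (s : R) (y : R -> 'rV[R]_n) : runnable u -> U al -> 0 <= s ->
  curve (f al) D 0 s y -> y 0 = fs u ->
  runnable (u ++ [:: (al, s)]) /\ forall t, 0 <= t <= s -> fs (u ++ [:: (al, t)]) = y t.
Proof.
move=> [Hu [x tx]] Ua s0 cy y0; have u0 := duration_ge0 Hu.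
pose z t := if t <= duration u then x t else y (t - duration u).
have zx t : 0 <= t <= duration u -> x t = z t by rewrite /z => /andP[_ ->].
have zy t : duration u <= t <= duration u + s -> y (t - duration u) = z t.
  rewrite /z => /andP[ut _]; case: ifPn => // tu.
  have -> : t = duration u by apply/le_anti; rewrite tu.
  by rewrite subrr y0 (final_stateE Hu tx).
have tz : is_trajectory S (u ++ [:: (al, s)]) z.
  apply: traj_rcons => //; first exact: traj_eq zx tx.
  by apply: curve_eq zy _; apply: curve_shift; rewrite subrr addrAC subrr add0r.
have Ru : runnable (u ++ [:: (al, s)]).
  by split; [apply/pc_cat; split=> //; exact: pc_seq1|exists z].
split=> // t /andP[t0 ts]; have [_ _ cf f0] := runnable_curve Ru.
have s00 : 0 <= (0 : R) <= s by rewrite lexx.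
apply: (curve_unique (nash_system_field Ua) cf cy s00); first by rewrite f0.
by rewrite t0.
Qed.

Lemma sys_runnable u : sys_inputs U S u -> runnable u.
Proof.
move=> [A [HA uA] Au]; split; first exact: adm_pc HA Au.
by have [x [tx _]] := uA u Au; exists x.
Qed.

Variable (finU : finite_set U).

(** With finitely many fields there are a common flow time and a common speed bound [K]. The
    distance to the initial state is at most [K] times the elapsed time, however many letters are
    used, so the flow can always be restarted. *)
Lemma short_inputs_runnable : exists2 tau : R, 0 < tau & forall w, short_inputs U tau w -> runnable w.
Proof.
have Dx := runnable_state runnable_nil; rewrite final_state_nil in Dx.
set x0 := initial_state S in Dx.
have /finite_seqP[us UE] := finU.
have Uus al : U al <-> al \in us by rewrite UE.
(* One parameter [e] is the radius and its inverse the bound, so the property persists when [e]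
   decreases and a minimum over [U] can be taken. *)
have [rho1 r1 H1] : exists2 e : R, 0 < e & forall al, al \in us ->
    forall i, repr x0 e e^-1 (fun x => f al x ord0 i).
  apply: seq_min_pos => [al /Uus Ua|al e e' e'0 ee' H i].
    have [rho [K [r0 H]]] := repr_common (fun i => nash_system_field Ua i Dx).
    exists (Num.min rho (`|K| + 1)^-1).
      by rewrite lt_min r0 invr_gt0; have := normr_ge0 K; lra.
    have K1 : 0 < `|K| + 1 by have := normr_ge0 K; lra.
    have m0 : 0 < Num.min rho (`|K| + 1)^-1 by rewrite lt_min r0 invr_gt0.
    move=> i; apply: repr_le (H i); first by rewrite (ltW m0) ge_min lexx.
    apply: le_trans (_ : `|K| + 1 <= _); first by have := ler_norm K; lra.
    by rewrite -[leLHS]invrK lef_pV2 ?posrE ?invr_gt0 // ge_min lexx orbT.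
  have e0 : 0 < e := lt_le_trans e'0 ee'.
  by apply: repr_le (H i); rewrite ?(ltW e'0) // lef_pV2.
have [rho0 r0 bD] := nbhs_inbox (open_nbhs_nbhs (conj nash_system_open Dx)).
pose rho := Num.min rho0 rho1; pose K := rho1^-1.
have rp : 0 < rho by rewrite lt_min r0.
have rl0 : rho <= rho0 by rewrite ge_min lexx.
have rl1 : rho <= rho1 by rewrite ge_min lexx orbT.
have K0 : 0 < K by rewrite invr_gt0.
have rX al i : U al -> repr x0 rho K (fun x => f al x ord0 i).
  by move=> /Uus/H1 h; apply: repr_shrink (h i); rewrite (ltW rp).
have [tau t0 H2] : exists2 e : R, 0 < e & forall al, al \in us -> forall y, inbox x0 (rho / 4) y ->
    exists x : R -> 'rV[R]_n, x 0 = y /\ forall t : R, `|t| <= e -> inbox x0 (rho / 2) (x t) /\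
      is_derive t (1 : R) x (f al (x t)).
  apply: seq_min_pos => [al /Uus Ua|al e e' e'0 ee' H y xy].
    exact: (flow_local rp (fun i => rX al i Ua)).
  by have [x [x0' xP]] := H y xy; exists x; split=> // t te; apply: xP; exact: le_trans ee'.
(* At speed [K] the state stays within rho / 4 during this time, where [H2] allows a new start. *)
pose tau' := Num.min tau (rho / 4 / K).
have r4K : 0 < rho / 4 / K by rewrite !divr_gt0.
have t'0 : 0 < tau' by rewrite lt_min t0.
have t't : tau' <= tau by rewrite ge_min lexx.
have t'K : K * tau' <= rho / 4 by rewrite mulrC -ler_pdivlMr // ge_min lexx orbT.
exists tau' => // w [Hw dw].
suff: runnable w /\ inbox x0 (K * duration w) (fs w) by case.
elim/last_ind: w Hw dw => [|w [al s] IH].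
  by move=> _ _; split; [exact: runnable_nil|move=> i; rewrite final_state_nil subrr normr0 duration_nil mulr0].
rewrite -cats1 duration_rcons => /pc_cat[Hw /pc_cons[Ua s0 _]] dw.
have w0 := duration_ge0 Hw.
have [//||Rw bw] := IH; first lra.
have bw' : inbox x0 (rho / 4) (fs w).
  move=> i; apply: le_trans (bw i) _; apply: le_trans t'K; apply: ler_wpM2l; first exact: ltW.
  lra.
have [y [y0 yP]] := H2 al ((Uus al).1 Ua) _ bw'.
pose D' := D `&` [set z | inbox x0 (rho / 2) z].
have yt t : 0 <= t <= s -> `|t| <= tau by move=> /andP[h1 h2]; rewrite ger0_norm //; lra.
have cy : curve (f al) D' 0 s y.
  split.
  - apply: derivable_within_continuous => t; rewrite in_itv /= => /yt/yP[_ [dy _]]; exact: dy.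
  - move=> t /yt/yP[h _]; split=> //; apply: bD => i; apply: le_trans (h i) _; lra.
  - by move=> t /andP[h1 h2]; have [|_] := yP t; [apply: yt; rewrite !ltW|].
have cy' : curve (f al) D 0 s y by case: cy => h1 h2 h3; split=> // t /h2[].
have [Rws fE] := runnable_rcons Rw Ua s0 cy' y0.
split=> // i; rewrite fE ?lexx ?s0 //.
have fK z j : D' z -> `|f al z ord0 j| <= K.
  move=> [_ bz]; apply: (repr_bound (ltW rp) (rX al j Ua)) => k; apply: le_trans (bz k) _; lra.
have h1 := curve_speed cy fK i (lexx 0) s0 (lexx s).
rewrite y0 subr0 in h1; have h2 := bw i.
have -> : y s ord0 i - x0 ord0 i = (y s ord0 i - fs w ord0 i) + (fs w ord0 i - x0 ord0 i) by rewrite addrA subrK.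
apply: le_trans (ler_normD _ _) _; lra.
Qed.

Lemma sys_admissible : admissible U (sys_inputs U S).
Proof.
have [tau t0 H] := short_inputs_runnable.
apply: admissible_bigcup => [|B []//].
exists (short_inputs U tau); split; first exact: short_inputs_admissible.
by move=> w /H; exact: runnable_unique.
Qed.

Lemma sys_stay u (be : seq 'rV[R]_m) (W : set 'rV[R]_n) : sys_inputs U S u ->
  (forall a, a \in be -> U a) -> nbhs (fs u) W ->
  exists2 eta : R, 0 < eta & forall s : seq R, size s = size be ->
    (forall x, x \in s -> 0 <= x <= eta) -> sys_inputs U S (u ++ zip be s) /\ W (fs (u ++ zip be s)).
Proof.
move=> Su; elim/last_ind: be W => [|be al IH] W Hbe Wu.
  by exists 1 => // s /size0nil -> _; rewrite cats0; split=> //; exact: nbhs_singleton.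
have Ua : U al by apply: Hbe; rewrite mem_rcons mem_head.
have Hbe' a : a \in be -> U a by move=> h; apply: Hbe; rewrite mem_rcons inE h orbT.
have Df := runnable_state (sys_runnable Su).
have [rho r0 [tau t0 H1]] := curve_stay nash_system_open (nash_system_field Ua) Df Wu.
have [e1 e10 H2] := IH _ Hbe' (inbox_nbhs (fs u) r0).
have [e2 e20 H3] := adm_small sys_admissible Su Hbe.
pose e := Num.min (Num.min e1 e2) tau.
have e0 : 0 < e by rewrite !lt_min e10 e20.
have ee1 : e <= e1 by rewrite !ge_min lexx.
have ee2 : e <= e2 by rewrite !ge_min lexx orbT.
have et : e <= tau by rewrite ge_min lexx orbT.
exists e => // s; rewrite size_rcons; case/lastP: s => // s t; rewrite size_rcons => -[ss] Hs.
have Hs' x : x \in s -> 0 <= x <= e by move=> h; apply: Hs; rewrite mem_rcons inE h orbT.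
have /andP[tt0 te] : 0 <= t <= e by apply: Hs; rewrite mem_rcons mem_head.
have [_ W1] : sys_inputs U S (u ++ zip be s) /\ inbox (fs u) rho (fs (u ++ zip be s)).
  by apply: H2 => // x /Hs'/andP[h1 h2]; rewrite h1 (le_trans h2).
have S1 : sys_inputs U S (u ++ zip (rcons be al) (rcons s t)).
  by apply: H3; rewrite ?size_rcons ?ss // => x /Hs/andP[h1 h2]; rewrite h1 (le_trans h2).
split=> //; rewrite zip_rcons // -cats1 catA in S1 *.
have [_ _ cf f0] := runnable_curve (sys_runnable S1).
by apply: (H1 _ _ (le_trans te et) cf); rewrite ?f0 // tt0 lexx.
Qed.

End Trajectories.

(** * The vanishing ideal *)

Section VanishingIdeal.
Variables (R : realType) (m n r : nat) (U : set 'rV[R]_m) (S : system R m n r).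
Variable (NS : nash_system U S).
Variable (finU : finite_set U).
Local Notation D := (state_space S).
Local Notation f := (dynamics S).
Local Notation fs := (final_state S).
Local Notation sys := (sys_inputs U S).

Definition lie_word (ga : seq 'rV[R]_m) (g : 'rV[R]_n -> R) : 'rV[R]_n -> R :=
  foldr (fun a => lie (f a)) g ga.

(** These numbers are the partial derivatives, at zero durations, of the final value of [g] along
    inputs issued from [x]; the first letter is the outermost derivation. *)
Definition lie_null (x : 'rV[R]_n) (g : 'rV[R]_n -> R) : Prop :=
  forall ga, (forall a, a \in ga -> U a) -> lie_word ga g x = 0.

Lemma lie_word_anl ga g : (forall a, a \in ga -> U a) -> anl D g -> anl D (lie_word ga g).
Proof.
elim: ga => //= a ga IH Hga Dg; apply: anl_lie.
  by apply: IH => // b h; apply: Hga; rewrite inE h orbT.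
by apply: (nash_system_field NS); apply: Hga; rewrite mem_head.
Qed.

Lemma lie_word_nseq k a ga g : lie_word (nseq k a ++ ga) g = iter k (lie (f a)) (lie_word ga g).
Proof. by elim: k => //= k ->. Qed.

(** Iterated derivatives of a Lie word along [al] are the Lie words with [al] repeated in front, so
    [lie_null] at one time contains the hypothesis of [curves_agree] for every Lie word. *)
Lemma lie_null_curve al (b t0 : R) x g : U al -> anl D g -> curve (f al) D 0 b x ->
  0 <= t0 <= b -> lie_null (x t0) g -> forall t, 0 <= t <= b -> lie_null (x t) g.
Proof.
move=> Ua Dg cx t0b x0 t tb ga Hga.
have F := nash_system_field NS Ua.
have := curves_agree F F (lie_word_anl Hga Dg) (@anl_cst R n D 0) cx cx t0b _ 0%N tb; apply=> k.
rewrite iter_lie0 -lie_word_nseq; apply: x0 => a; rewrite mem_cat => /orP[|/Hga //].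
by rewrite mem_nseq => /andP[_ /eqP ->].
Qed.

Lemma lie_null_run u v g : anl D g -> runnable U S (u ++ v) ->
  lie_null (fs u) g <-> lie_null (fs (u ++ v)) g.
Proof.
move=> Dg; elim/last_ind: v => [|v [al s] IH]; first by rewrite cats0.
rewrite -cats1 catA => Ru; apply: iff_trans (IH (runnable_prefix Ru)) _.
have [Ua s0 cx x0] := runnable_curve NS Ru; rewrite -x0.
split=> H; [apply: (lie_null_curve Ua Dg cx _ H)|apply: (lie_null_curve Ua Dg cx _ H)];
  by rewrite ?lexx ?s0.
Qed.

Lemma lie_null_run0 u v g : anl D g -> runnable U S (u ++ v) -> lie_null (fs u) g -> g (fs (u ++ v)) = 0.
Proof. by move=> Dg Ru /(lie_null_run Dg Ru)/(_ [::]); exact. Qed.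

Definition null_after (u : word R m) (g : 'rV[R]_n -> R) (be : seq 'rV[R]_m) : Prop :=
  exists2 eta : R, 0 < eta & forall s : seq R, size s = size be ->
    (forall x, x \in s -> 0 <= x <= eta) -> g (fs (u ++ zip be s)) = 0.

(** Induction on the Lie word, for all continuations [be] together: vanishing after [be] followed by
    a short letter [a] can be differentiated in the duration of [a] at 0, which gives vanishing of
    the derivative along [a] after [be]. *)
Lemma lie_null_of_null_after u g : anl D g -> sys u ->
  (forall be, (forall a, a \in be -> U a) -> null_after u g be) -> lie_null (fs u) g.
Proof.
move=> Dg Su H.
suff main ga : (forall a, a \in ga -> U a) ->
    forall be, (forall a, a \in be -> U a) -> null_after u (lie_word ga g) be.
  move=> ga /main/(_ [::])[] // e e0 /(_ [::]); rewrite cats0; exact.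
elim: ga => [_|a ga IH Hga] be Hbe; first exact: H.
have Ua : U a by apply: Hga; rewrite mem_head.
have Hga' b : b \in ga -> U b by move=> h; apply: Hga; rewrite inE h orbT.
have Hbe' b : b \in rcons be a -> U b by rewrite mem_rcons inE => /predU1P[->|/Hbe].
have [e1 e10 H1] := IH Hga' _ Hbe'.
have [e2 e20 H2] := adm_small (sys_admissible NS finU) Su Hbe'.
pose e := Num.min e1 e2.
have e0 : 0 < e by rewrite lt_min e10.
have ee1 : e <= e1 by rewrite ge_min lexx.
have ee2 : e <= e2 by rewrite ge_min lexx orbT.
exists e => // s ss Hs.
have E t : u ++ zip (rcons be a) (rcons s t) = (u ++ zip be s) ++ [:: (a, t)].
  by rewrite zip_rcons // -cats1 catA.
have Hr (t d : R) : 0 <= t <= e -> e <= d -> forall x, x \in rcons s t -> 0 <= x <= d.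
  move=> te ed x; rewrite mem_rcons inE => /predU1P[->|/Hs/andP[x0 xe]].
    by have /andP[t0 t1] := te; rewrite t0 (le_trans t1).
  by rewrite x0 (le_trans xe).
have e0e : 0 <= e <= e by rewrite lexx ltW.
have Ru : runnable U S ((u ++ zip be s) ++ [:: (a, e)]).
  by apply: sys_runnable; rewrite -E; apply: H2; [rewrite !size_rcons ss|exact: Hr].
have [_ _ cx x0] := runnable_curve NS Ru.
have F := nash_system_field NS Ua.
have e00 : 0 <= (0 : R) <= e by rewrite lexx ltW.
have := curves_agree_lie F F (lie_word_anl Hga' Dg) (@anl_cst R n D 0) cx cx e0 _ 1%N e00.
rewrite iter_lie0 x0; apply=> t te; rewrite -E; apply: H1; [by rewrite !size_rcons ss|exact: Hr].
Qed.

Lemma not_lie_null u g : anl D g -> sys u -> ~ lie_null (fs u) g ->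
  exists2 be, (forall a, a \in be -> U a) & forall eta : R, 0 < eta -> exists s : seq R,
    [/\ size s = size be, (forall x, x \in s -> 0 <= x <= eta) & g (fs (u ++ zip be s)) != 0].
Proof.
move=> Dg Su; apply: contra_notP => H; apply: lie_null_of_null_after => // be Hbe.
apply: contrapT => nH; apply: H; exists be => // eta eta0.
apply: contrapT => nH'; apply: nH; exists eta => // s ss Hs.
by apply/eqP/negP => /negP gs; apply: nH'; exists s.
Qed.

(** If [g] is not null, it is nonzero at a state reached shortly after [u], and by continuity near
    it. There [h] is still not null, since nullity would be carried back to [u]; so a further short
    input reaches a state where both are nonzero. *)
Lemma lie_null_prime u g h : anl D g -> anl D h -> sys u ->
  lie_null (fs u) (fun x => g x * h x) -> lie_null (fs u) g \/ lie_null (fs u) h.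
Proof.
move=> Dg Dh Su Igh; apply: contrapT => /not_orP[ng nh].
have adm := sys_admissible NS finU.
have [be Hbe H1] := not_lie_null Dg Su ng.
have [e1 e10 H2] := adm_small adm Su Hbe.
have [s [ss Hs gs]] := H1 e1 e10.
have Sw := H2 s ss Hs; set w := u ++ zip be s in Sw gs.
have Rw := sys_runnable Sw.
have nhw : ~ lie_null (fs w) h by move=> /(lie_null_run Dh Rw).
have [be2 Hbe2 H3] := not_lie_null Dh Sw nhw.
have gn : \forall x \near fs w, g x != 0.
  have gc : {for fs w, continuous g}.
    by apply: differentiable_continuous; apply: anl_differentiable Dg _; exact: runnable_state Rw.
  have /cvgrPdist_lt/(_ `|g (fs w)|) := gc; rewrite normr_gt0 => /(_ gs).
  by apply: filterS => x; apply: contraTneq => ->; rewrite subr0 ltxx.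
have [e2 e20 H4] := sys_stay NS finU Sw Hbe2 gn.
have [s2 [ss2 Hs2 hs2]] := H3 e2 e20.
have [Sw2 gw2] := H4 s2 ss2 Hs2.
have Rw2 := sys_runnable Sw2.
have := lie_null_run0 (anlM Dg Dh) (_ : runnable U S (u ++ (zip be s ++ zip be2 s2))) Igh.
rewrite catA => /(_ Rw2)/eqP; apply/negP; exact: mulf_neq0.
Qed.

(** Every runnable input extends the empty one, so the condition at the state reached by [u] is
    carried back to the initial state and from there to each reachable state. *)
Lemma lie_null_vanishing u g : anl D g -> sys u ->
  lie_null (fs u) g <-> forall x, reachable U S x -> g x = 0.
Proof.
move=> Dg Su; have nil_run v : runnable U S v -> lie_null (fs [::]) g <-> lie_null (fs v) g.
  by move=> Rv; have := @lie_null_run [::] v g Dg Rv.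
split=> [/(nil_run _ (sys_runnable Su)) H x [w /sys_runnable Rw <-]|H].
  by have := @lie_null_run0 [::] w g Dg Rw H.
apply: lie_null_of_null_after => // be Hbe.
have [e e0 He] := adm_small (sys_admissible NS finU) Su Hbe.
by exists e => // s ss Hs; apply: H; exists (u ++ zip be s) => //; exact: He.
Qed.

Lemma sys_nil : sys [::].
Proof. exact: adm_nil (sys_admissible NS finU). Qed.

Lemma short_input_nonzero A (eps : R) g : admissible U A -> 0 < eps -> anl D g ->
  ~ (forall x, reachable U S x -> g x = 0) ->
  exists u, [/\ sys u, A u, duration u < eps & g (fs u) != 0].
Proof.
move=> HA eps0 Dg /(lie_null_vanishing Dg sys_nil) ng.
have [be Hbe H] := not_lie_null Dg sys_nil ng.
have [e1 e10 H1] := adm_small (sys_admissible NS finU) sys_nil Hbe.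
have [e2 e20 H2] := adm_small HA (adm_nil HA) Hbe.
(* Dividing by one more than the number of letters keeps the total duration strictly below [eps]. *)
pose e3 := eps / (size be).+1%:R.
have e30 : 0 < e3 by rewrite divr_gt0.
pose e := Num.min (Num.min e1 e2) e3.
have e0 : 0 < e by rewrite !lt_min e10 e20.
have [s [ss Hs gs]] := H e e0.
have Hs' d : e <= d -> forall x, x \in s -> 0 <= x <= d.
  by move=> ed x /Hs/andP[h1 h2]; rewrite h1 (le_trans h2).
exists (zip be s); split=> //.
- by apply: H1 => //; apply: Hs'; rewrite !ge_min lexx.
- by apply: H2 => //; apply: Hs'; rewrite !ge_min lexx orbT.
rewrite duration_zip //.
apply: le_lt_trans (_ : \sum_(x <- s) e3 < _).
  rewrite big_seq [leRHS]big_seq; apply: ler_sum => x xs.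
  have ee3 : e <= e3 by rewrite ge_min lexx orbT.
  by have /andP[_ h] := Hs' e3 ee3 x xs.
rewrite big_const_seq count_predT iter_addr_0 ss -mulr_natr /e3 mulrAC ltr_pdivrMr //.
by rewrite ltr_pM2l // ltr_nat.
Qed.

Lemma nash_open_state : open D. Proof. exact: nash_system_open NS. Qed.

Lemma nash_semialgebraic : semialgebraic D. Proof. by case: NS => _ [_ []]. Qed.

Lemma nash_peval_at d (Phi : 'rV[R]_n -> 'rV[R]_d) (Q : mpoly (1 + d) R) g :
  nash D g -> nash_map D Phi -> nash D (fun x => peval_at Q (g x) (Phi x)).
Proof.
move=> ng nP; apply: (nash_pcomp Q nash_open_state nash_semialgebraic) => j.
apply: (@nash_eq R n D (fun x => if fintype.split j is inr k then Phi x ord0 k else g x) _ nash_open_state).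
  by move=> x _; rewrite mxE; case: fintype.split => // k; rewrite mxE (ord1 k) eqxx mulr1n.
by case: (fintype.split j) => [_|k]; [exact: ng|exact: nP].
Qed.

Lemma mpoly0_cst (P : mpoly 0 R) x : peval P x = 0 -> P = 0.
Proof.
have -> := @mderiv_eq0_const R 0 P ltac:(by case).
by rewrite pevalC => ->; rewrite mpoly.mpolyC0.
Qed.

(** An independent family of maximal length is taken. Prepending a further function, in the slot of
    the variable T, destroys independence, and the resulting relation is the [Q] sought. The empty
    family is independent because there is a reachable state. *)
Lemma step1_exists : exists (d : nat) (Phi : 'rV[R]_n -> 'rV[R]_d), step1 U S Phi.
Proof.
have [_ [cD [_ [_ [_ Dx]]]]] := NS.
pose I := vanishing_ideal U S.
pose indep d := exists Phi : 'rV[R]_n -> 'rV[R]_d, nash_map D Phi /\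
  forall P : mpoly d R, I (fun x => peval P (Phi x)) -> P = 0.
have i0 : exists d, `[< indep d >].
  exists 0%N; apply/asboolP; exists (fun=> 0); split; first by case.
  move=> P [_ /(_ (fs [::]))] h; apply: mpoly0_cst (h _); exists [::] => //; exact: sys_nil.
have ub d : `[< indep d >] -> (d <= n)%N.
  move=> /asboolP[Phi [nP iP]]; rewrite leqNgt; apply/negP => nd.
  have [P [P0 HP]] := nash_map_dependent nd nash_open_state cD Dx nP.
  apply: P0; apply: iP; split; first exact: nash_pcomp nash_open_state nash_semialgebraic nP.
  by move=> x [w /sys_runnable Rw <-]; apply: HP; exact: runnable_state Rw.
case: (ex_maxnP i0 ub) => d /asboolP[Phi [nP iP]] maxd.
exists d, Phi; split; [exact: nP|split; first exact: iP] => g ng.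
have /negP nd : ~~ (1 + d <= d)%N by rewrite -ltnNge.
have : ~ indep (1 + d)%N by move=> /asboolP/maxd.
move=> ni; apply: contrapT => nQ; apply: ni.
exists (fun x => row_mx ((g x)%:M : 'rV[R]_1) (Phi x)); split.
  move=> j; apply: (@nash_eq R n D (fun x => if fintype.split j is inr k then Phi x ord0 k else g x) _ nash_open_state).
    by move=> x _; rewrite mxE; case: fintype.split => // k; rewrite mxE (ord1 k) eqxx mulr1n.
  by case: (fintype.split j) => [_|k]; [exact: ng|exact: nP].
by move=> P IP; apply: contrapT => P0; apply: nQ; exists P.
Qed.

(** * Minimal polynomials and the choice of the input *)

Section Step2.
Variables (d : nat) (Phi : 'rV[R]_n -> 'rV[R]_d).
Variable (st1 : step1 U S Phi).

Lemma step1_nash : nash_map D Phi. Proof. by case: st1. Qed.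

Lemma step1_independent (P : mpoly d R) : (forall x, reachable U S x -> peval P (Phi x) = 0) -> P = 0.
Proof.
case: st1 => nP [iP _] H; apply: iP; split=> //.
exact: nash_pcomp nash_open_state nash_semialgebraic nP.
Qed.

Lemma step2_polynomials_exist : exists Q : 'I_n -> mpoly (1 + d) R, step2_polynomials U S Phi Q.
Proof.
have [nP [_ aP]] := st1.
suff /choice[Q HQ] : forall i, exists P : mpoly (1 + d) R, P <> 0 /\ annihilates U S Phi i P /\
    forall P', P' <> 0 -> annihilates U S Phi i P' -> (mpoly.msize P <= mpoly.msize P')%N by exists Q.
move=> i; pose ann k := exists P : mpoly (1 + d) R, [/\ P <> 0, annihilates U S Phi i P & mpoly.msize P = k].
have ex : exists k, `[< ann k >].
  have [Q [Q0 [_ IQ]]] := aP _ (nash_coord i nash_semialgebraic).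
  by exists (mpoly.msize Q); apply/asboolP; exists Q; split.
case: (ex_minnP ex) => k /asboolP[Q [Q0 aQ <-]] minQ.
by exists Q; split=> //; split=> // P P0 aP'; apply: minQ; apply/asboolP; exists P.
Qed.

(** In characteristic 0 a zero derivative means that the variable occurs in no monomial of [P]. *)
Lemma mderiv_eq0_indep k (P : mpoly k R) i (v w : 'I_k -> R) : mderiv i P = 0 ->
  (forall j, j != i -> v j = w j) -> meval v P = meval w P.
Proof.
move=> dP vw; rewrite !mpoly.mevalE; apply: eq_big_seq => mo moP; congr (_ * _).
apply: eq_bigr => j _; have [->|/vw -> //] := eqVneq j i.
suff -> : mo i = 0%N by rewrite !expr0.
apply/eqP; apply: contraLR moP => mi; rewrite -mpoly.mcoeff_eq0.
have lem : mpoly.lem (mpoly.mnm1 i) mo by rewrite mpoly.lep1mP.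
have := congr1 (mcoeff (mpoly.mnm_sub mo (mpoly.mnm1 i))) dP.
rewrite mpoly.mcoeff_mderiv mpoly.submK // mpoly.mcoeff0 => /eqP.
by rewrite mulrn_eq0.
Qed.

(** Otherwise [Q] does not involve T, and setting T to 0 yields a polynomial relation between the
    components of [Phi] alone, excluded by independence. *)
Lemma dT_neq0 i (Q : mpoly (1 + d) R) : Q <> 0 -> annihilates U S Phi i Q -> dT Q <> 0.
Proof.
move=> Q0 aQ dQ0; apply: Q0.
pose F (j : 'I_(1 + d)) : mpoly d R := if fintype.split j is inr k then mpolyX R (mpoly.mnm1 k) else 0.
have E t z : peval_at Q t z = peval (pcomp F Q) z.
  rewrite peval_pcomp; apply: mderiv_eq0_indep dQ0 _ => j jl; rewrite !mxE /F.
  case: splitP => [k jk|k jk]; last by rewrite peval_var.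
  by move: jl; rewrite -val_eqE /= jk (ord1 k).
have F0 : pcomp F Q = 0 by apply: step1_independent => x Rx; rewrite -(E (x ord0 i)); exact: aQ.
apply: (@polydisc_zero_poly R _ Q 0 1) => // y _.
have := E (y ord0 (lshift d ord0)) (rsubmx y); rewrite F0 [in RHS]/peval mpoly.meval0 => <-.
congr peval; rewrite -[LHS]hsubmxK; congr row_mx; apply/rowP => k.
by rewrite !mxE (ord1 k) eqxx mulr1n.
Qed.

(** [dT (Q i)] is nonzero and of smaller size than [Q i], so by minimality it does not annihilate.
    The ideal being prime, the product over all i is not in it either, and one short input serves
    every i. *)
Lemma step2_input_exists A (eps : R) (Q : 'I_n -> mpoly (1 + d) R) :
  admissible U A -> 0 < eps -> step2_polynomials U S Phi Q ->
  exists u, step2_input U A eps S Phi Q u.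
Proof.
move=> HA eps0 HQ.
pose h i (x : 'rV[R]_n) := peval_at (dT (Q i)) (x ord0 i) (Phi x).
have nh i : nash D (h i) by apply: nash_peval_at step1_nash; exact: nash_coord nash_semialgebraic.
have ah i : anl D (h i) := nash_anl nash_open_state (nh i).
have hI i : ~ lie_null (fs [::]) (h i).
  move=> /(lie_null_vanishing (ah i) sys_nil) hv.
  have [Q0 [aQ minQ]] := HQ i.
  have /minQ : dT (Q i) <> 0 by exact: dT_neq0 aQ.
  by move=> /(_ hv); rewrite leqNgt msize_mderiv //; exact/eqP.
have pa (s : seq 'I_n) : anl D (fun x => \prod_(i <- s) h i x).
  elim: s => [|i s IH].
    by rewrite (_ : (fun x => _) = fun=> 1); [exact: anl_cst|apply/funext => x; rewrite big_nil].
  rewrite (_ : (fun x => _) = fun x => h i x * \prod_(i <- s) h i x); first exact: anlM.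
  by apply/funext => x; rewrite big_cons.
have pI (s : seq 'I_n) : ~ lie_null (fs [::]) (fun x => \prod_(i <- s) h i x).
  elim: s => [|i s IH].
    by move=> /(_ [::]) H; have := H ltac:(by []); rewrite /= big_nil => /eqP; rewrite oner_eq0.
  rewrite (_ : (fun x => _) = fun x => h i x * \prod_(i <- s) h i x); last first.
    by apply/funext => x; rewrite big_cons.
  by move=> /(lie_null_prime (ah i) (pa s) sys_nil)[/hI|/IH].
have [|u [Su Au ue hu]] := short_input_nonzero HA eps0 (pa (enum 'I_n)).
  by move=> /(lie_null_vanishing (pa _) sys_nil)/pI.
exists u; split=> //; split=> //; split=> // i; apply/eqP.
by move: hu; rewrite prodf_seq_neq0 => /allP/(_ i (mem_enum _ _)).
Qed.

End Step2.

End VanishingIdeal.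

(** * Implicit functions *)

Section ImplicitFunction.
Variable (R : realType).

Lemma mpoly_alg_ind n (P : mpoly n R -> Prop) : (forall c, P (mpolyC n c)) ->
  (forall i, P (mpolyX R (mpoly.mnm1 i))) -> (forall p q, P p -> P q -> P (p + q)) ->
  (forall p q, P p -> P q -> P (p * q)) -> forall p, P p.
Proof.
move=> PC PX PD PM; apply: mpoly.mpolyind; first by rewrite -mpoly.mpolyC0; exact: PC.
move=> c mo p _ _ Pp; apply: (PD) => //; rewrite -mpoly.mul_mpolyC; apply: (PM); first exact: PC.
have P1 : P 1 by rewrite -mpoly.mpolyC1; exact: PC.
rewrite mpoly.mpolyXE_id; apply: (@big_ind _ P 1 *%R P1 PM) => i _.
by elim: (mo i) => [|k IH]; rewrite ?expr0 // exprS; exact: (PM).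
Qed.

Lemma mnm_sub_self n (mo : multinom n) : mpoly.mnm_sub mo mo = @mpoly.mnm0 n.
Proof. by apply/mpoly.mnmP => i; rewrite mpoly.mnmBE subnn mpoly.mnm0E. Qed.

Lemma pcompM n k (F : 'I_n -> mpoly k R) P Q : pcomp F (P * Q) = pcomp F P * pcomp F Q.
Proof. exact: (rmorphM (mmap (mpolyC k (R := R)) F)). Qed.

Lemma pcompD n k (F : 'I_n -> mpoly k R) P Q : pcomp F (P + Q) = pcomp F P + pcomp F Q.
Proof. exact: (raddfD (mmap (mpolyC k (R := R)) F)). Qed.

Lemma pcompC n k (F : 'I_n -> mpoly k R) c : pcomp F (mpolyC n c) = mpolyC k c.
Proof. exact: mpoly.mmapC. Qed.

Lemma pcompX n k (F : 'I_n -> mpoly k R) i : pcomp F (mpolyX R (mpoly.mnm1 i)) = F i.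
Proof. by rewrite /pcomp mpoly.mmapX mpoly.mmap1U. Qed.

Definition pshift n (a : 'rV[R]_n) : mpoly n R -> mpoly n R :=
  pcomp (fun j => mpolyX R (mpoly.mnm1 j) + mpolyC n (a ord0 j)).

Lemma peval_pshift n (a x : 'rV[R]_n) P : peval (pshift a P) x = peval P (a + x).
Proof.
rewrite peval_pcomp; congr peval; apply/rowP => j.
by rewrite !mxE pevalD peval_var pevalC addrC.
Qed.

Lemma mderiv_pshift n (a : 'rV[R]_n) P l : mderiv l (pshift a P) = pshift a (mderiv l P).
Proof.
elim/mpoly_alg_ind: P => [c|i|p q Hp Hq|p q Hp Hq]; rewrite /pshift.
- by rewrite pcompC !mpoly.mderivC -mpoly.mpolyC0 pcompC.
- rewrite pcompX mpoly.mderivD mpoly.mderivC addr0 mpoly.mderivX.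
  have [->|/negbTE il] := eqVneq l i; last first.
    by rewrite mpoly.mnm1E eq_sym il !scale0r -mpoly.mpolyC0 pcompC.
  by rewrite mpoly.mnm1E eqxx scale1r mnm_sub_self mpoly.mpolyX0 -mpoly.mpolyC1 pcompC.
- by rewrite pcompD !mpoly.mderivD Hp Hq pcompD.
by rewrite pcompM !mpoly.mderivM !(pcompM, pcompD) Hp Hq.
Qed.

Lemma mcoeff0_peval n (P : mpoly n R) : mcoeff (@mpoly.mnm0 n) P = peval P 0.
Proof.
elim/mpoly_alg_ind: P => [c|i|p q Hp Hq|p q Hp Hq].
- by rewrite pevalC mpoly.mcoeffC eqxx mulr1.
- by rewrite peval_var mxE mpoly.mcoeffX -mpoly.mdeg_eq0 mpoly.mdeg1.
- by rewrite mpoly.mcoeffD pevalD Hp Hq.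
by rewrite pevalM -Hp -Hq; exact: (rmorphM (mcoeff (@mpoly.mnm0 n))).
Qed.

Lemma mcoeff1_peval n (P : mpoly n R) i : mcoeff (mpoly.mnm1 i) P = peval (mderiv i P) 0.
Proof. by rewrite -mcoeff0_peval mpoly.mcoeff_mderiv mpoly.mnm0E mulr1n mpoly.add0m. Qed.

(* Weighted homogeneity: monomials of weight at least 2 shrink by a factor [rho ^+ 2]. *)
Lemma pnorm_scaled n (P : mpoly n R) l (rho : R) : 0 < rho <= 1 ->
  mcoeff (@mpoly.mnm0 n) P = 0 -> mcoeff (mpoly.mnm1 l) P = 0 ->
  pnorm 2 (pcomp (fun j => (if j == l then rho else rho ^+ 2) *: mpolyX R (mpoly.mnm1 j)) P)
    <= rho ^+ 2 * pnorm 2 P.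
Proof.
move=> /andP[r0 r1] c0 c1; rewrite /pcomp /mmap.
apply: le_trans (@pnorm_sum _ _ 2 _ _ _ _ (ler0n _ 2)) _; rewrite [in leRHS]/pnorm mulr_sumr.
rewrite big_seq [leRHS]big_seq; apply: ler_sum => mo moP.
rewrite mpoly.mul_mpolyC [leLHS]pnormZ [leRHS]mulrCA; apply: ler_wpM2l => //.
rewrite /mmap1 (eq_bigr (fun i => ((if i == l then rho else rho ^+ 2) ^+ mo i) *:
    (mpolyX R (mpoly.mnm1 i) ^+ mo i))) => [|i _]; last by rewrite exprZn.
rewrite scaler_prod -mpoly.mpolyXE_id [leLHS]pnormZ pnormX ler_wpM2r ?exprn_ge0 //.
have e0 i : 0 <= (if i == l then rho else rho ^+ 2) ^+ mo i.
  by apply: exprn_ge0; case: ifP => _; rewrite ?exprn_ge0 // ltW.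
rewrite ger0_norm; last by apply: prodr_ge0.
have w1 i : (if i == l then rho else rho ^+ 2) ^+ mo i <= 1.
  by apply: exprn_ile1; case: ifP => _; rewrite ?exprn_ge0 ?exprn_ile1 // ltW.
have [/existsP[j /andP[jl mj]]|] := boolP [exists j, (j != l) && (mo j != 0%N)].
  rewrite (bigD1 j) //= (negbTE jl) -[leRHS]mulr1; apply: ler_pM => //.
  - by rewrite -!exprM; apply: exprn_ge0; exact: ltW.
  - by apply: prodr_ge0.
  - rewrite -exprM; apply: ler_wiXn2l; rewrite ?(ltW r0) //.
    by rewrite leq_pmulr // lt0n.
  apply: le_trans (_ : \prod_(i < n | i != j) (1 : R) <= 1); last by rewrite big1_eq.
  by apply: ler_prod => i _; rewrite e0 w1.
rewrite negb_exists => /forallP H.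
have mE j : j != l -> mo j = 0%N by move=> jl; have := H j; rewrite jl negbK => /eqP.
rewrite (bigD1 l) //= eqxx big1 ?mulr1 => [|j jl]; last by rewrite (mE j jl) expr0.
apply: ler_wiXn2l; rewrite ?(ltW r0) //.
case E : (mo l) => [|[|k]] //.
  suff m0 : mo = @mpoly.mnm0 n by move: moP; rewrite m0 mpoly.mcoeff_msupp c0 eqxx.
  apply/mpoly.mnmP => j; rewrite mpoly.mnm0E; have [->|/mE] := eqVneq j l; [exact: E|by []].
suff m1 : mo = mpoly.mnm1 l by move: moP; rewrite m1 mpoly.mcoeff_msupp c1 eqxx.
by apply/mpoly.mnmP => j; rewrite mpoly.mnm1E eq_sym; have [->|/mE] := eqVneq j l; [exact: E|by []].
Qed.

Lemma inbox0_rV1 d (t : R) (w : 'rV[R]_d) (e : R) : `|t| <= e -> inbox 0 e w ->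
  inbox 0 e (row_mx (t%:M : 'rV[R]_1) w).
Proof.
move=> te we j; rewrite mxE; case: fintype.split => k.
  by rewrite !mxE (ord1 k) eqxx mulr1n subr0.
by have := we k; rewrite !mxE.
Qed.

(** Newton's iteration with frozen derivative, run on polynomials in z so that the solution is
    represented. The range of t on which the root is unique is part of the conclusion: it lets the
    graph of [G] be defined by [Q] itself. *)
Lemma poly_implicit_function d (Q : mpoly (1 + d) R) (t0 : R) (z0 : 'rV[R]_d) (rmax : R) :
  peval_at Q t0 z0 = 0 -> peval_at (dT Q) t0 z0 <> 0 -> 0 < rmax ->
  exists (rho sigma K : R) (G : 'rV[R]_d -> R),
    [/\ 0 < rho <= rmax, 0 < sigma, repr z0 sigma K G &
     forall z, inbox z0 sigma z -> `|G z - t0| < rho /\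
       forall t, `|t - t0| <= rho -> (peval_at Q t z = 0 <-> t = G z)].
Proof.
move=> Q0 /eqP; set c := peval_at (dT Q) t0 z0 => c0 rm0.
pose l : 'I_(1 + d) := lshift d ord0.
pose a : 'rV[R]_(1 + d) := row_mx (t0%:M : 'rV[R]_1) z0.
(* Zeros of [Q] near [a] become solutions of t = P(t, w), and [P] has neither a constant term nor a
   term linear in T. *)
pose P := mpolyX R (mpoly.mnm1 l) - c^-1 *: pshift a Q.
have P0 : mcoeff (@mpoly.mnm0 _) P = 0.
  rewrite mcoeff0_peval pevalB pevalZ peval_var mxE peval_pshift addr0.
  by rewrite [peval Q a]Q0 mulr0 subr0.
have P1 : mcoeff (mpoly.mnm1 l) P = 0.
  rewrite mcoeff1_peval mpoly.mderivB mpoly.mderivZ mderiv_pshift pevalB pevalZ peval_pshift addr0.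
  rewrite mpoly.mderivX mpoly.mnm1E eqxx scale1r mnm_sub_self mpoly.mpolyX0 -mpoly.mpolyC1 pevalC.
  by rewrite (_ : peval (mderiv l Q) a = c) // mulVf // subrr.
pose B := pnorm 2 P.
have B0 : 0 <= B by exact: pnorm_ge0.
pose rho := Num.min (Num.min 1 rmax) (4 * (B + 1))^-1.
have r0 : 0 < rho by rewrite !lt_min ltr01 rm0 invr_gt0; lra.
have r1 : rho <= 1 by rewrite !ge_min lexx.
have rm : rho <= rmax by rewrite !ge_min lexx orbT.
have rB : rho * B <= 4^-1.
  have h : rho <= (4 * (B + 1))^-1 by rewrite !ge_min lexx !orbT.
  apply: le_trans (ler_wpM2r B0 h) _; rewrite invfM -mulrA ger_pMr ?invr_gt0 //.
  by rewrite mulrC ler_pdivrMr ?mul1r; lra.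
(* T is rescaled by [rho] but the other variables by [rho ^+ 2], so that terms linear in the latter
   remain small after division by [rho]. Norm 1/4 at radius 2 makes t = P'(t, w) a contraction of
   ratio 1/4 at radius 1. *)
pose P' := rho^-1 *: pcomp (fun j => (if j == l then rho else rho ^+ 2) *: mpolyX R (mpoly.mnm1 j)) P.
have P'4 : pnorm 2 P' <= 4^-1.
  rewrite /P' pnormZ gtr0_norm ?invr_gt0 //; apply: le_trans rB.
  rewrite mulrC ler_pdivrMr // mulrAC -expr2; apply: pnorm_scaled => //; exact/andP.
have P'E t w : peval P' (row_mx (t%:M : 'rV[R]_1) w) =
    t - rho^-1 * c^-1 * peval_at Q (t0 + rho * t) (z0 + rho ^+ 2 *: w).
  rewrite /P' pevalZ peval_pcomp.
  have -> : (\row_i peval ((if i == l then rho else rho ^+ 2) *: mpolyX R (mpoly.mnm1 i))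
      (row_mx (t%:M : 'rV[R]_1) w)) = row_mx ((rho * t)%:M : 'rV[R]_1) (rho ^+ 2 *: w).
    apply/rowP => j; rewrite mxE pevalZ peval_var !mxE; case: splitP => i jE.
      have -> : j = l by apply/val_inj; rewrite /= jE (ord1 i).
      by rewrite !mxE eqxx (ord1 i) eqxx !mulr1n.
    by rewrite mxE -val_eqE /= jE.
  rewrite pevalB pevalZ peval_var peval_pshift row_mxEl mxE eqxx mulr1n mulrBr mulKf ?gt_eqF //.
  by rewrite mulrA /peval_at add_row_mx raddfD.
have lip t t' w : `|t| <= 1 -> `|t'| <= 1 -> inbox 0 1 w ->
    `|peval P' (row_mx (t%:M : 'rV[R]_1) w) - peval P' (row_mx (t'%:M : 'rV[R]_1) w)| <= `|t - t'| / 4.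
  move=> t1 t'1 w1.
  have := @repr_lipschitz R _ 0 2 1 (pnorm 2 P') `|t - t'| (fun x => peval P' (x - 0))
    (row_mx (t%:M : 'rV[R]_1) w) (row_mx (t'%:M : 'rV[R]_1) w) ltac:(lra) (normr_ge0 _) (repr_poly 0 2 P')
    (inbox0_rV1 t1 w1) (inbox0_rV1 t'1 w1).
  rewrite !subr0 => /(_ _) H; have {}H : `|peval P' (row_mx (t%:M : 'rV[R]_1) w) -
      peval P' (row_mx (t'%:M : 'rV[R]_1) w)| * (2 - 1) <= `|t - t'| * pnorm 2 P'.
    apply: H => j; rewrite !mxE; case: fintype.split => k; last by rewrite subrr normr0.
    by rewrite !mxE (ord1 k) eqxx !mulr1n.
  have := ler_wpM2l (normr_ge0 (t - t')) P'4; lra.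
pose F (phi : mpoly d R) (j : 'I_(1 + d)) : mpoly d R :=
  if fintype.split j is inr k then mpolyX R (mpoly.mnm1 k) else phi.
have Fb phi : pnorm 1 phi <= 1 -> forall j, pnorm 1 (F phi j) <= 1.
  by move=> h j; rewrite /F; case: fintype.split => k //; rewrite pnormX expr1n.
have Fe phi w : peval (pcomp (F phi) P') w = peval P' (row_mx ((peval phi w)%:M : 'rV[R]_1) w).
  rewrite peval_pcomp; congr peval; apply/rowP => j; rewrite !mxE /F.
  by case: fintype.split => k; rewrite ?peval_var // mxE (ord1 k) eqxx mulr1n.
pose phi : nat -> mpoly d R := fix phi (j : nat) : mpoly d R := if j is j'.+1 then pcomp (F (phi j')) P' else 0.
have phib j : pnorm 1 (phi j) <= 4^-1.
  elim: j => [|j IH] /=; first by rewrite pnorm0 invr_ge0.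
  apply: le_trans (pnorm_pcomp _ ler01 (Fb _ _)) _; first by apply: le_trans IH _; lra.
  by apply: le_trans (pnorm_le_radius _ _) P'4; apply/andP; split; lra.
have phib1 j : pnorm 1 (phi j) <= 1 by apply: le_trans (phib j) _; lra.
have phic (eta : R) : 0 < eta -> exists N, forall i j, (N <= i)%N -> (N <= j)%N ->
    pnorm 1 (phi i - phi j) <= eta.
  move=> eta0; have [N HN] := @contraction_cauchy R unit (fun _ i j => pnorm 1 (phi i - phi j)) 2
    (fun _ i j => le_trans (pnormB _ _ ler01) (lerD (phib1 i) (phib1 j)))
    ltac:(clear eta eta0; move=> eta eta0; exists 0%N => i j _ _ delta d0 /(_ tt) Hd _ /=;
      have := @pnorm_pcompB R _ _ (F (phi i)) (F (phi j)) 1 2 1 delta P' ler01 ler01 ltac:(lra) d0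
        (Fb _ (phib1 i)) (Fb _ (phib1 j)) ltac:(by move=> k; rewrite /F; case: fintype.split => k' //;
          rewrite subrr pnorm0); have := ler_wpM2l d0 P'4; lra) eta eta0.
  by exists N => i j; exact: HN tt i j.
have [g gP] := @aprx_cauchy R d 0 1 4^-1 phi ler01 phib phic.
have rg : repr 0 1 4^-1 g by exists phi.
have gb w : inbox 0 1 w -> `|g w| <= 4^-1 by exact: repr_bound ler01 rg.
have gfix w : inbox 0 1 w -> peval P' (row_mx ((g w)%:M : 'rV[R]_1) w) = g w.
  move=> w1; apply/eqP; rewrite -subr_eq0 -normr_eq0; apply/eqP/le_anti; rewrite normr_ge0 andbT.
  apply/ler_addgt0Pl => e e0; rewrite addr0; have [_ /(_ (e / 2))[|N HN]] := gP; first lra.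
  have [_ /(_ w w1)] := HN N (leqnn N); rewrite subr0 => h1.
  have [_ /(_ w w1)] := HN N.+1 (leqnSn N); rewrite subr0 /= Fe => h2.
  have h3 := lip (g w) (peval (phi N) w) w ltac:(by apply: le_trans (gb w w1) _; lra) _ w1.
  have {}h3 := h3 ltac:(apply: le_trans (phib1 N); rewrite -[w]subr0; exact: peval_le ler01 w1).
  set p1 := peval P' _ in h3 *; set p2 := peval P' _ in h3 h2.
  have -> : p1 - g w = (p1 - p2) - (g w - p2) by lra.
  apply: le_trans (ler_normB _ _) _; lra.
have guniq t w : `|t| <= 1 -> inbox 0 1 w -> peval P' (row_mx (t%:M : 'rV[R]_1) w) = t -> t = g w.
  move=> t1 w1 tE; have := lip t (g w) w t1 ltac:(by apply: le_trans (gb w w1) _; lra) w1.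
  rewrite tE gfix // => h; apply/eqP; rewrite -subr_eq0 -normr_eq0; apply/eqP/le_anti.
  by rewrite normr_ge0 andbT; lra.
have rr : 0 < rho ^+ 2 by rewrite exprn_gt0.
pose Z (z : 'rV[R]_d) : 'rV[R]_d := \row_i peval ((rho ^+ 2)^-1 *: mpolyX R (mpoly.mnm1 i)) (z - z0).
have ZE z i : Z z ord0 i = (rho ^+ 2)^-1 * (z ord0 i - z0 ord0 i).
  by rewrite mxE pevalZ peval_var !mxE.
have zZ z : z0 + rho ^+ 2 *: Z z = z.
  by apply/rowP => i; rewrite mxE [X in _ + X]mxE ZE mulVKf ?gt_eqF // addrC subrK.
pose sigma := rho ^+ 2 / 2.
have s0 : 0 < sigma by rewrite divr_gt0.
have Zb z : inbox z0 sigma z -> inbox 0 1 (Z z).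
  move=> zs i; rewrite ZE mxE subr0 normrM gtr0_norm ?invr_gt0 // mulrC ler_pdivrMr // mul1r.
  by apply: le_trans (zs i) _; rewrite /sigma; lra.
exists rho, sigma, (`|t0| + `|rho| * 4^-1), (fun z => t0 + rho * g (Z z)); split=> //.
- by rewrite r0.
- apply: reprD; [exact: ltW|exact: repr_cst|apply: reprM; [exact: ltW|exact: repr_cst|]].
  apply: (@repr_comp R d d 0 z0 2^-1 1 sigma 4^-1 g) => //; first exact: ltW.
    by apply/andP; split; lra.
  move=> i; have := repr_poly z0 sigma ((rho ^+ 2)^-1 *: mpolyX R (mpoly.mnm1 i)).
  rewrite pnormZ pnormX mpoly.mdeg1 expr1 gtr0_norm ?invr_gt0 // mulKf ?gt_eqF //.
  by apply: repr_ext => x _; rewrite mxE subr0.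
move=> z zs; have Z1 := Zb z zs; split.
  rewrite addrC addKr normrM gtr0_norm // gtr_pMr //; apply: le_lt_trans (gb _ Z1) _; lra.
move=> t tr; have tE : t = t0 + rho * ((t - t0) / rho) by rewrite mulrCA mulfV ?gt_eqF // mulr1 addrC subrK.
have Pt : peval P' (row_mx (((t - t0) / rho)%:M : 'rV[R]_1) (Z z)) =
    (t - t0) / rho - rho^-1 * c^-1 * peval_at Q t z by rewrite P'E zZ -tE.
have t1 : `|(t - t0) / rho| <= 1.
  by rewrite normrM [`|rho^-1|]gtr0_norm ?invr_gt0 // ler_pdivrMr // mul1r.
split=> [Qz|E].
  by rewrite {1}tE; congr (_ + _ * _); apply: guniq => //; rewrite Pt Qz mulr0 subr0.
have Eg : (t - t0) / rho = g (Z z).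
  by rewrite E addrC addKr mulrC mulKf ?gt_eqF.
move: Pt; rewrite Eg gfix // => /eqP; rewrite -subr_eq0 opprB addrC subrK => /eqP/eqP.
by rewrite !mulf_eq0 !invr_eq0 (gt_eqF r0) (negbTE c0) /= => /eqP.
Qed.

End ImplicitFunction.

(** * The local inverse *)

Section OpenBoxes.
Variable (R : realType).

Definition open_box n (a : 'rV[R]_n) (rho : 'I_n -> R) : set 'rV[R]_n :=
  [set x | forall i, `|x ord0 i - a ord0 i| < rho i].

Lemma open_box_open n (a : 'rV[R]_n) rho : open (open_box a rho).
Proof.
rewrite openE => x ax; rewrite /interior.
have [||e e0 He] := @seq_min_pos R _ (enum 'I_n) (fun i e => `|x ord0 i - a ord0 i| + e < rho i).
- move=> i _; exists ((rho i - `|x ord0 i - a ord0 i|) / 2); first by rewrite divr_gt0 ?subr_gt0.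
  by have := ax i; lra.
- by move=> i e e' _ ee' He; apply: le_lt_trans He; rewrite lerD2l.
have := inbox_nbhs x e0; apply: filterS => y xy i.
rewrite -[y ord0 i](subrK (x ord0 i)) -addrA; apply: le_lt_trans (ler_normD _ _) _.
have := xy i; have := He i (mem_enum _ _); lra.
Qed.

Lemma open_box_center n (a : 'rV[R]_n) rho : (forall i, 0 < rho i) -> open_box a rho a.
Proof. by move=> r0 i; rewrite subrr normr0. Qed.

(** The box is the union of the segments joining its centre to its points. *)
Lemma open_box_connected n (a : 'rV[R]_n) rho : (forall i, 0 < rho i) -> connected (open_box a rho).
Proof.
move=> r0; pose seg (x : 'rV[R]_n) := [set a + t *: (x - a) | t in `[(0 : R), 1]%classic].
have -> : open_box a rho = \bigcup_(x in open_box a rho) seg x.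
  apply/seteqP; split=> x.
    by move=> ax; exists x => //; exists 1; rewrite /= ?in_itv /= ?ler01 ?lexx // scale1r addrC subrK.
  move=> [y ay [t]]; rewrite /= in_itv /= => /andP[t0 t1] <- i.
  have -> : (a + t *: (y - a)) ord0 i - a ord0 i = t * (y ord0 i - a ord0 i) by rewrite !mxE; lra.
  rewrite normrM (ger0_norm t0); apply: le_lt_trans (ay i).
  by rewrite ler_piMl.
apply: bigcup_connected.
  exists a => x _; exists 0; rewrite /= ?in_itv /= ?lexx ?ler01 //.
  by rewrite scale0r addr0.
move=> x _; apply: connected_continuous_connected; first exact: segment_connected.
by have [//|] := @line_curve R n a (x - a) setT.
Qed.

Lemma semialgebraic_open_box n (a : 'rV[R]_n) rho : semialgebraic (open_box a rho).
Proof.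
apply: (@semialgebraic_erow _ _ _ (fun e => forall i : 'I_n, - rho i < e i - a ord0 i /\ e i - a ord0 i < rho i)).
  apply: dfn_forall_ord => i.
  have ti : tfn (fun e : nat -> R => e i - a ord0 i) by apply: tfnB; [exact: tfn_var|exact: tfn_cst].
  by apply: dfnI; apply: dfn_lt => //; exact: tfn_cst.
move=> x; split=> H i; have := H i; rewrite vget_ord ltr_norml; first by move=> /andP[].
by move=> [-> ->].
Qed.

Lemma differentiable_row n d (F : 'rV[R]_n -> 'rV[R]_d) x :
  (forall j, differentiable (fun x => F x ord0 j) x) -> differentiable F x.
Proof.
move=> dF; have -> : F = \sum_j (fun x => F x ord0 j *: (delta_mx ord0 j : 'rV[R]_d)).
  apply/funext => y; rewrite fct_sumE [LHS]row_sum_delta //.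
apply: differentiable_sum => j.
apply: (@differentiable_comp _ _ _ _ (fun x => F x ord0 j) ( *:%R^~ (delta_mx ord0 j : 'rV[R]_d))) => //.
Qed.

Lemma jacobianE n d (F : 'rV[R]_n -> 'rV[R]_d) x i j : differentiable F x ->
  jacobian F x i j = 'D_(delta_mx ord0 i) (fun x => F x ord0 j) x.
Proof.
move=> dF; have dFi : derivable F x (delta_mx ord0 i) by exact: diff_derivable.
by rewrite /jacobian mxE -deriveE // derive_mx // mxE.
Qed.

End OpenBoxes.

(** * Construction of V, W and G *)

Section Step3.
Variables (R : realType) (m n r : nat) (U : set 'rV[R]_m) (S : system R m n r).
Variable (NS : nash_system U S).
Variable (finU : finite_set U).
Local Notation D := (state_space S).
Local Notation f := (dynamics S).
Local Notation fs := (final_state S).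
Local Notation sys := (sys_inputs U S).

Lemma trajectory_prefix w v t : runnable U S (w ++ v) -> 0 <= t <= duration w ->
  trajectory S (w ++ v) t = trajectory S w t.
Proof.
move=> Rwv tw; have Rw := runnable_prefix Rwv.
have [/pc_cat[Hw Hv] _] := Rwv.
apply: (traj_unique NS Hw) tw; last exact: runnableP Rw.
by apply: traj_prefix (runnableP Rwv); exact: duration_ge0 Hv.
Qed.

Lemma final_state_last w al (q t : R) : runnable U S (w ++ [:: (al, q)]) -> 0 <= t <= q ->
  fs (w ++ [:: (al, t)]) = trajectory S (w ++ [:: (al, q)]) (duration w + t).
Proof.
move=> Rw /andP[t0 tq]; have [/pc_cat[Hw /pc_cons[Ua q0 _]] _] := Rw.
have w0 := duration_ge0 Hw; have tx := runnableP Rw.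
have q1 : 0 <= duration [:: (al, q)] by rewrite duration_cons duration_nil addr0.
rewrite (@final_stateE _ _ _ _ U S NS _ (trajectory S (w ++ [:: (al, q)]))) ?duration_rcons //.
  by apply/pc_cat; split=> //; exact: pc_seq1.
apply: traj_rcons => //; first exact: traj_prefix q1 tx.
by apply: curve_sub (traj_last w0 tx) => //; rewrite lerD2l.
Qed.

(** Step 3 speaks of the whole trajectory after [u]. Each intermediate state is the final state of a
    word with shorter durations, to which [sys_stay] applies. *)
Lemma sys_stay_trajectory u (be : seq 'rV[R]_m) (W : set 'rV[R]_n) : sys u ->
  (forall a, a \in be -> U a) -> nbhs (fs u) W ->
  exists2 eta : R, 0 < eta & forall s : seq R, size s = size be ->
    (forall x, x \in s -> 0 <= x <= eta) -> sys (u ++ zip be s) /\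
    forall t, 0 <= t <= duration (zip be s) -> W (trajectory S (u ++ zip be s) (duration u + t)).
Proof.
move=> Su; elim/last_ind: be W => [|be al IH] W Hbe Wu.
  exists 1 => // s /size0nil -> _; rewrite cats0; split=> // t.
  rewrite duration_nil => t0; have -> : t = 0 by apply/le_anti; rewrite andbC.
  by rewrite addr0; exact: nbhs_singleton Wu.
have Hbe' a : a \in be -> U a by move=> h; apply: Hbe; rewrite mem_rcons inE h orbT.
have [e1 e10 H1] := IH W Hbe' Wu.
have [e2 e20 H2] := sys_stay NS finU Su Hbe Wu.
have m0 : 0 < Num.min e1 e2 by rewrite lt_min e10.
exists (Num.min e1 e2) => // s; rewrite size_rcons; case/lastP: s => // s q; rewrite size_rcons => -[ss] Hs.
have Hs1 x : x \in s -> 0 <= x <= e1.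
  move=> xs; have /andP[-> h] := Hs x ltac:(by rewrite mem_rcons inE xs orbT).
  by apply: le_trans h _; rewrite ge_min lexx.
have Hq t : 0 <= t <= q -> forall x, x \in rcons s t -> 0 <= x <= e2.
  move=> /andP[t0 tq] x; rewrite mem_rcons inE => /predU1P[->|xs].
    rewrite t0; have /andP[_ h] := Hs q ltac:(by rewrite mem_rcons mem_head).
    by apply: le_trans tq (le_trans h _); rewrite ge_min lexx orbT.
  have /andP[-> h] := Hs x ltac:(by rewrite mem_rcons inE xs orbT).
  by apply: le_trans h _; rewrite ge_min lexx orbT.
have q0 : 0 <= q by have /andP[] := Hs q ltac:(by rewrite mem_rcons mem_head).
have E t : u ++ zip (rcons be al) (rcons s t) = (u ++ zip be s) ++ [:: (al, t)].
  by rewrite zip_rcons // -cats1 catA.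
have [_ W1] := H1 s ss Hs1.
have sz t : size (rcons s t) = size (rcons be al) by rewrite !size_rcons ss.
have [Sq _] := H2 _ (sz q) (Hq q ltac:(by rewrite q0 lexx)).
split=> // t; rewrite zip_rcons // -cats1 duration_rcons catA => /andP[t0 tq].
have Rq : runnable U S ((u ++ zip be s) ++ [:: (al, q)]) by rewrite -E; exact: sys_runnable Sq.
have u0 : 0 <= duration u by have [h _] := sys_runnable Su; exact: duration_ge0 h.
have [ts|ts] := leP t (duration (zip be s)).
  rewrite trajectory_prefix //; first by apply: W1; rewrite t0.
  by rewrite duration_cat lerD2l ts addr_ge0.
have tq' : 0 <= t - duration (zip be s) <= q by apply/andP; split; lra.
have -> : duration u + t = duration (u ++ zip be s) + (t - duration (zip be s)).
  by rewrite duration_cat; lra.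
rewrite -final_state_last // -E.
by have [] := H2 _ (sz _) (Hq _ tq').
Qed.

Section Density.
Variables (d : nat) (Phi : 'rV[R]_n -> 'rV[R]_d) (u : word R m).
Variable (st1 : step1 U S Phi).
Variable (Su : sys u).

Lemma step1_differentiable x : D x -> differentiable Phi x.
Proof.
move=> Dx; apply: differentiable_row => j.
by apply: anl_differentiable Dx; apply: nash_anl (nash_open_state NS) _; exact: (step1_nash st1).
Qed.

(* By independence of [Phi] the zero set of [g] lies in no hypersurface, so it contains a
   polydisc. *)
Lemma nash_zero_of_null_after (V : set 'rV[R]_d) g : open V -> connected V -> nash V g ->
  (forall be, (forall a, a \in be -> U a) -> exists2 eta : R, 0 < eta & forall s : seq R,
     size s = size be -> (forall x, x \in s -> 0 <= x <= eta) ->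
     V (Phi (fs (u ++ zip be s))) /\ g (Phi (fs (u ++ zip be s))) = 0) ->
  forall z, V z -> g z = 0.
Proof.
move=> oV cV ng H; have [_ sg] := ng.
have ag := nash_anl oV ng.
case: (semialgebraic_dichotomy (semialgebraic_zeros sg)) => [[a [rho [r0 bZ]]]|[P [P0 PZ]]].
  have aa : inbox a rho a by move=> i; rewrite subrr normr0 ltW.
  apply: (anl_identity (a := a)) => //; first by have [] := bZ a aa.
  by have := inbox_nbhs a r0; apply: filterS => x /bZ[].
exfalso; apply: P0; apply: (step1_independent NS st1).
have aP : anl D (fun x => peval P (Phi x)).
  apply: (@anl_comp R d n D setT) => // [|j]; first exact: anl_poly.
  by apply: nash_anl (nash_open_state NS) _; exact: (step1_nash st1).
apply/(lie_null_vanishing NS finU aP Su); apply: lie_null_of_null_after => // be Hbe.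
have [e e0 He] := H be Hbe.
by exists e => // s ss Hs; apply: PZ; exact: He.
Qed.

Lemma section_right_inverse (V : set 'rV[R]_d) (G : 'rV[R]_d -> 'rV[R]_n) :
  open V -> connected V -> nash_map V G -> (forall z, V z -> D (G z)) ->
  (forall be, (forall a, a \in be -> U a) -> exists2 eta : R, 0 < eta & forall s : seq R,
     size s = size be -> (forall x, x \in s -> 0 <= x <= eta) ->
     V (Phi (fs (u ++ zip be s))) /\ G (Phi (fs (u ++ zip be s))) = fs (u ++ zip be s)) ->
  semialgebraic V -> forall z, V z -> Phi (G z) = z.
Proof.
move=> oV cV nG GD H sV z Vz; apply/rowP => j; apply/eqP; rewrite -subr_eq0; apply/eqP.
pose g z := Phi (G z) ord0 j - z ord0 j.
have ng : nash V g.
  apply: nashB => //; last exact: nash_coord.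
  exact: (nash_comp oV (nash_open_state NS) sV GD (step1_nash st1 j) nG).
apply: (nash_zero_of_null_after oV cV ng) Vz => be Hbe.
have [e e0 He] := H be Hbe; exists e => // s ss Hs; have [h1 h2] := He s ss Hs.
by split=> //; rewrite /g h2 subrr.
Qed.

(** [G] collects the implicit roots of the [Q i], one coordinate at a time. At a reachable [x] the
    coordinates of [x] are themselves roots at [Phi x], so uniqueness of the root gives G (Phi x) =
    x. *)
Lemma step3_exists A (eps : R) (Q : 'I_n -> mpoly (1 + d) R) :
  step2_polynomials U S Phi Q -> step2_input U A eps S Phi Q u ->
  exists (V : set 'rV[R]_d) (W : set 'rV[R]_n) (G : 'rV[R]_d -> 'rV[R]_n),
     step3 U S Phi u V W G /\ forall i z, V z -> peval_at (Q i) (G z ord0 i) z = 0.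
Proof.
move=> HQ [_ [_ [_ Hu]]].
have oD := nash_open_state NS; have sD := nash_semialgebraic NS.
have nP := step1_nash st1.
set xu := fs u; set z0 := Phi xu.
have Dx : D xu := runnable_state (sys_runnable Su).
have [rmax rm0 bD] := nbhs_inbox (open_nbhs_nbhs (conj oD Dx)).
have reach x : reachable U S x -> forall i, peval_at (Q i) (x ord0 i) (Phi x) = 0.
  by move=> Rx i; have [_ [aQ _]] := HQ i; exact: aQ.
have /choice[rho /choice[sig /choice[K /choice[G GP]]]] : forall i, exists (rho sigma K : R) G,
    [/\ 0 < rho <= rmax, 0 < sigma, repr z0 sigma K G &
     forall z, inbox z0 sigma z -> `|G z - xu ord0 i| < rho /\
       forall t, `|t - xu ord0 i| <= rho -> (peval_at (Q i) t z = 0 <-> t = G z)].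
  by move=> i; apply: poly_implicit_function => //; apply: reach; exists u.
have r0 i : 0 < rho i by have [/andP[]] := GP i.
have [||s s0 Hs] := @seq_min_pos R _ (enum 'I_n) (fun i e => e <= sig i).
- by move=> i _; exists (sig i) => //; have [] := GP i.
- by move=> i e e' _ ee' /(le_trans ee').
have s2 : 0 < s / 2 by rewrite divr_gt0.
pose V := open_box z0 (fun=> s / 2).
have Vin z : V z -> forall i, inbox z0 (sig i) z.
  move=> Vz i j; have := Vz j; have := Hs i (mem_enum _ _); lra.
have oV : open V by exact: open_box_open.
have cV : connected V by apply: open_box_connected.
have sV : semialgebraic V by exact: semialgebraic_open_box.
pose B := open_box xu rho.
have BD x : B x -> D x.
  by move=> Bx; apply: bD => i; apply: le_trans (ltW (Bx i)) _; have [/andP[]] := GP i.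
(* Both conditions are required for the uniqueness of roots: [B] bounds the coordinates of x, and
   [V] the point at which the [Q i] are solved. *)
pose W : set 'rV[R]_n := [set x | B x /\ V (Phi x)].
have Bx : B xu by exact: open_box_center.
have Vz0 : V z0 by exact: open_box_center.
have oW : open W.
  rewrite openE => x [Bx' Vx]; rewrite /interior.
  have Pc : {for x, continuous Phi}.
    by apply: differentiable_continuous; apply: step1_differentiable; exact: BD.
  have h1 : nbhs x (Phi @^-1` V) by apply: Pc; exact: open_nbhs_nbhs.
  have h2 : nbhs x B by apply: open_nbhs_nbhs; split=> //; exact: open_box_open.
  exact: filterI h2 h1.
have sW : semialgebraic W.
  apply: semialgebraic_preimage (semialgebraic_open_box xu rho) sV _ => j.
  by have [_ h] := nP j; apply: semialgebraic_graph_sub (semialgebraic_open_box xu rho) BD h.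
pose GG (z : 'rV[R]_d) : 'rV[R]_n := \row_i G i z.
have BG z : V z -> B (GG z).
  by move=> Vz i; rewrite mxE; have [_ _ _ h] := GP i; have [] := h z (Vin z Vz i).
have root i z t : V z -> `|t - xu ord0 i| <= rho i -> peval_at (Q i) t z = 0 <-> t = G i z.
  by move=> Vz ht; have [_ _ _ h] := GP i; have [_] := h z (Vin z Vz i); exact.
have nG : nash_map V GG.
  apply: nash_map_row => i; split.
    apply: anl_analytic_on => z Vz; exists (s / 2), (K i); split=> //.
    have [_ _ rG _] := GP i; apply: repr_recenter rG; first exact: ltW.
    by move=> j; have := Vz j; have := Hs i (mem_enum _ _); lra.
  (* Over [V] the graph of [G i] is cut out by Q_i = 0 inside the box, where the root is unique. *)
  apply: semialgebraic_graph.
  apply: (@dfn_iff _ (fun e => V (erow d 0 e) /\ ((- rho i < e d - xu ord0 i /\ e d - xu ord0 i < rho i) /\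
      peval (Q i) (\row_j (if fintype.split j is inr k then e (0 + k)%N else e d)) = 0))).
    move=> e; have -> : peval (Q i) (\row_j (if fintype.split j is inr k then e (0 + k)%N else e d)) =
        peval_at (Q i) (e d) (erow d 0 e).
      congr peval; apply/rowP => j; rewrite !mxE; case: fintype.split => k; rewrite mxE //.
      by rewrite (ord1 k) eqxx mulr1n.
    split=> [[Vz [[h1 h2]]]|[Vz eG]].
      move=> Qz; split=> //; apply/(root i _ _ Vz) => //.
      by rewrite ltW // ltr_norml h1.
    have := BG _ Vz i; rewrite mxE -eG => h; split=> //.
    split; first by move: h; rewrite ltr_norml => /andP[].
    by apply/(root i _ _ Vz) => //; exact: ltW.
  apply: dfnI; first exact: dfn_erow sV.
  have tv : tfn (fun e : nat -> R => e d - xu ord0 i) by apply: tfnB; [exact: tfn_var|exact: tfn_cst].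
  apply: dfnI; first by apply: dfnI; apply: dfn_lt => //; exact: tfn_cst.
  apply: dfn_eq; last exact: tfn_cst.
  by apply: tfn_peval => j; case: fintype.split => k; exact: tfn_var.
have Ginv x : reachable U S x -> W x -> GG (Phi x) = x.
  move=> Rx [Bx' Vx]; apply/rowP => i; rewrite mxE; apply/esym/(root i _ _ Vx).
    by apply: ltW; exact: Bx'.
  exact: reach.
have Wn : nbhs xu W by apply: open_nbhs_nbhs.
(* This is what places [GG z] in [W], for points z that need not come from reachable states; it
   rests on the independence of [Phi]. *)
have PG z : V z -> Phi (GG z) = z.
  apply: section_right_inverse => // [w Vw|be Hbe]; first exact/BD/BG.
  have [e e0 He] := sys_stay NS finU Su Hbe Wn; exists e => // t st Ht.
  have [S1 W1] := He t st Ht; split; first by case: W1.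
  by apply: Ginv => //; exists (u ++ zip be t).
exists V, W, GG; split; last first.
  move=> i z Vz; rewrite mxE; apply/(root i _ _ Vz) => //.
  by have := BG z Vz i; rewrite mxE; exact: ltW.
do 5 (split; first by []); split; first by move=> x [/BD].
split=> //; split.
  by move=> z Vz; split; [exact: BG|rewrite PG].
split=> //; split=> // v Sv HW.
have Rv := sys_runnable Sv.
have [/pc_cat[Hu' Hv] _] := Rv.
have v0 := duration_ge0 Hv.
have Wf : W (fs (u ++ v)).
  by rewrite /final_state duration_cat; apply: HW; rewrite v0 lexx.
by split; [case: Wf|apply: Ginv => //; exists (u ++ v)].
Qed.

End Density.

End Step3.

(** * The system on V *)

Section Jets.
Variable (R : realType).

(** Mixed derivative in the durations, at duration 0, along a multiflow: the field followed first is
    the outermost derivation. *)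
Definition iter_lies n (Xs : seq ('rV[R]_n -> 'rV[R]_n)) (ks : seq nat) (g : 'rV[R]_n -> R) : 'rV[R]_n -> R :=
  foldr (fun c h => iter c.2 (lie c.1) h) g (zip Xs ks).

Definition same_jet n1 n2 (Xs : seq ('rV[R]_n1 -> 'rV[R]_n1)) (Ys : seq ('rV[R]_n2 -> 'rV[R]_n2))
    (g : 'rV[R]_n1 -> R) (h : 'rV[R]_n2 -> R) x y : Prop :=
  forall ks, size ks = size Xs -> iter_lies Xs ks g x = iter_lies Ys ks h y.

(* [x s] is the point reached from [x [::]] by following the fields [Xs] for the times [s]. *)
Fixpoint multiflow n (D : set 'rV[R]_n) (eta : R) (Xs : seq ('rV[R]_n -> 'rV[R]_n))
    (x : seq R -> 'rV[R]_n) : Prop :=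
  if Xs is X :: Xs' then
    [/\ field_anl D X, curve X D 0 eta (fun t => x [:: t]), x [:: 0] = x [::] &
        forall t, 0 <= t <= eta -> multiflow D eta Xs' (fun s => x (t :: s))]
  else True.

Lemma iter_lies_anl n (D : set 'rV[R]_n) (eta : R) Xs x ks g : 0 <= eta -> multiflow D eta Xs x -> anl D g ->
  anl D (iter_lies Xs ks g).
Proof.
move=> e0; rewrite /iter_lies; elim: Xs x ks => [|X Xs IH] x [|k ks] //= [DX _ _ H] Dg.
by apply: anl_iter_lie DX; apply: IH Dg; apply: (H 0); rewrite lexx.
Qed.

(** At each value t of the first duration the jets in the remaining ones agree by induction, and
    this equality of functions of t is differentiated at 0. *)
Lemma same_jet_of_eq n1 n2 (D : set 'rV[R]_n1) (E : set 'rV[R]_n2) (eta : R) Xs Ys g h x y :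
  0 < eta -> anl D g -> anl E h -> size Xs = size Ys ->
  multiflow D eta Xs x -> multiflow E eta Ys y ->
  (forall s : seq R, size s = size Xs -> (forall z, z \in s -> 0 <= z <= eta) -> g (x s) = h (y s)) ->
  same_jet Xs Ys g h (x [::]) (y [::]).
Proof.
move=> e0 Dg Eh; elim: Xs Ys x y => [|X Xs IH] [|Y Ys] x y // szE.
  by move=> _ _ H [|//] _; apply: H.
move: szE => [szE] [DX cx x0 fx] [EY cy y0 fy] H [|k ks] // [ks_sz].
have e00 : 0 <= (0 : R) <= eta by rewrite lexx ltW.
have gD : anl D (iter_lies Xs ks g) by apply: (iter_lies_anl _ (ltW e0) (fx 0 e00)).
have hE : anl E (iter_lies Ys ks h) by apply: (iter_lies_anl _ (ltW e0) (fy 0 e00)).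
have := curves_agree_lie DX EY gD hE cx cy e0 _ k e00.
rewrite x0 y0; apply=> t te; apply: (IH Ys (fun s => x (t :: s)) (fun s => y (t :: s))) ks_sz => //.
- exact: fx.
- exact: fy.
move=> s ss Hs; apply: H => [|z]; first by rewrite /= ss.
by rewrite inE => /predU1P[->//|]; exact: Hs.
Qed.

Lemma same_jet_curve n1 n2 (D : set 'rV[R]_n1) (E : set 'rV[R]_n2) (a b t0 : R) X Xs Y Ys g h x y :
  field_anl D X -> field_anl E Y ->
  (forall ks, anl D (iter_lies Xs ks g)) -> (forall ks, anl E (iter_lies Ys ks h)) ->
  curve X D a b x -> curve Y E a b y -> a <= t0 <= b ->
  same_jet (X :: Xs) (Y :: Ys) g h (x t0) (y t0) ->
  forall t, a <= t <= b -> same_jet (X :: Xs) (Y :: Ys) g h (x t) (y t).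
Proof.
move=> DX EY gD hE cx cy t0ab J t tab [|k ks] // [ks_sz].
apply: (curves_agree DX EY (gD ks) (hE ks) cx cy t0ab) tab => i.
by apply: (J (i :: ks)); rewrite /= ks_sz.
Qed.

(** Converse of [same_jet_of_eq]: the jets agree along the first curves, and their entries of order
    0 in the first field are the jets for the remaining fields. *)
Lemma eq_of_same_jet n1 n2 (D : set 'rV[R]_n1) (E : set 'rV[R]_n2) (eta : R) Xs Ys g h x y :
  0 <= eta -> anl D g -> anl E h ->
  multiflow D eta Xs x -> multiflow E eta Ys y -> size Xs = size Ys ->
  same_jet Xs Ys g h (x [::]) (y [::]) ->
  forall s : seq R, size s = size Xs -> (forall z, z \in s -> 0 <= z <= eta) -> g (x s) = h (y s).
Proof.
move=> e0 Dg Eh; elim: Xs Ys x y => [|X Xs IH] [|Y Ys] x y //.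
  by move=> _ _ _ /(_ [::] erefl) J [|//] _ _.
move=> [DX cx x0 fx] [EY cy y0 fy] [szE] J [|t s] // [ss] Hs.
have te : 0 <= t <= eta by apply: Hs; rewrite mem_head.
have e00 : 0 <= (0 : R) <= eta by rewrite lexx.
have gD ks : anl D (iter_lies Xs ks g) by apply: (iter_lies_anl _ e0 (fx 0 e00)).
have hE ks : anl E (iter_lies Ys ks h) by apply: (iter_lies_anl _ e0 (fy 0 e00)).
have := same_jet_curve DX EY gD hE cx cy e00 _ te; rewrite x0 y0 => /(_ J) Jt.
apply: (IH Ys (fun s => x (t :: s)) (fun s => y (t :: s)) (fx t te) (fy t te) szE) => //.
  by move=> ks ks_sz; apply: (Jt (0%N :: ks)); rewrite /= ks_sz.
by move=> z zs; apply: Hs; rewrite inE zs orbT.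
Qed.

(** Durations are treated as states of R^k: lengthening the i-th one means following a constant unit
    field, so partial derivatives of the extension of [p] are Lie derivatives too. *)
Definition unit_field k (i : nat) : 'rV[R]_k -> 'rV[R]_k := fun=> \row_j (nat_of_ord j == i)%:R.

(** Missing durations are 0: a shorter list describes the moment at which the later letters have not
    begun. *)
Definition time_point k (q : seq R) : 'rV[R]_k := \row_(i < k) nth 0 q i.

Lemma unit_field_anl k i D : field_anl D (@unit_field k i).
Proof. by move=> j; exact: anl_cst. Qed.

Lemma time_point_rcons k q (t : R) : time_point k (rcons q t) = time_point k q + t *: @unit_field k (size q) 0.
Proof.
apply/rowP => j; rewrite !mxE nth_rcons; case: ltngtP => [jq|jq|->].
- by rewrite mulr0 addr0.
- by rewrite nth_default ?mulr0 ?addr0 // ltnW.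
by rewrite nth_default // add0r mulr1.
Qed.

Lemma time_point_cat0 k q (s : seq R) : (forall x, x \in s -> x = 0) -> time_point k (q ++ s) = time_point k q.
Proof.
move=> s0; apply/rowP => j; rewrite !mxE nth_cat; case: ltnP => // qj.
rewrite [RHS]nth_default //; have [js|js] := ltnP (j - size q)%N (size s); last by rewrite nth_default.
by apply: s0; rewrite mem_nth.
Qed.

Lemma time_point_curve k q (a b : R) (D : set 'rV[R]_k) :
  (forall t, a <= t <= b -> D (time_point k (rcons q t))) ->
  curve (@unit_field k (size q)) D a b (fun t => time_point k (rcons q t)).
Proof.
move=> HD; have H t : is_derive t (1 : R) (fun t => time_point k (rcons q t)) (@unit_field k (size q) (time_point k (rcons q t))).
  rewrite (_ : (fun t => _) = cst (time_point k q) + ( *:%R^~ (@unit_field k (size q) 0))); last first.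
    by apply/funext => s; rewrite time_point_rcons.
  by have := is_deriveD (is_derive_cst (time_point k q) t (1 : R)) (is_derive_scale (@unit_field k (size q) 0) t); rewrite add0r.
split=> //.
by apply: derivable_within_continuous => t _; have [] := H t.
Qed.

Lemma time_multiflow k (D : set 'rV[R]_k) (eta : R) l q : 0 <= eta ->
  (forall s : seq R, size s = l -> (forall z, z \in s -> 0 <= z <= eta) -> D (time_point k (q ++ s))) ->
  multiflow D eta [seq @unit_field k i | i <- iota (size q) l] (fun s => time_point k (q ++ s)).
Proof.
move=> e0; elim: l q => //= l IH q H; split.
- exact: unit_field_anl.
- have -> : (fun t => time_point k (q ++ [:: t])) = (fun t => time_point k (rcons q t)).
    by apply/funext => t; rewrite cats1.
  apply: time_point_curve => t te; rewrite -(@time_point_cat0 _ _ (nseq l 0)); last by move=> x /nseqP[].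
  rewrite cat_rcons; apply: H; first by rewrite /= size_nseq.
  by move=> z; rewrite inE => /predU1P[->//|/nseqP[-> _]]; rewrite lexx.
- by rewrite cats0 time_point_cat0 // => x; rewrite inE => /eqP.
move=> t te; have := IH (rcons q t); rewrite size_rcons.
have -> : (fun s => time_point k (rcons q t ++ s)) = (fun s => time_point k (q ++ t :: s)).
  by apply/funext => s; rewrite cat_rcons.
apply=> s ss Hs; rewrite cat_rcons; apply: H; first by rewrite /= ss.
by move=> z; rewrite inE => /predU1P[->//|]; exact: Hs.
Qed.

End Jets.

Lemma state_multiflow (R : realType) (m n r : nat) (U : set 'rV[R]_m) (S : system R m n r) (eta : R) be w :
  nash_system U S -> 0 <= eta ->
  (forall s : seq R, size s = size be -> (forall z, z \in s -> 0 <= z <= eta) -> runnable U S (w ++ zip be s)) ->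
  multiflow (state_space S) eta [seq dynamics S a | a <- be] (fun s => final_state S (w ++ zip be s)).
Proof.
move=> NS e0; elim: be w => //= a be IH w H.
have R0 t : 0 <= t <= eta -> runnable U S (w ++ [:: (a, t)]).
  move=> te; have := H (t :: nseq (size be) 0); rewrite /= size_nseq => /(_ erefl) H'.
  apply: (@runnable_prefix _ _ _ _ _ _ _ (zip be (nseq (size be) 0))); rewrite -catA; apply: H'.
  by move=> z; rewrite inE => /predU1P[->//|/nseqP[-> _]]; rewrite lexx.
have [Ua _ cx x0] := runnable_curve NS (R0 eta ltac:(by rewrite e0 lexx)).
split.
- exact: (nash_system_field NS Ua).
- by move: cx; case: (be).
- by rewrite cats0 -x0; case: (be).
move=> t te; have := IH (w ++ [:: (a, t)]).
have -> : (fun s => final_state S ((w ++ [:: (a, t)]) ++ zip be s)) =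
          (fun s => final_state S (w ++ (a, t) :: zip be s)) by apply/funext => s; rewrite -catA.
apply=> s ss Hs; rewrite -catA; apply: (H (t :: s)); first by rewrite /= ss.
by move=> z; rewrite inE => /predU1P[->//|]; exact: Hs.
Qed.

(** As in [adm_small], but the letter before the appended ones may take any duration up to slightly
    more than its own. *)
Lemma adm_small_after (R : realType) (m : nat) (U : set 'rV[R]_m) (B : set (word R m)) w a (t : R) be :
  admissible U B -> B (w ++ [:: (a, t)]) -> (forall b, b \in be -> U b) ->
  exists2 eta : R, 0 < eta & forall (t1 : R) (s : seq R), 0 <= t1 <= t + eta -> size s = size be ->
    (forall x, x \in s -> 0 <= x <= eta) -> B (w ++ (a, t1) :: zip be s).
Proof.
move=> HB Bu Hbe; have /pc_cat[/pc_unzip[_ w0] _] := adm_pc HB Bu.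
pose z := nseq (size be) (0 : R).
have E (t1 : R) s : w ++ (a, t1) :: zip be s = zip ([seq b.1 | b <- w] ++ a :: be) ([seq b.2 | b <- w] ++ t1 :: s).
  by rewrite zip_cat ?size_map // word_zip.
have Bz : B (w ++ (a, t) :: zip be z).
  rewrite -cat1s catA; apply/(adm_zeros _ HB) => //.
    by apply: pc_zip => // x; rewrite mem_nseq => /andP[_ /eqP ->].
  move=> b; rewrite /z; elim: (be) => //= c l IH; rewrite inE => /predU1P[->//|]; exact: IH.
rewrite E in Bz; have [|e e0 H] := adm_perturb HB _ Bz.
  by rewrite !size_cat /= !size_map size_nseq.
exists e => // t1 s /andP[t10 t1e] ss Hs; rewrite E; apply: H; rewrite !size_cat /= !size_map size_nseq ?ss //.
move=> i iu; rewrite !nth_cat size_map; case: ltnP => iu'.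
  have h : 0 <= nth 0 [seq b.2 | b <- w] i by apply: w0; rewrite mem_nth // size_map.
  by rewrite h /=; lra.
have : (i - size w < (size be).+1)%N by rewrite -(ltn_add2l (size w)) subnKC.
case: (i - size w)%N => [_|k kl] /=; first by rewrite t10.
by rewrite nth_nseq if_same add0r; apply: Hs; rewrite mem_nth // ss.
Qed.

(** * The system on V: short trajectories and reachability *)

Section Step4.
Variables (R : realType) (m n r d : nat) (U : set 'rV[R]_m) (S : system R m n r).
Variable (NS : nash_system U S).
Variable (finU : finite_set U).
Variables (Phi : 'rV[R]_n -> 'rV[R]_d) (u : word R m).
Variable (st1 : step1 U S Phi).
Variable (Su : sys_inputs U S u).
Variables (V : set 'rV[R]_d) (W : set 'rV[R]_n) (G : 'rV[R]_d -> 'rV[R]_n).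
Variable (st3 : step3 U S Phi u V W G).
Local Notation D := (state_space S).
Local Notation f := (dynamics S).
Local Notation fs := (final_state S).
Local Notation SV := (step4 S Phi u V G).

Lemma step3_section (be : seq 'rV[R]_m) : (forall a, a \in be -> U a) ->
  exists2 eta : R, 0 < eta & forall s : seq R, size s = size be ->
    (forall x, x \in s -> 0 <= x <= eta) ->
    [/\ sys_inputs U S (u ++ zip be s), V (Phi (fs (u ++ zip be s))) &
        G (Phi (fs (u ++ zip be s))) = fs (u ++ zip be s)].
Proof.
move=> Hbe; have [_ [_ [_ [oW [_ [_ [_ [_ [_ [Wu H]]]]]]]]]] := st3.
have [e e0 He] := sys_stay_trajectory NS finU Su Hbe (open_nbhs_nbhs (conj oW Wu)).
exists e => // s ss Hs; have [S1 W1] := He s ss Hs.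
by have [h1 h2] := H _ S1 W1.
Qed.

Lemma step3_state z : V z -> D (G z).
Proof. by have [_ [_ [_ [_ [_ [WD [_ [VW _]]]]]]]] := st3; move=> /VW/WD. Qed.

Lemma step4_nash_system : nash_system U SV.
Proof.
have [oV [cV [sV [_ [_ [WD [nG [VW [Vz _]]]]]]]]] := st3.
have oD := nash_open_state NS; have sD := nash_semialgebraic NS.
have nP := step1_nash st1.
have [_ [_ [_ [nf [nh _]]]]] := NS.
split=> //; split=> //; split=> //; split; last split=> //.
  move=> al Ua j.
  pose g x := \sum_i f al x ord0 i * 'D_(delta_mx ord0 i) (fun x => Phi x ord0 j) x.
  apply: (@nash_eq R d V (fun z => g (G z)) _ oV) => [z Vz'|].
    rewrite /= mxE; apply: eq_bigr => i _; rewrite jacobianE //.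
    by apply: (step1_differentiable NS st1); exact: step3_state.
  apply: (nash_comp oV oD sV step3_state _ nG).
  by apply: nash_sum => // i; apply: nashM => //; [exact: nf|exact: nash_partial].
move=> j; exact: (nash_comp oV oD sV step3_state (nh j) nG).
Qed.

(** Chain rule: the velocity of Phi(x) is f(x) times the Jacobian at x, and x = G (Phi x) turns this
    into a function of Phi(x) alone. *)
Lemma step4_curve al (b : R) x : U al -> curve (f al) D 0 b x ->
  (forall t, 0 <= t <= b -> V (Phi (x t)) /\ G (Phi (x t)) = x t) ->
  curve (dynamics SV al) V 0 b (fun t => Phi (x t)).
Proof.
move=> Ua [xc xD xd] H; split.
- apply: (within_continuous_comp xc) => t tb.
  by apply: differentiable_continuous; apply: (step1_differentiable NS st1); exact: xD.
- by move=> t /H[].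
move=> t tb; have tb' : 0 <= t <= b by case/andP: tb => h1 h2; rewrite !ltW.
have dP := step1_differentiable NS st1 (xD t tb').
have [_ GP] := H t tb'.
rewrite /= GP -deriveEjacobian //; exact: is_derive_comp_diff dP (xd t tb).
Qed.

Lemma step4_small (be : seq 'rV[R]_m) : (forall a, a \in be -> U a) ->
  exists2 eta : R, 0 < eta & forall s : seq R, size s = size be ->
    (forall x, x \in s -> 0 <= x <= eta) ->
    runnable U SV (zip be s) /\ final_state SV (zip be s) = Phi (fs (u ++ zip be s)).
Proof.
elim/last_ind: be => [_|be al IH Hbe].
  exists 1 => // s /size0nil -> _; rewrite cats0; split; first exact: runnable_nil step4_nash_system.
  exact: final_state_nil step4_nash_system.
have Ua : U al by apply: Hbe; rewrite mem_rcons mem_head.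
have [a|e1 e10 H1] := IH; first by move=> h; apply: Hbe; rewrite mem_rcons inE h orbT.
have [e2 e20 H2] := step3_section Hbe.
have m0 : 0 < Num.min e1 e2 by rewrite lt_min e10.
exists (Num.min e1 e2) => // s; rewrite size_rcons; case/lastP: s => // s q; rewrite size_rcons => -[ss] Hs.
have Hs1 x : x \in s -> 0 <= x <= e1.
  move=> xs; have /andP[-> h] := Hs x ltac:(by rewrite mem_rcons inE xs orbT).
  by apply: le_trans h _; rewrite ge_min lexx.
have Hq t : 0 <= t <= q -> forall x, x \in rcons s t -> 0 <= x <= e2.
  move=> /andP[t0 tq] x; rewrite mem_rcons inE => /predU1P[->|xs].
    rewrite t0; have /andP[_ h] := Hs q ltac:(by rewrite mem_rcons mem_head).
    by apply: le_trans tq (le_trans h _); rewrite ge_min lexx orbT.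
  have /andP[-> h] := Hs x ltac:(by rewrite mem_rcons inE xs orbT).
  by apply: le_trans h _; rewrite ge_min lexx orbT.
have /andP[q0 _] := Hs q ltac:(by rewrite mem_rcons mem_head).
have qq : 0 <= q <= q by rewrite q0 lexx.
have E t : u ++ zip (rcons be al) (rcons s t) = (u ++ zip be s) ++ [:: (al, t)].
  by rewrite zip_rcons // -cats1 catA.
have sz t : size (rcons s t) = size (rcons be al) by rewrite !size_rcons ss.
have [R1 F1] := H1 s ss Hs1.
have [Sq _ _] := H2 _ (sz q) (Hq q qq); rewrite E in Sq.
have [_ _ cx x0] := runnable_curve NS (sys_runnable Sq).
have cV := step4_curve Ua cx (fun t tq => ltac:(by have [_ h1 h2] := H2 _ (sz t) (Hq t tq); rewrite -E)).
have [|R2 F2] := runnable_rcons step4_nash_system R1 Ua q0 cV; first by rewrite x0 F1.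
by rewrite E zip_rcons // -cats1; split=> //; exact: F2.
Qed.

Lemma step4_reachable : semialgebraically_reachable U SV.
Proof.
move=> g ng H; have [oV [cV _]] := st3.
apply: (nash_zero_of_null_after NS finU st1 Su oV cV ng) => be Hbe.
have NV := step4_nash_system; have adm := sys_admissible NV finU.
have [e1 e10 H1] := step4_small Hbe.
have [e2 e20 H2] := step3_section Hbe.
have [e3 e30 H3] := adm_small adm (adm_nil adm) Hbe.
exists (Num.min (Num.min e1 e2) e3); first by rewrite !lt_min e10 e20.
move=> s ss Hs.
have Hs' e : Num.min (Num.min e1 e2) e3 <= e -> forall x, x \in s -> 0 <= x <= e.
  by move=> le x /Hs/andP[-> h]; exact: le_trans le.
have [_ F1] := H1 s ss (Hs' e1 ltac:(by rewrite !ge_min lexx)).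
have [_ V2 _] := H2 s ss (Hs' e2 ltac:(by rewrite !ge_min lexx orbT)).
have S3 := H3 s ss (Hs' e3 ltac:(by rewrite !ge_min lexx orbT)).
by split=> //; rewrite -F1; apply: H; exists (zip be s).
Qed.

End Step4.

Lemma near_between (R : realType) (t t' s ts e : R) : `|t - ts| < e / 4 -> `|t' - ts| < e / 4 ->
  Num.min t t' <= s <= Num.max t t' -> `|s - ts| <= e / 2.
Proof.
rewrite !ltr_norml ler_norml ge_min le_max.
by move=> /andP[? ?] /andP[? ?] /andP[/orP[?|?] /orP[?|?]]; apply/andP; split; lra.
Qed.

(** * The system on V realizes the shifted response map *)

Section Step4Realization.
Variables (R : realType) (m n r d : nat) (U : set 'rV[R]_m) (S : system R m n r).
Variables (A : set (word R m)) (p : word R m -> 'rV[R]_r).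
Variable (finU : finite_set U).
Variable (HA : admissible U A).
Variable (Hp : response_map U A p).
Variable (HS : local_realization U A p S).
Variables (Phi : 'rV[R]_n -> 'rV[R]_d) (u : word R m).
Variable (st1 : step1 U S Phi).
Variable (Su : sys_inputs U S u).
Variable (Au : A u).
Variables (V : set 'rV[R]_d) (W : set 'rV[R]_n) (G : 'rV[R]_d -> 'rV[R]_n).
Variable (st3 : step3 U S Phi u V W G).
Local Notation SV := (step4 S Phi u V G).
Local Notation fV := (final_state SV).

Let NS : nash_system U S := proj1 HS.
Let NV : nash_system U SV := step4_nash_system NS st1 st3.

(** Agreement at [v] alone would not propagate: the next letter is reached through all derivatives
    in the durations of later letters, and these are recovered from short continuations by arbitrary
    lists [be]. *)
Definition agree_after (j : 'I_r) (v : word R m) : Prop :=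
  forall be, (forall b, b \in be -> U b) -> exists2 eta : R, 0 < eta & forall s : seq R,
    size s = size be -> (forall x, x \in s -> 0 <= x <= eta) ->
    p (u ++ v ++ zip be s) ord0 j = output SV (fV (v ++ zip be s)) ord0 j.

Lemma agree_after_nil j : agree_after j [::].
Proof.
move=> be Hbe.
have [e1 e10 H1] := step4_small NS finU st1 Su st3 Hbe.
have [e2 e20 H2] := step3_section NS finU Su st3 Hbe.
have [e3 e30 H3] := adm_small HA Au Hbe.
exists (Num.min (Num.min e1 e2) e3); first by rewrite !lt_min e10 e20.
move=> s ss Hs.
have Hs' e : Num.min (Num.min e1 e2) e3 <= e -> forall x, x \in s -> 0 <= x <= e.
  by move=> le x /Hs/andP[-> h]; exact: le_trans le.
have [_ F1] := H1 s ss (Hs' e1 ltac:(by rewrite !ge_min lexx)).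
have [S2 _ G2] := H2 s ss (Hs' e2 ltac:(by rewrite !ge_min lexx orbT)).
have A3 := H3 s ss (Hs' e3 ltac:(by rewrite !ge_min lexx orbT)).
by rewrite /= F1 G2; have [_ ->] := HS.
Qed.

(** For a fixed continuation [be], agreement is moved from duration 0 to duration [T] of the letter
    [a] by [segment_ind]. Each local move turns agreement into equality of jets, transports the jets
    along [a], and turns them back into agreement. *)
Lemma agree_after_rcons j v a (T : R) : agree_after j v -> A (u ++ v ++ [:: (a, T)]) ->
  sys_inputs U SV (v ++ [:: (a, T)]) -> agree_after j (v ++ [:: (a, T)]).
Proof.
move=> gv Av Sv be Hbe.
have admV := sys_admissible NV finU.
have [/pc_cat[Hv /pc_cons[Ua T0 _]] _] := sys_runnable Sv.
have [e0 e00 HT] := adm_extend_last admV T0 Sv.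
(* [P t] looks only to the right of t, which makes sense at both ends: at 0 durations are
   nonnegative, and at [T] the letter can be prolonged a little. *)
pose P t := exists2 eta : R, 0 < eta & forall (t1 : R) s, t <= t1 <= t + eta -> size s = size be ->
  (forall x, x \in s -> 0 <= x <= eta) ->
  p (u ++ v ++ (a, t1) :: zip be s) ord0 j = output SV (fV (v ++ (a, t1) :: zip be s)) ord0 j.
suff [eta eta0 He] : P T.
  exists eta => // s ss Hs; rewrite -!catA /=; apply: He => //; rewrite lexx; lra.
have Hbe' b : b \in a :: be -> U b by rewrite inE => /predU1P[->|/Hbe].
have P0 : P 0.
  have [e ep He] := gv _ Hbe'; exists e => // t1 s; rewrite add0r => t1e ss Hs.
  apply: (He (t1 :: s)); first by rewrite /= ss.
  by move=> x; rewrite inE => /predU1P[->//|]; exact: Hs.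
pose w := u ++ v; pose N := size w; pose l := size be.
pose al := [seq b.1 | b <- w] ++ a :: be; pose dw := [seq b.2 | b <- w].
pose k := (N + l.+1)%N.
have sdw : size dw = N by rewrite size_map.
have sal : size al = k by rewrite size_cat size_map.
pose alw (i : 'I_k) := nth 0 al i.
have mkE (q : seq R) : size q = l.+1 -> mk_word alw (time_point k (dw ++ q)) = w ++ zip (a :: be) q.
  move=> sq; rewrite mk_wordE // ?size_cat ?sdw ?sq //.
  by rewrite /al zip_cat ?size_map // word_zip.
have Aw : A (w ++ [:: (a, T)]) by rewrite /w -catA.
have Uw b : b \in al -> U b.
  rewrite mem_cat => /orP[/mapP[c cw ->]|/Hbe' //].
  by have /pc_cat[/(_ c cw)[]] := adm_pc HA Aw.
have ana : analytic_on [set t : 'rV[R]_k | A (mk_word alw t)] (fun t => p (mk_word alw t) ord0 j).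
  apply: (Hp.2 k alw); first by rewrite /k addnS.
  by move=> i; apply: Uw; rewrite mem_nth // sal.
pose H z := output SV z ord0 j.
have aH : anl V H by apply: nash_anl (nash_system_open NV) _; have [_ [_ [_ [_ [h _]]]]] := NV; exact: h.
have T0T : 0 <= T <= T by rewrite T0 lexx.
have z0T : 0 <= (0 : R) <= T by rewrite lexx.
apply: (@segment_ind R 0 T P 0 z0T P0 _ T T0T) => ts tsT.
have inA t : 0 <= t <= T -> A (w ++ [:: (a, t)]) by move=> tT; exact: adm_shrink_last HA tT Aw.
pose c := time_point k (dw ++ [:: ts]).
have cA : A (mk_word alw c).
  have [e ep He] := adm_small_after HA (inA ts tsT) Hbe.
  have -> : c = time_point k (dw ++ ts :: nseq l 0).
    by rewrite -cat_rcons -cats1 time_point_cat0 // => x /nseqP[].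
  rewrite mkE /= ?size_nseq //; apply: He; rewrite ?size_nseq //.
    by case/andP: tsT => -> _; rewrite lerDl ltW.
  by move=> x /nseqP[-> _]; rewrite lexx ltW.
(* Extension of [p] in all durations near [c], where [a] lasts [ts] and the letters of [be] last 0.
   Such a point may be a corner, so [gh] equals [p] only at admissible durations. *)
have [gh [rho [K [r0 rg ghE]]]] := analytic_on_repr ana cA.
pose Dm := inbox c (rho / 2).
have aD : anl Dm gh := anl_polydisc r0 rg.
have Db (t1 : R) s : `|t1 - ts| <= rho / 2 -> (forall x, x \in s -> `|x| <= rho / 2) ->
    Dm (time_point k (dw ++ t1 :: s)).
  move=> ht Hs i; rewrite !mxE !nth_cat; have r2 : 0 <= rho / 2 by rewrite divr_ge0 // ltW.
  case: ifP => _; first by rewrite subrr normr0.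
  case: (i - size dw)%N => [//|q] /=; rewrite nth_nil subr0.
  by have [qs|qs] := ltnP q (size s); [apply: Hs; rewrite mem_nth|rewrite nth_default // normr0].
pose Xs := [seq @unit_field R k i | i <- iota N l.+1].
pose Ys := [seq dynamics SV b | b <- a :: be].
(* Both flows start with [a] already followed for the time t, and the first duration is added to
   it. *)
pose X t (s : seq R) := time_point k (dw ++ if s is s0 :: s' then (t + s0) :: s' else [:: t]).
pose Y t (s : seq R) := fV (v ++ if s is s0 :: s' then (a, t + s0) :: zip be s' else [:: (a, t)]).
(* Stated for all smaller [eta], since at the starting time it must also fit the range on which
   agreement is already known. *)
have near (t : R) : 0 <= t <= T -> `|t - ts| < rho / 4 -> exists2 eta0 : R, 0 < eta0 &
    forall eta : R, 0 < eta -> eta <= eta0 -> [/\ multiflow Dm eta Xs (X t), multiflow V eta Ys (Y t) &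
      forall (t1 : R) s, t <= t1 <= t + eta -> size s = l -> (forall x, x \in s -> 0 <= x <= eta) ->
        p (u ++ v ++ (a, t1) :: zip be s) ord0 j = gh (time_point k (dw ++ t1 :: s))].
  move=> tT tts; have /andP[t0 tT'] := tT.
  have SVt : sys_inputs U SV (v ++ [:: (a, t)]) by apply: HT; rewrite t0; lra.
  have [eA eA0 HeA] := adm_small_after HA (inA t tT) Hbe.
  have [eV eV0 HeV] := adm_small_after admV SVt Hbe.
  exists (Num.min (Num.min eA eV) (rho / 8)); first by rewrite !lt_min eA0 eV0 divr_gt0.
  move=> eta eta0; rewrite !le_min => /andP[/andP[etaA etaV] etar].
  have tDb (t1 : R) s : t <= t1 <= t + eta -> (forall x, x \in s -> 0 <= x <= eta) ->
      Dm (time_point k (dw ++ t1 :: s)).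
    move=> /andP[tt1 t1e] Hs; apply: Db.
      by move: tts; rewrite ltr_norml ler_norml => /andP[h1 h2]; apply/andP; split; lra.
    by move=> x /Hs/andP[x0 xe]; rewrite ger0_norm //; lra.
  split.
  - split.
    + exact: unit_field_anl.
    + rewrite /X; have -> : (fun t2 : R => time_point k (dw ++ [:: t + t2])) =
          (fun t2 : R => time_point k (rcons dw (t2 + t))) by apply/funext => t2; rewrite cats1 addrC.
      apply: (@curve_shift _ _ _ _ 0 eta t (fun t2 => time_point k (rcons dw t2))).
      rewrite add0r [eta + t]addrC -sdw; apply: time_point_curve => t1 ht1.
      by rewrite -cats1; apply: tDb.
    + by rewrite /X addr0.
    move=> t2 t2e; rewrite /X.
    have -> : (fun s => time_point k (dw ++ (t + t2) :: s)) = (fun s => time_point k (rcons dw (t + t2) ++ s)).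
      by apply/funext => s; rewrite cat_rcons.
    have -> : N.+1 = size (rcons dw (t + t2)) by rewrite size_rcons sdw.
    apply: time_multiflow => [|s ss Hs]; first exact: ltW.
    by rewrite cat_rcons; apply: tDb => //; rewrite lerDl lerD2l.
  - have Rt1 (t1 : R) s : t <= t1 <= t + eta -> size s = l -> (forall x, x \in s -> 0 <= x <= eta) ->
        runnable U SV (v ++ (a, t1) :: zip be s).
      move=> /andP[tt1 t1e] ss Hs; apply: sys_runnable; apply: HeV => //.
        by apply/andP; split; [exact: le_trans tt1|lra].
      by move=> x /Hs/andP[-> h]; exact: le_trans etaV.
    have Rte : runnable U SV (v ++ [:: (a, t + eta)]).
      apply: (@runnable_prefix _ _ _ _ _ _ _ (zip be (nseq l 0))); rewrite -catA; apply: Rt1.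
      + by rewrite lerDl lexx ltW.
      + by rewrite size_nseq.
      by move=> x /nseqP[-> _]; rewrite lexx ltW.
    have [_ _ cy _] := runnable_curve NV Rte.
    split.
    + exact: (nash_system_field NV Ua).
    + rewrite /Y; have E2 : (fun t2 : R => fV (v ++ (a, t + t2) :: zip be (nil : seq R))) =
          (fun t2 : R => fV (v ++ [:: (a, t2 + t)])).
        by apply/funext => t2; rewrite addrC; case: (be).
      rewrite E2; apply: (@curve_shift _ _ _ _ 0 eta t (fun t2 => fV (v ++ [:: (a, t2)]))).
      by rewrite add0r [eta + t]addrC; exact: curve_sub cy.
    + by rewrite /Y addr0; case: (be).
    move=> t2 t2e; rewrite /Y.
    have -> : (fun s => fV (v ++ (a, t + t2) :: zip be s)) = (fun s => fV ((v ++ [:: (a, t + t2)]) ++ zip be s)).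
      by apply/funext => s; rewrite -catA.
    apply: (state_multiflow NV (ltW eta0)) => s ss Hs; rewrite -catA; apply: Rt1 => //.
    by rewrite lerDl lerD2l.
  move=> t1 s ht1 ss Hs; have /andP[tt1 t1e] := ht1.
  have At1 : A (w ++ zip (a :: be) (t1 :: s)).
    apply: HeA => //; first by apply/andP; split; [exact: le_trans tt1|lra].
    by move=> x /Hs/andP[-> h]; exact: le_trans etaA.
  have -> : u ++ v ++ (a, t1) :: zip be s = mk_word alw (time_point k (dw ++ t1 :: s)).
    by rewrite mkE /= ?ss // /w -catA.
  apply: ghE; first by rewrite /= mkE //= ss.
  by move=> i; apply: le_trans (tDb t1 s ht1 Hs i) _; lra.
exists (rho / 4); first by rewrite divr_gt0.
move=> t t' tT t'T tts t'ts [e1 e10 H1].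
have szXY : size Xs = size Ys by rewrite !size_map size_iota.
have [e2 e20 H2] := near t tT tts.
pose eta := Num.min e1 e2.
have eta0 : 0 < eta by rewrite lt_min e10.
have ee1 : eta <= e1 by rewrite ge_min lexx.
have ee2 : eta <= e2 by rewrite ge_min lexx orbT.
have [fX fY ghP] := H2 eta eta0 ee2.
have Jt : same_jet Xs Ys gh H (X t [::]) (Y t [::]).
  apply: (same_jet_of_eq eta0 aD aH szXY fX fY) => -[//|s0 s].
  rewrite size_map size_iota => -[ss] Hs.
  have /andP[s00 s0e] : 0 <= s0 <= eta by apply: Hs; rewrite mem_head.
  have Hs' x : x \in s -> 0 <= x <= eta by move=> xs; apply: Hs; rewrite inE xs orbT.
  rewrite /X /Y -ghP //; last by rewrite lerDl lerD2l s00.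
  apply: H1 => //; first by rewrite lerDl lerD2l s00 (le_trans s0e).
  by move=> x /Hs'/andP[-> h]; exact: le_trans ee1.
(* The jets are transported over the interval between t and t', in either order: the durations move
   along a unit field, the state of [Sigma_V] along the letter [a]. *)
have Jt' : same_jet Xs Ys gh H (X t' [::]) (Y t' [::]).
  pose lo := Num.min t t'; pose hi := Num.max t t'.
  have [lot lot'] : lo <= t /\ lo <= t' by rewrite /lo !ge_min !lexx orbT.
  have [thi t'hi] : t <= hi /\ t' <= hi by rewrite /hi !le_max !lexx orbT.
  have /andP[t0 tT'] := tT; have /andP[t'0 t'T'] := t'T.
  have lo0 : 0 <= lo by rewrite le_min t0.
  have hiT : hi <= T by rewrite ge_max tT'.
  have [_ _ cy _] := runnable_curve NV (sys_runnable Sv).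
  have cx : curve (@unit_field R k N) Dm lo hi (fun t2 => time_point k (rcons dw t2)).
    rewrite -sdw; apply: time_point_curve => t2 /andP[l2 h2]; rewrite -cats1; apply: Db => //.
    by apply: near_between tts t'ts _; rewrite l2.
  have gD ks : anl Dm (iter_lies (behead Xs) ks gh).
    have [_ _ _ /(_ 0) h] := fX.
    by apply: (iter_lies_anl _ (ltW eta0) (h _) aD); rewrite lexx ltW.
  have hV ks : anl V (iter_lies (behead Ys) ks H).
    have [_ _ _ /(_ 0) h] := fY.
    by apply: (iter_lies_anl _ (ltW eta0) (h _) aH); rewrite lexx ltW.
  have := same_jet_curve (@unit_field_anl R k N Dm) (nash_system_field NV Ua) gD hV cx (curve_sub lo0 hiT cy) (t0 := t).
  rewrite -!cats1 lot thi => /(_ isT Jt t'); rewrite -cats1 lot' t'hi; exact.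
have [e3 e30 H3] := near t' t'T t'ts.
have [fX' fY' ghP'] := H3 e3 e30 (lexx _).
exists e3 => // t1 s ht1 ss Hs; rewrite ghP' //.
have /andP[t't1 t1e] := ht1.
(* The first duration is counted from t', hence the difference t1 - t'. *)
have := eq_of_same_jet (ltW e30) aD aH fX' fY' szXY Jt' (s := (t1 - t') :: s).
rewrite /X /Y [t' + _]addrC subrK; apply; first by rewrite size_map size_iota /= ss.
move=> x; rewrite inE => /predU1P[->|/Hs //]; apply/andP; split; lra.
Qed.

Lemma step4_local_realization : local_realization U (shift_dom A u) (shift_map p u) SV.
Proof.
split=> [|v [_ Auv] Sv]; first exact: NV.
suff main j : agree_after j v.
  apply/rowP => j; have [e e0 He] := main j [::] ltac:(by []).
  by have := He [::] erefl; rewrite !cats0; apply.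
have admV := sys_admissible NV finU.
elim/last_ind: v Auv Sv => [_ _|v [a T] IH]; first exact: agree_after_nil.
rewrite -cats1 => Auv Sv; apply: agree_after_rcons => //; apply: IH.
  by apply: (adm_prefix HA (v := [:: (a, T)])); rewrite -catA.
exact: adm_prefix admV Sv.
Qed.

End Step4Realization.

Unset Implicit Arguments.

Theorem mainTheorem2 (R : realType) (m n r : nat) (U : set 'rV[R]_m)
    (A : set (word R m)) (p : word R m -> 'rV[R]_r)
    (S : system R m n r) (eps : R) :
  finite_set U ->
  admissible U A ->
  response_map U A p ->
  has_negative_extension U A p ->
  local_realization U A p S ->
  0 < eps ->
  (exists (d : nat) (Phi : 'rV[R]_n -> 'rV[R]_d), step1 U S Phi) /\
  forall (d : nat) (Phi : 'rV[R]_n -> 'rV[R]_d), step1 U S Phi ->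
  (exists Q : 'I_n -> mpoly.mpoly (1 + d) R, step2_polynomials U S Phi Q) /\
  forall Q : 'I_n -> mpoly.mpoly (1 + d) R, step2_polynomials U S Phi Q ->
  (exists u : word R m, step2_input U A eps S Phi Q u) /\
  forall u : word R m, step2_input U A eps S Phi Q u ->
  (exists (V : set 'rV[R]_d) (W : set 'rV[R]_n) (G : 'rV[R]_d -> 'rV[R]_n),
     step3 U S Phi u V W G /\
     forall i z, V z -> peval_at (Q i) (G z ord0 i) z = 0) /\
  forall (V : set 'rV[R]_d) (W : set 'rV[R]_n) (G : 'rV[R]_d -> 'rV[R]_n),
     step3 U S Phi u V W G ->
     local_realization U (shift_dom A u) (shift_map p u) (step4 S Phi u V G) /\
     semialgebraically_reachable U (step4 S Phi u V G).
Proof.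
move=> finU HA Hp _ HS eps0; have NS := HS.1.
split; first exact: step1_exists NS finU.
move=> d Phi st1; split; first exact (step2_polynomials_exist NS st1).
move=> Q HQ; split; first exact (step2_input_exists NS finU st1 HA eps0 HQ).
move=> u st2; have [Su [Au _]] := st2; split; first exact (step3_exists NS finU st1 Su HQ st2).
move=> V W G st3; split; last exact (step4_reachable NS finU st1 Su st3).
exact (step4_local_realization finU HA Hp HS st1 Su Au st3).
Qed.
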